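(* Let $\varepsilon>0$ be small, let $\Theta_\varepsilon=(-1+\varepsilon,\varepsilon^{-1})\times[0,1]$, and consider the parametric family of preferential attachment functions $f_{\alpha,\beta}(k)=(k+\alpha)^\beta$, $(\alpha,\beta)\in\Theta_\varepsilon$. Let the preferential attachment tree be generated with true parameter $(\alpha_0,1)\in\Theta_\varepsilon$, let $(\hat\alpha_n,\hat\beta_n)$ be the maximum likelihood estimator over $\Theta_\varepsilon$, and let $$T_n=\frac{n^{1/2}(\hat\beta_n-1)}{\bigl((V_{\hat\alpha_n,1}^{-1})_{2,2}\bigr)^{1/2}},$$ where $V_{\hat\alpha_n,1}$ is the matrix $V_{\alpha,\beta}$ evaluated at $(\alpha,\beta)=(\hat\alpha_n,1)$. Then, as $n\to\infty$, $T_n$ converges in distribution to $Z\,1_{\{Z\le0\}}$, where $Z$ is a standard normal variable.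
   Context: Preferential attachment (PA) tree with PA function $f:\mathbb{N}_+\to(0,\infty)$: at time $1$ there is a single node $v_1$, of degree $1$ (a root with a loose edge). Given the tree at time $n$ with nodes $v_1,\dots,v_n$ of degrees $d_1(n),\dots,d_n(n)$, a new node $v_{n+1}$ of degree $1$ is attached by an edge to the node $v_i$ with conditional probability $f(d_i(n))/\sum_{j=1}^n f(d_j(n))$ given the past; the degree of the chosen node increases by $1$. $N_k(n)$ is the number of nodes of degree $k$ at time $n$, $P_{>k}(n)=\frac1n\sum_{l>k}N_l(n)$, and $S_h(n)=\sum_kh(k)N_k(n)$. The maximum likelihood estimator is a maximizer over the parameter set of $\iota_n(f_\theta)=\sum_{k=1}^\infty\log f_\theta(k)\,P_{>k}(n)-\frac1n\sum_{t=2}^n\log S_{f_\theta}(t-1)$, with $\theta=(\alpha,\beta)$. For $(\alpha,\beta)$, let $p_k=\frac{\lambda^*}{\lambda^*+f(k)}\prod_{j=1}^{k-1}\frac{f(j)}{\lambda^*+f(j)}$ with $f=f_{\alpha,\beta}$ and $\lambda^*>0$ the solution of $\sum_{l\ge1}\prod_{k=1}^l\frac{f(k)}{\lambda^*+f(k)}=1$ (limiting degree distribution). Then $$V_{\alpha,\beta}=\frac1{a^2}\begin{pmatrix}ab-c^2&ad-ce\\ ad-ce&ag-e^2\end{pmatrix},$$ with $a=\sum_kp_kf(k)$, $b=\sum_kp_kf(k)\frac{\beta^2}{(k+\alpha)^2}$, $c=\sum_kp_kf(k)\frac{\beta}{k+\alpha}$, $d=\sum_kp_kf(k)\frac{\beta}{k+\alpha}\log(k+\alpha)$,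 $e=\sum_kp_kf(k)\log(k+\alpha)$, $g=\sum_kp_kf(k)\log^2(k+\alpha)$. *)

(* Defs.v *)
From HB Require Import structures.
From mathcomp Require Import all_boot all_order all_algebra.
From mathcomp Require Import all_classical all_reals all_analysis.

Set Implicit Arguments.
Unset Strict Implicit.
Unset Printing Implicit Defensive.

Import Order.TTheory GRing.Theory Num.Theory.
Import numFieldNormedType.Exports.

Local Open Scope classical_set_scope.
Local Open Scope ring_scope.

Section tree.

(* A growing tree with nodes v_1, v_2, ... is encoded by its attachment
   history [c : nat -> nat]: for t >= 1, the node v_(t+1) is attached to v_(c t)
   (the value [c 0] is irrelevant).  The tree at time n has the nodes
   v_1, ..., v_n and is determined by c 1, ..., c (n - 1). *)
Variable c : nat -> nat.

(* Each node is born with degree 1: the loose edge of the root v_1, or the edge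
   from v_i, i > 1, to its parent. *)
Definition degree (n i : nat) : nat := (1 + \sum_(1 <= t < n) (c t == i))%N.

Definition num_deg (n k : nat) : nat :=
  (\sum_(1 <= i < n.+1) (degree n i == k))%N.

Variable R : realType.

(* The degrees at time n are between 1 and n, so the sums over all k or l in the
   next three definitions stop at n; moreover P_(>n)(n) = 0. *)
Definition tail_prop (n k : nat) : R :=
  n%:R^-1 * \sum_(k.+1 <= l < n.+1) (num_deg n l)%:R.

Definition tot_weight (h : nat -> R) (n : nat) : R :=
  \sum_(1 <= k < n.+1) h k * (num_deg n k)%:R.

Definition loglik (n : nat) (f : nat -> R) : R :=
  \sum_(1 <= k < n.+1) ln (f k) * tail_prop n k
  - n%:R^-1 * \sum_(2 <= t < n.+1) ln (tot_weight f t.-1).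

End tree.

Section parametric_family.
Variable R : realType.

Definition pa_fun (alpha beta : R) (k : nat) : R := (k%:R + alpha) `^ beta.

Definition Theta (eps : R) : set (R * R) :=
  [set th | -1 + eps < th.1 < eps^-1 /\ 0 <= th.2 <= 1].

Definition maximizes (eps : R) (c : nat -> nat) (n : nat) (th : R * R) : Prop :=
  Theta eps th /\
  forall th', Theta eps th' ->
    loglik c n (pa_fun th'.1 th'.2) <= loglik c n (pa_fun th.1 th.2).

(* As Theta_eps is not closed, the supremum need not be attained on some trees
   (e.g. when v_1 has degree 3 at time 3); there the estimator may be any point
   of Theta_eps.  Ties between several maximizers are broken arbitrarily. *)
Definition is_MLE (eps : R) (c : nat -> nat) (n : nat) (th : R * R) : Prop :=
  Theta eps th /\ ((exists th', maximizes eps c n th') -> maximizes eps c n th).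

End parametric_family.

Section limit_quantities.
Variable R : realType.

Definition pos_series (u : nat -> R) : R :=
  limn (fun n => \sum_(1 <= k < n.+1) u k).

(* [xget 0 A] is an element of A if there is one, and 0 otherwise; here the
   solution is unique, as each product is decreasing in lam > 0. *)
Definition lambda_star (f : nat -> R) : R :=
  xget 0 [set lam : R | 0 < lam /\
    (fun n => \sum_(1 <= l < n.+1) \prod_(1 <= k < l.+1) (f k / (lam + f k)))
      @ \oo --> (1 : R)].

Definition limit_deg (f : nat -> R) (k : nat) : R :=
  let lam := lambda_star f in
  lam / (lam + f k) * \prod_(1 <= j < k) (f j / (lam + f j)).

Definition V_matrix (alpha beta : R) : 'M[R]_2 :=
  let f := pa_fun alpha beta in
  let S (u : nat -> R) := pos_series (fun k => limit_deg f k * f k * u k) in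
  let a := S (fun=> 1) in
  let b := S (fun k => beta ^+ 2 / (k%:R + alpha) ^+ 2) in
  let c := S (fun k => beta / (k%:R + alpha)) in
  let d := S (fun k => beta / (k%:R + alpha) * ln (k%:R + alpha)) in
  let e := S (fun k => ln (k%:R + alpha)) in
  let g := S (fun k => ln (k%:R + alpha) ^+ 2) in
  (a ^+ 2)^-1 *: \matrix_(i < 2, j < 2)
    (if i == 0 then if j == 0 then a * b - c ^+ 2 else a * d - c * e
     else if j == 0 then a * d - c * e else a * g - e ^+ 2).

(* The entries of a 2 x 2 matrix are indexed by 0 and 1, so that (V^-1)_(2,2)
   is [invmx V 1 1]. *)
Definition test_stat (n : nat) (alphahat betahat : R) : R :=
  Num.sqrt n%:R * (betahat - 1) /
  Num.sqrt (invmx (V_matrix alphahat 1) 1 1).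

End limit_quantities.

Section probability.
Variable R : realType.

(* Conditional probabilities given the past are multiplied out: given any
   history h up to time n (the parents of v_2, ..., v_n), the node v_(n+1)
   attaches to v_i with probability proportional to f (degree of v_i).  Summing
   over i shows that c n is almost surely in {1, ..., n}. *)
Definition is_PA_tree d (Omega : measurableType d) (P : probability Omega R)
    (f : nat -> R) (c : nat -> {RV P >-> nat}) : Prop :=
  forall (n : nat) (h : nat -> nat) (i : nat), (1 <= i <= n)%N ->
    P [set w | (forall t, (1 <= t < n)%N -> c t w = h t) /\ c n w = i] =
    ((f (degree h n i) / \sum_(1 <= j < n.+1) f (degree h n j))%:E *
     P [set w | forall t, (1 <= t < n)%N -> c t w = h t])%E.

Definition standard_normal d (Omega : measurableType d)
    (P : probability Omega R) (Z : {RV P >-> R}) : Prop :=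
  forall A : set R, measurable A -> distribution P Z A = normal_prob 0 1 A.

Definition cvg_in_distribution
    d (Omega : measurableType d) (P : probability Omega R)
    (X : nat -> Omega -> R)
    d' (Omega' : measurableType d') (P' : probability Omega' R)
    (Y : Omega' -> R) : Prop :=
  [/\ forall n, measurable_fun setT (X n),
      measurable_fun setT Y &
      forall g : R -> R, continuous g -> bounded_fun g ->
        ((fun n => 'E_P[g \o X n]) @ \oo --> 'E_P'[g \o Y])%E].

End probability.

(* Main.v *)
(* With true parameter (a, 1) every choice is made with probability proportional to
   d + a, a total weight known in advance.  So the numbers of nodes of degree > k are, up
   to this known drift, martingales, and they satisfy a law of large numbers with tails
   that are summable against log^2.

   Let gamma = log (f_(alpha, beta) / f_(a, 1)) be the log-likelihood ratio of one choice.
   Along the tree, the log-likelihood ratio is a martingale minus a sum of conditional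
   Kullback-Leibler terms ln E e^gamma - E gamma.  These terms are bounded below by a
   multiple of |alpha - a|^2 + |beta - 1|^2, which makes the estimator sqrt n-consistent,
   and near (a, 1) they are half the conditional variances of gamma.  Hence the
   log-likelihood ratio is locally quadratic.  In the coordinates that diagonalize its
   Hessian, the maximizer over beta <= 1 is sqrt n (beta - 1) = min(0, D / V), where D is
   the normalized martingale of the score of beta orthogonalized to that of alpha, and V,
   its limiting variance, is the inverse of the (2, 2) entry of the inverse of V_(a, 1).
   A martingale central limit theorem (Lindeberg replacement along the heat equation)
   gives D / sqrt V -> N(0, 1).

   All the estimates are made for a finite Markov chain of attachment histories, whose law
   is that of the random tree; only the last step returns to the probability space. *)

From HB Require Import structures.
Require Import Defs.
From mathcomp Require Import all_boot all_order all_algebra.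
From mathcomp Require Import all_classical all_reals all_analysis.
From mathcomp Require Import measurable_realfun.
From mathcomp Require Import ring lra zify.
Import Order.TTheory GRing.Theory Num.Theory.
Import numFieldNormedType.Exports.
Set Implicit Arguments.
Unset Strict Implicit.
Unset Printing Implicit Defensive.
Local Open Scope classical_set_scope.
Local Open Scope ring_scope.

(** * Expectations over finite attachment histories *)

Section chain.
Variable R : realType.
Implicit Types (h : nat -> nat) (phi psi : (nat -> nat) -> R).

(** The estimator is random, so bounds at a fixed parameter do not apply to it. All probability is
    therefore spent on one event, [regular], on which the argument is deterministic and uniform over
    [Theta]. Two facts allow this. Near the truth [log_ratio] is linear in two scores up to an error
    bounded uniformly in the degree, and [mart a m phi] is at most the supremum of [phi] times
    [count_mart], which is o(n), even for a [phi] selected after the history. And quadratic forms in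
    two scores are controlled by three of their values. The scores grow like the logarithm of the
    degree, so their squares need the summability against log^2. No score equation is used, since
    the truth lies on the boundary [beta = 1]. The maximizer is compared with the point that has the
    same first orthogonal coordinate and the predicted [beta]; strict concavity turns a small gap in
    likelihood into a small distance. As [Theta] is open in alpha, the existence of a maximizer is
    also proved on [regular]. The limit has an atom at 0, so only distribution functions at negative
    points are compared. *)

Definition upd h (t i : nat) : nat -> nat := fun s => if s == t then i else h s.

Definition valid (m : nat) h := forall t, (0 < t <= m)%N -> (0 < h t <= t)%N.

(** Histories are total functions of which only the coordinates 1 to [m] count; this stands in for
    measurability with respect to the first [m] choices. *)
Definition adapted (T : Type) (m : nat) (phi : (nat -> nat) -> T) :=
  forall h h', (forall t, (0 < t <= m)%N -> h t = h' t) -> phi h = phi h'.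

Lemma valid_upd m h i : valid m h -> (0 < i <= m.+1)%N -> valid m.+1 (upd h m.+1 i).
Proof.
move=> vh i_m t /andP[t0 tm]; rewrite /upd; case: eqP => [->//|/eqP ntm].
by apply: vh; rewrite t0 /= -ltnS ltn_neqAle ntm.
Qed.

Lemma valid_leq m n h : (m <= n)%N -> valid n h -> valid m h.
Proof. by move=> mn vh t /andP[t0 tm]; apply: vh; rewrite t0 (leq_trans tm). Qed.

Lemma adapted_upd (T : Type) m (phi : (nat -> nat) -> T) h i :
  adapted m phi -> phi (upd h m.+1 i) = phi h.
Proof.
move=> ap; apply: ap => t /andP[_ tm]; rewrite /upd; case: eqP => // tE.
by rewrite tE ltnn in tm.
Qed.

Lemma adapted_leq (T : Type) m n (phi : (nat -> nat) -> T) :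
  (m <= n)%N -> adapted m phi -> adapted n phi.
Proof.
move=> mn ap h h' hh; apply: ap => t /andP[t0 tm].
by apply: hh; rewrite t0 (leq_trans tm).
Qed.

Variable p : (nat -> nat) -> nat -> nat -> R.

Definition step m phi h := \sum_(1 <= i < m.+2) p h m i * phi (upd h m.+1 i).

(** The last coordinate is integrated out first, so that the tower property holds by computation. *)
Fixpoint Ex m phi : R := if m is m'.+1 then Ex m' (step m' phi) else phi (fun=> 0%N).

(* [p h m] is the conditional law of the coordinate [m.+1] given the first [m] ones. *)
Definition transition :=
  [/\ forall m h i, valid m h -> (0 < i <= m.+1)%N -> 0 <= p h m i,
      forall m h, valid m h -> \sum_(1 <= i < m.+2) p h m i = 1 &
      forall m i, adapted m (fun h => p h m i)].

Hypothesis tp : transition.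

Lemma step_le m phi psi h : valid m h ->
  (forall h, valid m.+1 h -> phi h <= psi h) -> step m phi h <= step m psi h.
Proof.
move=> vh le; apply: ler_sum_nat => i /andP[i1 i2].
have i_m : (0 < i <= m.+1)%N by rewrite i1 -ltnS.
apply: ler_wpM2l; last exact/le/valid_upd.
by case: tp => p0 _ _; exact: p0.
Qed.

Lemma stepD m phi psi h :
  step m (fun h => phi h + psi h) h = step m phi h + step m psi h.
Proof. by rewrite -big_split; apply: eq_bigr => i _; rewrite mulrDr. Qed.

Lemma stepZ m c phi h : step m (fun h => c * phi h) h = c * step m phi h.
Proof. by rewrite mulr_sumr; apply: eq_bigr => i _; rewrite mulrCA. Qed.

Lemma step_adapted m c h : valid m h -> adapted m c -> step m c h = c h.
Proof.
move=> vh ac; rewrite /step; under eq_bigr do rewrite (adapted_upd _ _ ac).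
by rewrite -mulr_suml; case: tp => _ -> //; rewrite mul1r.
Qed.

Lemma step_cst m c h : valid m h -> step m (fun=> c) h = c.
Proof. by move=> vh; exact: (@step_adapted _ (fun=> c)). Qed.

Lemma step_adaptedM m c phi h : adapted m c ->
  step m (fun h => c h * phi h) h = c h * step m phi h.
Proof.
move=> ac; rewrite /step mulr_sumr; apply: eq_bigr => i _.
by rewrite (adapted_upd _ _ ac) mulrCA.
Qed.

Lemma Ex_le m phi psi :
  (forall h, valid m h -> phi h <= psi h) -> Ex m phi <= Ex m psi.
Proof.
elim: m phi psi => [|m IH] phi psi le /=; first by apply: le => t; case: t.
by apply: IH => h vh; exact: step_le.
Qed.

Lemma Ex_eq m phi psi :
  (forall h, valid m h -> phi h = psi h) -> Ex m phi = Ex m psi.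
Proof. by move=> eq; apply/eqP; rewrite eq_le !Ex_le// => h /eq ->. Qed.

Lemma ExD m phi psi : Ex m (fun h => phi h + psi h) = Ex m phi + Ex m psi.
Proof.
elim: m phi psi => [|m IH] phi psi //=; rewrite -IH; apply: Ex_eq => h _.
exact: stepD.
Qed.

Lemma ExZ m c phi : Ex m (fun h => c * phi h) = c * Ex m phi.
Proof.
elim: m phi => [|m IH] phi //=; rewrite -IH; apply: Ex_eq => h _.
exact: stepZ.
Qed.

Lemma Ex_cst m c : Ex m (fun=> c) = c.
Proof.
elim: m => [|m IH] //=; rewrite -[RHS]IH; apply: Ex_eq => h vh.
exact: step_cst.
Qed.

Lemma ExB m phi psi : Ex m (fun h => phi h - psi h) = Ex m phi - Ex m psi.
Proof.
rewrite ExD; congr (_ + _); rewrite -mulN1r -ExZ.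
by apply: Ex_eq => h _; rewrite mulN1r.
Qed.

Lemma Ex_sum (I : Type) (r : seq I) (P : pred I) m (F : I -> (nat -> nat) -> R) :
  Ex m (fun h => \sum_(i <- r | P i) F i h) = \sum_(i <- r | P i) Ex m (F i).
Proof.
elim: r => [|i r IH].
  by rewrite big_nil -[RHS](Ex_cst m); apply: Ex_eq => h _; rewrite big_nil.
rewrite big_cons; case: ifPn => Pi; last first.
  by rewrite -IH; apply: Ex_eq => h _; rewrite big_cons (negbTE Pi).
by rewrite -IH -ExD; apply: Ex_eq => h _; rewrite big_cons Pi.
Qed.

Lemma Ex_ge0 m phi : (forall h, valid m h -> 0 <= phi h) -> 0 <= Ex m phi.
Proof. by move=> phi0; rewrite -(Ex_cst m 0); exact: Ex_le. Qed.

Lemma Ex_leq m n phi : (m <= n)%N -> adapted m phi -> Ex n phi = Ex m phi.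
Proof.
move=> /subnK <-; elim: (n - m)%N => //= k IH ap; rewrite -IH//.
apply: Ex_eq => h vh; apply: step_adapted => //.
by apply: adapted_leq ap; exact: leq_addl.
Qed.

Lemma Ex_norm m phi : `|Ex m phi| <= Ex m (fun h => `|phi h|).
Proof.
rewrite ler_norml -mulN1r -ExZ; apply/andP; split; apply: Ex_le => h _.
  by rewrite mulN1r lerNl -normrN ler_norm.
exact: ler_norm.
Qed.

Lemma Ex_sqr m phi : (Ex m phi) ^+ 2 <= Ex m (fun h => phi h ^+ 2).
Proof.
have : 0 <= Ex m (fun h => (phi h - Ex m phi) ^+ 2).
  by apply: Ex_ge0 => h _; exact: sqr_ge0.
rewrite (_ : Ex _ _ = Ex m (fun h => phi h ^+ 2) - Ex m phi ^+ 2) ?subr_ge0//.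
transitivity (Ex m (fun h => phi h ^+ 2 + ((- Ex m phi *+ 2) * phi h + Ex m phi ^+ 2))).
  by apply: Ex_eq => h _; ring.
by rewrite !ExD ExZ Ex_cst; ring.
Qed.

Lemma Ex_abs_sqrt m phi c : Ex m (fun h => phi h ^+ 2) <= c ->
  Ex m (fun h => `|phi h|) <= Num.sqrt c.
Proof.
move=> le; have E0 : 0 <= Ex m (fun h => `|phi h|) by apply: Ex_ge0.
rewrite -(ger0_norm E0) -sqrtr_sqr ler_sqrt.
  apply: le_trans le; apply: (le_trans (Ex_sqr _ _)); apply: Ex_le => h _.
  by rewrite real_normK// num_real.
by apply: le_trans le; apply: Ex_ge0 => h _; exact: sqr_ge0.
Qed.

Lemma Ex_markov m phi c : 0 < c -> (forall h, valid m h -> 0 <= phi h) ->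
  Ex m (fun h => (c <= phi h)%R%:R) <= c^-1 * Ex m phi.
Proof.
move=> c0 phi0; rewrite -ExZ; apply: Ex_le => h vh.
case: (leP c (phi h)) => [le|_]; first by rewrite mulrC ler_pdivlMr ?mul1r.
by rewrite mulr_ge0 ?phi0// invr_ge0 ltW.
Qed.

(** Increments are orthogonal: given the past, the cross term with the new increment has mean 0. *)
Lemma martingale_sqr m (xi v : nat -> (nat -> nat) -> R) :
  (forall s, adapted s.+1 (xi s)) ->
  (forall s h, (s < m)%N -> valid s h -> step s (xi s) h = 0) ->
  (forall s h, (s < m)%N -> valid s h -> step s (fun h => xi s h ^+ 2) h = v s h) ->
  Ex m (fun h => (\sum_(s < m) xi s h) ^+ 2) = \sum_(s < m) Ex s (v s).
Proof.
move=> axi xi0; elim: m xi0 => [|m IH] xi0 xiv.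
  by rewrite !big_ord0 -[RHS](Ex_cst 0); apply: Ex_eq => h _; rewrite big_ord0 expr0n.
rewrite big_ord_recr -IH /=; first last.
- by move=> s h sm; apply: xiv; exact: ltnW.
- by move=> s h sm; apply: xi0; exact: ltnW.
rewrite -ExD; apply: Ex_eq => h vh.
have aM : adapted m (fun h => \sum_(s < m) xi s h).
  move=> h1 h2 hh; apply: eq_bigr => s _; apply: axi => t /andP[t0 ts].
  by apply: hh; rewrite t0 (leq_trans ts).
transitivity (step m (fun h => (\sum_(s < m) xi s h) ^+ 2 +
   ((2%:R * \sum_(s < m) xi s h) * xi m h + xi m h ^+ 2)) h).
  by apply: eq_bigr => i _; rewrite big_ord_recr /=; congr (_ * _); ring.
rewrite !stepD xiv// step_adapted//; last by move=> h1 h2 /aM ->.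
by rewrite step_adaptedM ?xi0 ?mulr0 ?add0r//; move=> h1 h2 /aM ->.
Qed.

End chain.

(** * Taylor bounds from the mean value theorem *)

Section mean_value.
Variable R : realType.
Implicit Types (x y t r C : R).

Lemma MVT_minmax (f df : R -> R) x y :
  (forall z, Num.min x y <= z <= Num.max x y -> is_derive z 1 f (df z)) ->
  exists2 z, Num.min x y <= z <= Num.max x y & f y - f x = df z * (y - x).
Proof.
have ordered (a b : R) : a <= b -> (forall z, a <= z <= b -> is_derive z 1 f (df z)) ->
    exists2 z, a <= z <= b & f b - f a = df z * (b - a).
  move=> ab d; have [||z] := @MVT_segment _ f df a b ab.
  - by move=> z; rewrite in_itv/= => /andP[az zb]; apply: d; rewrite !ltW.
  - apply: derivable_within_continuous => z; rewrite in_itv/= => zab.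
    by have [] := d _ zab.
  - by rewrite in_itv/= => zab E; exists z.
have [xy|yx] := leP x y; first exact: ordered.
move=> /(ordered _ _ (ltW yx))[z zyx E]; exists z => //.
by rewrite -opprB E -mulrN opprB.
Qed.

Lemma MVT_le (f df : R -> R) x y C :
  (forall z, Num.min x y <= z <= Num.max x y -> is_derive z 1 f (df z)) ->
  (forall z, Num.min x y <= z <= Num.max x y -> `|df z| <= C) ->
  `|f y - f x| <= C * `|y - x|.
Proof.
by move=> /MVT_minmax[z zxy ->] dC; rewrite normrM ler_wpM2r// dC.
Qed.

(** Two uses of the mean value theorem replace an integral remainder, at the price of the sharp
    factor 1/2. *)
Lemma taylor1 (g g1 g2 : R -> R) x y (C : R) : 0 <= C ->
  (forall z, Num.min x y <= z <= Num.max x y -> is_derive z 1 g (g1 z)) ->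
  (forall z, Num.min x y <= z <= Num.max x y -> is_derive z 1 g1 (g2 z)) ->
  (forall z, Num.min x y <= z <= Num.max x y -> `|g2 z| <= C) ->
  `|g y - g x - (y - x) * g1 x| <= C * `|y - x| ^+ 2.
Proof.
move=> C0 d1 d2 gC; have [z zxy ->] := MVT_minmax d1.
have zx : Num.min x z <= x <= Num.max x z.
  by rewrite ge_min le_max lexx.
have sub w : Num.min x z <= w <= Num.max x z -> Num.min x y <= w <= Num.max x y.
  move: zxy => /andP[z1 z2] /andP[w1 w2]; apply/andP; split.
    by apply: le_trans w1; rewrite le_min z1 ge_min lexx.
  by apply: (le_trans w2); rewrite ge_max z2 le_max lexx.
have le1 : `|g1 z - g1 x| <= C * `|z - x|.
  by apply: (@MVT_le _ g2) => w /sub; [exact: d2|exact: gC].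
have le2 : `|z - x| <= `|y - x|.
  move: zxy; case: (leP x y) => xy /andP[z1 z2]; last first.
    by rewrite ![`|_ - x|]distrC !ger0_norm ?subr_ge0//; lra.
  by rewrite !ger0_norm ?subr_ge0//; lra.
rewrite mulrC -mulrBr normrM expr2 mulrCA ler_wpM2l// (le_trans le1)//.
exact: ler_wpM2l.
Qed.

Lemma taylor2 (g g1 g2 g3 : R -> R) x t (C : R) :
  (forall z : R, is_derive z 1 g (g1 z)) ->
  (forall z : R, is_derive z 1 g1 (g2 z)) ->
  (forall z : R, is_derive z 1 g2 (g3 z)) -> (forall z, `|g3 z| <= C) ->
  `|g (x + t) - g x - t * g1 x - t ^+ 2 / 2 * g2 x| <= C * `|t| ^+ 3.
Proof.
move=> d1 d2 d3 gC; have C0 : 0 <= C by exact: le_trans (gC 0).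
pose k z := g (x + z) - z * g1 x - z ^+ 2 / 2 * g2 x.
have dk (z : R) : is_derive z 1 k (g1 (x + z) - g1 x - z * g2 x).
  by apply: is_derive_eq; rewrite /GRing.scale/=; field.
have [w wt E] : exists2 w, Num.min 0 t <= w <= Num.max 0 t & k t - k 0 =
   (g1 (x + w) - g1 x - w * g2 x) * (t - 0).
  by apply: MVT_minmax => z _; exact: dk.
have -> : g (x + t) - g x - t * g1 x - t ^+ 2 / 2 * g2 x = k t - k 0.
  by rewrite /k addr0 mul0r expr0n/= !mul0r !subr0; ring.
have wt' : `|w| <= `|t|.
  move: wt; case: (leP 0 t) => xy /andP[z1 z2]; first by rewrite !ger0_norm//; lra.
  by rewrite !ler0_norm//; lra.
rewrite E subr0 normrM exprSr mulrA ler_wpM2r//.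
have -> : g1 (x + w) - g1 x - w * g2 x = g1 (x + w) - g1 x - (x + w - x) * g2 x.
  by ring.
apply: le_trans (_ : C * `|x + w - x| ^+ 2 <= _).
  by apply: (@taylor1 g1 g2 g3).
by rewrite addrC addKr ler_wpM2l// ler_pXn2r.
Qed.

End mean_value.

(** * The normal distribution function and the heat equation *)

Section gaussian.
Variable R : realType.
Implicit Types (x y t r u v d e : R).

Definition gpdf : R -> R := normal_pdf 0 1.
Definition gcdf x : R := fine (normal_prob 0 1 `]-oo, x]).

Lemma gpdfE x : gpdf x = normal_peak 1 * expR (- (x ^+ 2 / 2)).
Proof.
by rewrite /gpdf normal_pdfE ?oner_eq0// /normal_fun subr0 expr1n mulNr.
Qed.

Lemma normal_peak1_le1 : normal_peak 1 <= 1 :> R.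
Proof.
rewrite /normal_peak expr1n mul1r invf_le1; last first.
  by rewrite sqrtr_gt0 mulrn_wgt0// pi_gt0.
have p2 := pi_ge2 R; rewrite -[leLHS]sqrtr1 ler_sqrt mulr2n; lra.
Qed.

Lemma gpdf_ge0 x : 0 <= gpdf x. Proof. exact: normal_pdf_ge0. Qed.

Lemma sqr_gpdf_le x : gpdf x <= 1 /\ x ^+ 4 * gpdf x <= 8.
Proof.
rewrite gpdfE; set z := x ^+ 2 / 2; have z0 : 0 <= z by rewrite divr_ge0 ?sqr_ge0.
have e0 := expR_gt0 (- z); have p0 := normal_peak_ge0 (1 : R).
have p1 := normal_peak1_le1.
have e1 : expR (- z) <= 1 by rewrite -expR0 ler_expR oppr_le0.
(* From [z^2 / 2 <= expR z]; since [x^4 = 4 z^2], this is where the 8 comes from. *)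
have e2 : z ^+ 2 * expR (- z) <= 2.
  have := expR_ge1Dxn 1 z0; rewrite expRN ler_pdivrMr ?expR_gt0//.
  by rewrite (_ : 2`!%:R = 2)//; lra.
have -> : x ^+ 4 = 4 * z ^+ 2 by rewrite /z; field.
split; first by rewrite mulr_ile1 ?normal_peak_ge0// ltW.
have : normal_peak 1 * (z ^+ 2 * expR (- z)) <= 1 * 2.
  by rewrite ler_pM// mulr_ge0 ?sqr_ge0// ltW.
by lra.
Qed.

Lemma is_derive_gpdf x : is_derive x 1 gpdf (- x * gpdf x).
Proof.
rewrite (_ : gpdf = (fun x => normal_peak 1 *: expR (- (x ^+ 2 / 2)))); last first.
  by apply/funext => y; rewrite gpdfE.
by apply: is_derive_eq; rewrite /GRing.scale/=; field.
Qed.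

Lemma is_derive_gcdf x : is_derive x 1 gcdf (gpdf x).
Proof.
rewrite (_ : gcdf = fun x => (\int[lebesgue_measure]_(t in `]-oo, x]) gpdf t)%R) //.
have [] := @continuous_FTC1 R gpdf -oo%O x (x + 1).
- by rewrite ltrDl.
- apply: (integrableS (E := setT)) => //.
  exact: integrable_normal_pdf.
- exact: ltNyr.
- exact/continuous_normal_pdf/oner_neq0.
move=> d1 d2; apply: DeriveDef; first exact: d1.
by rewrite -derive1E; exact: d2.
Qed.

Lemma normal_prob_gcdf x : normal_prob 0 1 `]-oo, x] = (gcdf x)%:E :> \bar R.
Proof. by rewrite /gcdf fineK// fin_num_measure. Qed.

Lemma gcdf_ge0 x : 0 <= gcdf x.
Proof. by rewrite -lee_fin -normal_prob_gcdf. Qed.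

Lemma gcdf_le1 x : gcdf x <= 1.
Proof. by rewrite -lee_fin -normal_prob_gcdf probability_le1. Qed.

Lemma gcdf_lip x y : `|gcdf x - gcdf y| <= `|x - y|.
Proof.
rewrite -[leRHS]mul1r; apply: (@MVT_le _ gcdf gpdf) => z _.
  exact: is_derive_gcdf.
by rewrite ger0_norm ?gpdf_ge0//; have [] := sqr_gpdf_le z.
Qed.

(** The powers 1 to 3 lie below a multiple of [1 + x^4], and [(1 + x^4) gpdf x <= 9]. *)
Lemma gpdf_mom x : [/\ x ^+ 2 * gpdf x <= 5, `|x| * gpdf x <= 9 & `|x| ^+ 3 * gpdf x <= 9].
Proof.
have [g1 g4] := sqr_gpdf_le x; have g0 := gpdf_ge0 x.
have x4 : x ^+ 4 = `|x| ^+ 4 by rewrite -normrX ger0_norm// exprn_even_ge0.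
have x2 : x ^+ 2 = `|x| ^+ 2 by rewrite real_normK// num_real.
rewrite x4 in g4; rewrite x2; move: (normr_ge0 x) => a0; set a := `|x| in g4 a0 *.
have g04 : 0 <= a ^+ 4 * gpdf x by rewrite mulr_ge0// exprn_ge0.
have bnd q c : q <= c * (1 + a ^+ 4) -> 0 <= c -> q * gpdf x <= c * 9.
  move=> qc c0; apply: (@le_trans _ _ (c * (1 + a ^+ 4) * gpdf x)).
    exact: ler_wpM2r.
  by rewrite -mulrA ler_wpM2l// mulrDl mul1r; lra.
split.
- have : 0 <= (a ^+ 2 - 1) ^+ 2 by exact: sqr_ge0.
  by move=> p1; have : a ^+ 2 * gpdf x <= 1 / 2 * 9 by [apply: bnd; lra]; lra.
- have : 0 <= (a ^+ 2 - 1 / 2) ^+ 2 by exact: sqr_ge0.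
  have : 0 <= (a - 1 / 2) ^+ 2 by exact: sqr_ge0.
  by move=> p1 p2; have : a * gpdf x <= 1 * 9 by [apply: bnd; lra]; lra.
- have : 0 <= (a ^+ 2 - a) ^+ 2 by exact: sqr_ge0.
  have : 0 <= (a ^+ 2 - 1) ^+ 2 by exact: sqr_ge0.
  have : 0 <= a ^+ 4 by exact: exprn_ge0.
  by move=> p0 p1 p2; have : a ^+ 3 * gpdf x <= 1 * 9 by [apply: bnd; lra]; lra.
Qed.

Lemma gcdf_taylor u t :
  `|gcdf (u + t) - gcdf u - t * gpdf u - t ^+ 2 / 2 * (- u * gpdf u)| <= 6 * `|t| ^+ 3.
Proof.
apply: (@taylor2 _ gcdf gpdf (fun z => - z * gpdf z)
  (fun z => (z ^+ 2 - 1) * gpdf z)) => z.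
- exact: is_derive_gcdf.
- exact: is_derive_gpdf.
- have dz := is_derive_gpdf z.
  by apply: is_derive_eq; rewrite /GRing.scale/=; ring.
- have [g2 _ _] := gpdf_mom z; have [g1 _] := sqr_gpdf_le z; have g0 := gpdf_ge0 z.
  have : 0 <= z ^+ 2 * gpdf z by rewrite mulr_ge0 ?sqr_ge0.
  by move=> ?; rewrite mulrBl mul1r ler_norml; lra.
Qed.

(** Taylor expansion of [gcdf (x / sqrt s)] in the variance [s]. Its first derivative at [r],
    [- u gpdf u / (2 r)], is half the second derivative in [x], as the heat equation demands. *)
Lemma gcdf_scale x r v u : 0 < r -> 0 <= v -> u = x / Num.sqrt r ->
  `|gcdf (x / Num.sqrt (r + v)) - gcdf u - v * (- u * gpdf u / (2 * r))| <=
  9 * v ^+ 2 / r ^+ 2.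
Proof.
move=> r0 v0 ->.
have ds (s : R) : 0 < s -> is_derive s 1 (fun s => x / Num.sqrt s) (- (x / Num.sqrt s) / (2 * s)).
  move=> s0; have q0 : Num.sqrt s != 0 by rewrite gt_eqF// sqrtr_gt0.
  have := is_derive1_sqrt s0 => dq.
  apply: (is_derive_eq (is_deriveZ x (is_deriveV q0 dq))); rewrite /GRing.scale/=.
  rewrite -[in X in _ = _ / (2 * X)](sqr_sqrtr (ltW s0)); field.
  exact: q0.
(* The second derivative in [s]; the moment bounds give 9 * 3/4 + 9/4 = 9. *)
pose g2 s := let w := x / Num.sqrt s in
  (w * (3 / 4) - w ^+ 3 / 4) * gpdf w / s ^+ 2.
have mn z : Num.min r (r + v) <= z <= Num.max r (r + v) -> 0 < z /\ r <= z.
  by rewrite min_l ?lerDl// => /andP[rz _]; split=> //; exact: lt_le_trans rz.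
have rvE : r + v - r = v by ring.
have -> : 9 * v ^+ 2 / r ^+ 2 = 9 / r ^+ 2 * `|r + v - r| ^+ 2.
  by rewrite rvE ger0_norm// mulrAC.
rewrite -[X in X * (_ / (2 * r))]rvE.
apply: (@taylor1 R (fun s => gcdf (x / Num.sqrt s))
  (fun s => - (x / Num.sqrt s) * gpdf (x / Num.sqrt s) / (2 * s)) g2).
- by rewrite divr_ge0// sqr_ge0.
- move=> z /mn[z0 _]; have dz := ds _ z0.
  have dc := @is_derive1_comp R gcdf (fun s => x / Num.sqrt s) z _ _
    (is_derive_gcdf _) dz.
  by apply: (is_derive_eq dc); ring.
- move=> z /mn[z0 _]; have dz := ds _ z0.
  have dg := @is_derive1_comp R gpdf (fun s => x / Num.sqrt s) z _ _
    (is_derive_gpdf _) dz.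
  have z0' : z != 0 by rewrite gt_eqF.
  have d2z : is_derive z 1 (fun s : R => (2 * s)^-1) (- (2 * z) ^- 2 *: 2).
    by apply: is_deriveV; [rewrite mulf_neq0|apply: is_derive_eq; rewrite /GRing.scale/=; ring].
  have dw : is_derive z 1 (fun s => - (x / Num.sqrt s)) (- (- (x / Num.sqrt z) / (2 * z))).
    by apply: is_derive_eq.
  apply: (is_derive_eq (is_deriveM (is_deriveM dw dg) d2z)); rewrite /g2 /GRing.scale/=.
  by rewrite !fctE /=; set w := x / _; field.
- move=> z /mn[z0 rz]; rewrite /g2; set w := x / _.
  have [_ w1 w3] := gpdf_mom w; have g0 := gpdf_ge0 w.
  rewrite normrM; apply: ler_pM => //; last first.
    rewrite ger0_norm ?invr_ge0 ?sqr_ge0// lef_pV2 ?posrE ?exprn_gt0//.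
    by rewrite ler_pXn2r ?nnegrE// ltW.
  rewrite normrM (ger0_norm g0).
  apply: (@le_trans _ _ ((`|w| * (3 / 4) + `|w| ^+ 3 / 4) * gpdf w)).
    clearbody w; rewrite ler_wpM2r// (le_trans (ler_normB _ _))// !normrM !normfV.
    by rewrite !normr_nat -!mulrA.
  by move: w1 w3; rewrite mulrDl; lra.
Qed.

(* [(r, x) |-> gcdf (x / sqrt r)] solves the heat equation [d_r F = 1/2 d_xx F], so that
   the second order terms cancel when [r] decreases by the variance of [xi]. *)
Lemma gcdf_heat d r v x : 0 < d <= 1 -> d <= r -> 0 <= v ->
  exists c1 c2, forall xi,
    `|gcdf ((x + xi) / Num.sqrt r) - gcdf (x / Num.sqrt (r + v)) -
      (c1 * xi + c2 * (xi ^+ 2 - v))| <= d ^- 2 * (6 * `|xi| ^+ 3 + 9 * v ^+ 2).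
Proof.
move=> /andP[d0 d1] dr v0; have r0 : 0 < r by exact: lt_le_trans dr.
set q := Num.sqrt r; have q0 : 0 < q by rewrite sqrtr_gt0.
have qq : r = q ^+ 2 by rewrite sqr_sqrtr// ltW.
set u := x / q; exists (gpdf u / q), (- u * gpdf u / (2 * r)) => xi.
have T1 := gcdf_taylor u (xi / q).
have T2 := @gcdf_scale x r v u r0 v0 erefl.
set A := gcdf (x / _) in T2 *.
have -> : gcdf ((x + xi) / q) - A - (gpdf u / q * xi + - u * gpdf u / (2 * r) * (xi ^+ 2 - v)) =
  (gcdf (u + xi / q) - gcdf u - xi / q * gpdf u - (xi / q) ^+ 2 / 2 * (- u * gpdf u)) -
  (A - gcdf u - v * (- u * gpdf u / (2 * r))).
  by rewrite mulrDl -/u qq; field; rewrite gt_eqF.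
apply: (le_trans (ler_normB _ _)); rewrite mulrDr; apply: lerD.
  apply: (le_trans T1); rewrite normrM normfV (ger0_norm (ltW q0)) exprMn exprVn.
  rewrite mulrA [leRHS]mulrC ler_wpM2l ?mulr_ge0 ?exprn_ge0//.
  rewrite lef_pV2 ?posrE ?exprn_gt0//.
  have dq : d <= q.
    rewrite -(ler_pXn2r (n := 2)) ?nnegrE ?(ltW d0) ?(ltW q0)// -qq.
    by apply: le_trans dr; rewrite expr2 ger_pMr.
  by rewrite expr2 exprSr -qq; apply: ler_pM => //; exact: ltW.
apply: (le_trans T2); rewrite mulrC ler_wpM2r ?mulr_ge0 ?sqr_ge0//.
by rewrite lef_pV2 ?posrE ?exprn_gt0// ler_pXn2r// nnegrE ltW.
Qed.

(** The identity, as a random variable of normal law, gives access to the limits of distribution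
    functions at infinity. *)
Let idR : measurableTypeR R -> R := idfun.

#[local] HB.instance Definition _ :=
  @isMeasurableFun.Build _ _ _ _ idR (@measurable_id _ _ setT).

Lemma gcdf_tails e : 0 < e -> exists2 L, 0 < L & forall x, L <= x ->
  1 - e <= gcdf x /\ gcdf (- x) <= e.
Proof.
move=> e0.
pose X : {RV normal_prob 0 1 >-> R} := idR.
have cdfX x : cdf X x = (gcdf x)%:E.
  by rewrite /cdf /distribution/= /pushforward preimage_id normal_prob_gcdf.
have : gcdf x @[x --> +oo] --> (1 : R).
  by have := cvg_cdfy1 X; rewrite (_ : cdf X = EFin \o gcdf) ?funeqE// => /fine_cvgP[].
have : gcdf x @[x --> -oo] --> (0 : R).
  by have := cvg_cdfNy0 X; rewrite (_ : cdf X = EFin \o gcdf) ?funeqE// => /fine_cvgP[].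
move=> /cvgrPdist_le/(_ _ e0)[A [_ hA]] /cvgrPdist_le/(_ _ e0)[B [_ hB]].
exists (`|A| + `|B| + 1) => [|x Lx]; first by rewrite ltr_wpDl// addr_ge0.
have := ler_norm A; have := ler_norm (- A); have := ler_norm B.
have := normr_ge0 B; rewrite normrN => b0 b1 a1 a2.
have := hB x; have := hA (- x); rewrite /= sub0r normrN => /(_ _)h1 /(_ _)h2.
have := gcdf_ge0 (- x) => g0; have h1' := h1 ltac:(lra); have h2' := h2 ltac:(lra).
by move: h1' h2'; rewrite !ler_norml; lra.
Qed.

End gaussian.

Lemma sqrtr_le (R : rcfType) (x c : R) : 0 <= c -> x <= c ^+ 2 -> Num.sqrt x <= c.
Proof. by move=> c0 xc; rewrite -[c]ger0_norm// -sqrtr_sqr ler_sqrt ?sqr_ge0. Qed.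

(** * A central limit theorem for martingales *)

Section martingale_clt.

Variables (R : realType) (p : (nat -> nat) -> nat -> nat -> R).
Hypothesis tp : transition p.

Section lindeberg.
Variables (m : nat) (xi v : nat -> (nat -> nat) -> R) (b : R).
Hypothesis b0 : 0 <= b.
Hypothesis axi : forall s, adapted s.+1 (xi s).
Hypothesis av : forall s, adapted s (v s).
Hypothesis xi0 : forall s h, (s < m)%N -> valid s h -> step p s (xi s) h = 0.
Hypothesis xiv : forall s h, (s < m)%N -> valid s h ->
  step p s (fun h => xi s h ^+ 2) h = v s h.
Hypothesis xib : forall s h, (s < m)%N -> valid s.+1 h -> `|xi s h| <= b.

Lemma cond_var_bounds s h : (s < m)%N -> valid s h -> 0 <= v s h <= b ^+ 2.
Proof.
move=> sm vh; rewrite -xiv// -(step_cst tp (b ^+ 2) vh) -(step_cst tp 0 vh).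
apply/andP; split; apply: (step_le tp vh) => h' vh'; first exact: sqr_ge0.
by rewrite -[leLHS]real_normK ?num_real// ler_pXn2r ?nnegrE// xib.
Qed.

Variables (d r0 x0 : R).

(* The position of the martingale started at [x0] and the variance budget that remains of
   [r0]; a step that would bring the budget below [d] is skipped. *)
Fixpoint budgeted s h : R * R :=
  if s is s'.+1 then
    let: (x, r) := budgeted s' h in
    if d + v s' h <= r then (x + xi s' h, r - v s' h) else (x, r)
  else (x0, r0).

Hypothesis d01 : 0 < d <= 1.
Hypothesis dr0 : d <= r0.

Lemma budgeted_adapted s : adapted s (budgeted s).
Proof.
elim: s => [|s IH] h h' hh //=.
rewrite (IH h h') => [|t /andP[t0 ts]]; last by apply: hh; rewrite t0 ltnW.
have -> : v s h = v s h'.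
  by apply: av => t /andP[t0 ts]; apply: hh; rewrite t0 ltnW.
by have -> : xi s h = xi s h' by exact: axi.
Qed.

Lemma budgeted_ge s h : d <= (budgeted s h).2.
Proof.
elim: s => //= s; case: (budgeted s h) => x r /= dr; case: ifPn => //= dvr.
by rewrite lerBrDr.
Qed.

(** Conditional variances are nonnegative, so every shorter sum also stays within the budget and no
    step is skipped. *)
Lemma budgeted_full s h : (s <= m)%N -> valid s h ->
  \sum_(i < s) v i h <= r0 - d ->
  budgeted s h = (x0 + \sum_(i < s) xi i h, r0 - \sum_(i < s) v i h).
Proof.
elim: s => [|s IH] sm vh; first by rewrite !big_ord0 addr0 subr0.
rewrite !big_ord_recr/= => le.
have vs : valid s h by apply: valid_leq vh.
have /andP[v0 _] := cond_var_bounds sm vs.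
rewrite IH ?(ltnW sm)//; last by lra.
by rewrite ifT; [congr pair; ring|lra].
Qed.

Let F (xr : R * R) := gcdf (xr.1 / Num.sqrt xr.2).
Let K := d ^- 2 * (6 * b + 9 * b ^+ 2).

(** A skipped step changes nothing. In the others the terms in [xi] and in [xi^2 - v] have
    conditional mean 0, and with [|xi|^3 <= b xi^2] and [v^2 <= b^2 v] the remainder costs a
    multiple of the variance, that is, of the budget spent. *)
Lemma lindeberg_step s h : (s < m)%N -> valid s h ->
  `|step p s (fun h => F (budgeted s.+1 h)) h - F (budgeted s h)| <=
  K * ((budgeted s h).2 - (budgeted s.+1 h).2).
Proof.
move=> sm vh; have := budgeted_ge s h; have := @budgeted_adapted s.
have /andP[v0 vb] := cond_var_bounds sm vh.
move=> ab; case E : (budgeted s h) => [x r] /= dr; rewrite E.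
case: ifPn => [dvr|dvr] /=; last first.
  rewrite subrr mulr0 normr_le0 subr_eq0; apply/eqP.
  transitivity (step p s (fun h' => F (x, r)) h); last exact: step_cst.
  apply: eq_bigr => i _; congr (_ * _).
  by rewrite (adapted_upd _ _ ab) (adapted_upd _ _ (@av s)) E (negbTE dvr).
have dr' : d <= r - v s h by rewrite lerBrDr.
have [c1 [c2 H]] := gcdf_heat x d01 dr' v0.
have stE : step p s (fun h0 => F (let '(x1, r1) := budgeted s h0 in
    if d + v s h0 <= r1 then (x1 + xi s h0, r1 - v s h0) else (x1, r1))) h =
  step p s (fun h' => gcdf ((x + xi s h') / Num.sqrt (r - v s h))) h.
  apply: eq_bigr => i _; congr (_ * _).
  by rewrite (adapted_upd _ _ ab) (adapted_upd _ _ (@av s)) E dvr.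
rewrite stE.
pose G xi := gcdf ((x + xi) / Num.sqrt (r - v s h)) - F (x, r) -
  (c1 * xi + c2 * (xi ^+ 2 - v s h)).
have -> : step p s (fun h' => gcdf ((x + xi s h') / Num.sqrt (r - v s h))) h - F (x, r) =
    step p s (fun h' => G (xi s h')) h.
  have -> : step p s (fun h' => G (xi s h')) h =
    step p s (fun h' => gcdf ((x + xi s h') / Num.sqrt (r - v s h)) +
     ((- F (x, r) + c2 * v s h) + ((- c1) * xi s h' + (- c2) * xi s h' ^+ 2))) h.
    by apply: eq_bigr => i _; congr (_ * _); rewrite /G; ring.
  rewrite !stepD !stepZ xi0// xiv// !(step_cst tp _ vh); ring.
have Gle h' : valid s.+1 h' -> `|G (xi s h')| <=
    d ^- 2 * (6 * b) * xi s h' ^+ 2 + d ^- 2 * (9 * b ^+ 2) * v s h.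
  move=> vh'; have := H (xi s h'); rewrite subrK => /le_trans; apply.
  rewrite -!mulrA -mulrDr ler_wpM2l ?invr_ge0 ?sqr_ge0//.
  apply: lerD; last by rewrite ler_wpM2l// mulrA -expr2 [leLHS]expr2 ler_wpM2r.
  rewrite ler_wpM2l// exprSr mulrC real_normK ?num_real// ler_wpM2r ?sqr_ge0//.
  exact: xib.
have -> : K * (r - (r - v s h)) = step p s (fun h' =>
    d ^- 2 * (6 * b) * xi s h' ^+ 2 + d ^- 2 * (9 * b ^+ 2) * v s h) h.
  by rewrite stepD stepZ xiv// step_cst// /K; ring.
rewrite ler_norml -mulN1r -stepZ; apply/andP; split; apply: (step_le tp vh) => h' vh'.
  by have := Gle _ vh'; rewrite ler_norml mulN1r => /andP[].
by have := Gle _ vh'; rewrite ler_norml => /andP[].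
Qed.

(** The costs telescope to the part of the budget that is spent, hence to at most [r0], however many
    steps there are. *)
Lemma lindeberg :
  `|Ex p m (fun h => F (budgeted m h)) - F (x0, r0)| <= K * r0.
Proof.
suff H s : (s <= m)%N -> `|Ex p s (fun h => F (budgeted s h)) - F (x0, r0)| <=
    K * (r0 - Ex p s (fun h => (budgeted s h).2)).
  apply: (le_trans (H m (leqnn m))); rewrite ler_wpM2l//.
    rewrite /K mulr_ge0 ?invr_ge0 ?sqr_ge0// addr_ge0// mulr_ge0// sqr_ge0//.
  rewrite gerBl; apply: (Ex_ge0 tp) => h _.
  by apply: le_trans (budgeted_ge _ _); case/andP: d01 => /ltW.
elim: s => [_|s IH sm] /=; first by rewrite !subrr normr0 mulr0.
set f := step p s _.
have -> : Ex p s f - F (x0, r0) = (Ex p s (fun h => f h - F (budgeted s h))) +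
    (Ex p s (fun h => F (budgeted s h)) - F (x0, r0)).
  by rewrite (ExB tp); ring.
apply: (le_trans (ler_normD _ _)); rewrite [leRHS](_ : _ =
  K * (Ex p s (fun h => (budgeted s h).2) - Ex p s (fun h => (budgeted s.+1 h).2)) +
  K * (r0 - Ex p s (fun h => (budgeted s h).2))); last first.
  have -> : Ex p s (step p s (fun h => (let '(x, r) := budgeted s h in
     if d + v s h <= r then (x + xi s h, r - v s h) else (x, r)).2)) =
     Ex p s (fun h => (budgeted s.+1 h).2).
    apply: (Ex_eq tp) => h vh; rewrite (step_adapted tp vh)//.
    move=> h1 h2 hh /=; rewrite (@budgeted_adapted s h1 h2)// (@av s h1 h2)//.
    by case: (budgeted s h2) => x r; case: ifP.
  by ring.
apply: lerD; last by apply: IH; exact: ltnW.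
apply: (le_trans (Ex_norm tp _ _)); rewrite -(ExB tp) -(ExZ tp).
by apply: (Ex_le tp) => h vh; exact: lindeberg_step.
Qed.

End lindeberg.

(** Run the budgeted process from [z] with steps [- xi] and budget [1 + d]. If the total variance is
    within [d / 2] of 1, it ends at [z - sum xi] with a remaining variance between [d / 2] and
    [3 d / 2], where [gcdf] is a smoothed indicator of [sum xi <= z]. Its mean is close to the
    initial value [gcdf (z / sqrt (1 + d))]. Taking [z = y + e'] and [z = y - e'] brackets the
    indicator of [sum xi <= y]. *)
Theorem martingale_clt (xi v : nat -> nat -> (nat -> nat) -> R) (b : nat -> R) :
  (forall n s, adapted s.+1 (xi n s)) -> (forall n s, adapted s (v n s)) ->
  (forall n s h, (s < n)%N -> valid s h -> step p s (xi n s) h = 0) ->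
  (forall n s h, (s < n)%N -> valid s h ->
     step p s (fun h => xi n s h ^+ 2) h = v n s h) ->
  (forall n s h, (s < n)%N -> valid s.+1 h -> `|xi n s h| <= b n) ->
  b @ \oo --> (0 : R) ->
  (forall e, 0 < e ->
    Ex p n (fun h => (e <= `|\sum_(s < n) v n s h - 1|)%R%:R) @[n --> \oo] --> (0 : R)) ->
  forall y, Ex p n (fun h => (\sum_(s < n) xi n s h <= y)%R%:R) @[n --> \oo] --> gcdf y.
Proof.
move=> axi av xi0 xiv xib b0 v1 y; apply/cvgrPdist_le => e e0.
pose e' := e / 8; have e'0 : 0 < e' by rewrite divr_gt0.
have [L L0 HL] := gcdf_tails e'0.
(* [d] small enough for [L * sqrt (3/2 d) <= e'] and for [gcdf (z / sqrt (1 + d))] to be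
   close to [gcdf z] when [|z| <= |y| + e']. *)
pose d := Num.min (Num.min 1 (e' / (`|y| + e' + 1))) ((e' / (2 * L)) ^+ 2).
have d0 : 0 < d.
  by rewrite !lt_min ltr01 divr_gt0 ?exprn_gt0 ?divr_gt0 ?mulr_gt0// -addrA ltr_wpDl// addr_gt0.
have d1 : d <= 1 by rewrite !ge_min lexx.
have dy : d <= e' / (`|y| + e' + 1) by rewrite !ge_min lexx orbT.
have dL : d <= (e' / (2 * L)) ^+ 2 by rewrite !ge_min lexx !orbT.
pose d' := d / 2; have d'0 : 0 < d' by rewrite divr_gt0.
have d'1 : 0 < d' <= 1 by rewrite d'0 /d'; lra.
have dr0 : d' <= 1 + d by rewrite /d'; lra.
have Lq r : d' <= r -> r <= 3 / 2 * d -> L <= e' / Num.sqrt r.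
  move=> dr rd; have r0 : 0 < r by exact: lt_le_trans dr.
  rewrite ler_pdivlMr ?sqrtr_gt0// mulrC -ler_pdivlMr//.
  apply: sqrtr_le; first by rewrite divr_ge0 ?ltW.
  apply: (le_trans rd); have -> : (e' / L) ^+ 2 = 4 * (e' / (2 * L)) ^+ 2.
    by field; rewrite gt_eqF.
  by have := sqr_ge0 (e' / (2 * L)); lra.
have sq1 z : `|z| <= `|y| + e' -> `|gcdf (z / Num.sqrt (1 + d)) - gcdf z| <= e'.
  move=> zy; apply: (le_trans (gcdf_lip _ _)).
  have s1 : 1 <= Num.sqrt (1 + d) by rewrite -[leLHS]sqrtr1; apply: ler_wsqrtr; lra.
  have s2 : Num.sqrt (1 + d) <= 1 + d.
    by apply: sqrtr_le; [lra|rewrite expr2 ler_peMr//; lra].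
  have s0 : 0 < Num.sqrt (1 + d) by lra.
  have -> : z / Num.sqrt (1 + d) - z = - z * ((Num.sqrt (1 + d) - 1) / Num.sqrt (1 + d)).
    by field; rewrite gt_eqF.
  rewrite normrM normrN; apply: (@le_trans _ _ ((`|y| + e') * d)); last first.
    apply: (@le_trans _ _ ((`|y| + e' + 1) * (e' / (`|y| + e' + 1)))).
      have yn := normr_ge0 y.
      apply: ler_pM => //; [|exact: ltW|]; lra.
    by rewrite mulrC divfK// gt_eqF//; have := normr_ge0 y; lra.
  apply: ler_pM => //; rewrite ger0_norm; last by rewrite divr_ge0// subr_ge0.
  rewrite ler_pdivrMr//; have : d * 1 <= d * Num.sqrt (1 + d) by apply: ler_wpM2l => //; exact: ltW.
  by lra.
have main n z : `|Ex p n (fun h => gcdf ((budgeted (fun s h => - xi n s h) (v n) d' (1 + d) z n h).1 /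
     Num.sqrt (budgeted (fun s h => - xi n s h) (v n) d' (1 + d) z n h).2)) -
     gcdf (z / Num.sqrt (1 + d))| <=
  d' ^- 2 * (6 * `|b n| + 9 * `|b n| ^+ 2) * (1 + d).
  apply: (@lindeberg n (fun s h => - xi n s h) (v n) `|b n|) => //.
  - by move=> s h h' hh; rewrite (axi n s h h').
  - move=> s h sn vh; rewrite -[RHS](mulr0 (-1)) -(xi0 n s h)// -stepZ.
    by apply: eq_bigr => i _; rewrite mulN1r.
  - move=> s h sn vh; rewrite -(xiv n s h)//.
    by apply: eq_bigr => i _; rewrite sqrrN.
  - by move=> s h sn vh; rewrite normrN (le_trans (xib n s h sn vh)) ?ler_norm.
move: (v1 _ d'0) => /cvgrPdist_le/(_ _ e'0)[N1 _ H1].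
(* For [|b n| <= 1] the bracket [6 |b n| + 9 |b n|^2] is at most [15 |b n|], and [1 + d <= 2]; hence
   30. *)
pose eta := Num.min 1 (e' * d' ^+ 2 / 30).
have eta0 : 0 < eta by rewrite lt_min ltr01 divr_gt0// mulr_gt0// exprn_gt0.
move: b0 => /cvgrPdist_le/(_ _ eta0)[N2 _ H2].
exists (maxn N1 N2) => // n /=; rewrite geq_max => /andP[n1 n2].
have {H1}H1 := H1 n n1; have {H2}H2 := H2 n n2; rewrite sub0r normrN in H1.
rewrite le_min in H2; case/andP: H2; rewrite !sub0r !normrN => B1 B2.
have {B1 B2}H2 : d' ^- 2 * (6 * `|b n| + 9 * `|b n| ^+ 2) * (1 + d) <= e'.
  have Bn := normr_ge0 (b n); set B := `|b n| in B1 B2 Bn *.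
  rewrite -mulrA mulrC ler_pdivrMr ?exprn_gt0//.
  have B3 : B ^+ 2 <= B by rewrite expr2 ler_piMr.
  apply: (@le_trans _ _ (15 * B * 2)); last by lra.
  by apply: ler_pM; rewrite ?addr_ge0 ?mulr_ge0 ?sqr_ge0//; lra.
set bad := fun h => (d' <= `|\sum_(s < n) v n s h - 1|)%R%:R : R in H1.
have {H1}H1 : Ex p n bad <= e' by exact: le_trans (ler_norm _) H1.
pose G z h := gcdf ((budgeted (fun s h => - xi n s h) (v n) d' (1 + d) z n h).1 /
     Num.sqrt (budgeted (fun s h => - xi n s h) (v n) d' (1 + d) z n h).2).
have EG z : `|z| <= `|y| + e' -> `|Ex p n (G z) - gcdf z| <= 2 * e'.
  move=> zy; have -> : Ex p n (G z) - gcdf z = (Ex p n (G z) - gcdf (z / Num.sqrt (1 + d))) +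
    (gcdf (z / Num.sqrt (1 + d)) - gcdf z) by ring.
  rewrite (le_trans (ler_normD _ _))// mulr_natl mulr2n lerD ?sq1//.
  exact: le_trans (main n z) H2.
have good z h : valid n h -> bad h = 0 -> exists2 r, d' <= r <= 3 / 2 * d &
    G z h = gcdf ((z - \sum_(s < n) xi n s h) / Num.sqrt r).
  move=> vh; rewrite /bad; case: leP => [_ /eqP|/ltW]; first by rewrite oner_eq0.
  rewrite ler_norml => /andP[l1 l2] _.
  exists (1 + d - \sum_(s < n) v n s h); first by apply/andP; rewrite /d' in l1 l2 *; split; lra.
  rewrite /G (@budgeted_full n _ _ `|b n|)//; first last.
  - by rewrite /d' in l1 l2 *; lra.
  - by move=> s h' sn vh'; rewrite normrN (le_trans (xib n s h' sn vh')) ?ler_norm.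
  - move=> s h' sn vh'; rewrite -(xiv n s h')//.
    by apply: eq_bigr => i _; rewrite sqrrN.
  by rewrite sumrN.
have bad01 h : bad h = 0 \/ bad h = 1 by rewrite /bad; case: leP; [right|left].
(* For a good history with [sum xi <= y] the argument of [gcdf] is at least [e' / sqrt r >= L],
   where [gcdf] exceeds [1 - e']. *)
have up : Ex p n (fun h => (\sum_(s < n) xi n s h <= y)%R%:R) <= Ex p n (G (y + e')) + 2 * e'.
  apply: (@le_trans _ _ (Ex p n (fun h => G (y + e') h + (bad h + e')))); last first.
    by rewrite !(ExD tp) (Ex_cst tp); lra.
  apply: (Ex_le tp) => h vh; have := gcdf_ge0 ((budgeted (fun s h => - xi n s h) (v n) d' (1 + d) (y + e') n h).1 /
     Num.sqrt (budgeted (fun s h => - xi n s h) (v n) d' (1 + d) (y + e') n h).2).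
  rewrite -/(G (y + e') h) => G0.
  case: (leP _ y) => My /=; last by case: (bad01 h) => ->; lra.
  case: (bad01 h) => bh; rewrite bh; last by lra.
  have [r /andP[r1 r2] ->] := good (y + e') h vh bh.
  have [] := HL ((y + e' - \sum_(s < n) xi n s h) / Num.sqrt r); last by lra.
  apply: (le_trans (Lq _ r1 r2)); rewrite ler_wpM2r ?invr_ge0//; lra.
have lo : Ex p n (G (y - e')) <= Ex p n (fun h => (\sum_(s < n) xi n s h <= y)%R%:R) + 2 * e'.
  apply: (@le_trans _ _ (Ex p n (fun h => (\sum_(s < n) xi n s h <= y)%R%:R + (bad h + e')))); last first.
    by rewrite !(ExD tp) (Ex_cst tp); lra.
  apply: (Ex_le tp) => h vh; have := gcdf_le1 ((budgeted (fun s h => - xi n s h) (v n) d' (1 + d) (y - e') n h).1 /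
     Num.sqrt (budgeted (fun s h => - xi n s h) (v n) d' (1 + d) (y - e') n h).2).
  rewrite -/(G (y - e') h) => G1.
  case: (leP _ y) => My /=; first by case: (bad01 h) => ->; lra.
  case: (bad01 h) => bh; rewrite bh; last by lra.
  have [r /andP[r1 r2] ->] := good (y - e') h vh bh.
  have [] := HL (- ((y - e' - \sum_(s < n) xi n s h) / Num.sqrt r)); last by rewrite opprK; lra.
  apply: (le_trans (Lq _ r1 r2)); rewrite -mulNr ler_wpM2r ?invr_ge0//; lra.
have E1 : `|y + e'| <= `|y| + e' by rewrite (le_trans (ler_normD _ _))// (ger0_norm (ltW e'0)).
have E2 : `|y - e'| <= `|y| + e' by rewrite (le_trans (ler_normB _ _))// (ger0_norm (ltW e'0)).
have := EG _ E1; have := EG _ E2; rewrite !ler_norml => /andP[a1 a2] /andP[a3 a4].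
have := gcdf_lip (y + e') y; have := gcdf_lip (y - e') y.
rewrite addrAC subrr add0r addrAC subrr add0r normrN (ger0_norm (ltW e'0)) !ler_norml.
move=> /andP[a5 a6] /andP[a7 a8]; have ee : e = 8 * e' by rewrite /e'; field.
clearbody e'; clear - up lo a1 a2 a3 a4 a5 a6 a7 a8 ee e0.
by rewrite ee; apply/andP; split; lra.
Qed.

End martingale_clt.

(** * Degrees along an attachment history *)

Section degrees.
Implicit Types (h : nat -> nat) (m i k : nat).

(* The history [h 1, ..., h m] is that of a tree with the nodes [1, ..., m.+1]. *)
Definition dg m h i := degree h m.+1 i.

(* The degree of the node chosen by the step that follows the history [h 1, ..., h m]. *)
Definition chosen m h := dg m h (h m.+1).

Lemma dgS m h i : dg m.+1 h i = (dg m h i + (h m.+1 == i))%N.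
Proof. by rewrite /dg /degree big_nat_recr//= addnA. Qed.

Lemma dg0 h i : dg 0 h i = 1%N.
Proof. by rewrite /dg /degree big_geq. Qed.

Lemma dg_gt0 m h i : (0 < dg m h i)%N.
Proof. by []. Qed.

Lemma dg_le m h i : (dg m h i <= m.+1)%N.
Proof. by elim: m => [|m IH]; rewrite ?dg0// dgS; case: eqP => _; lia. Qed.

(** [degree] is 1 also before the birth of a node, so that a newborn node contributes [phi 1] to a
    node sum without a separate case. *)
Lemma dg_unborn m h i : valid m h -> (m < i)%N -> dg m h i = 1%N.
Proof.
elim: m => [|m IH] vh mi; first by rewrite dg0.
rewrite dgS IH ?(ltnW mi)//; last exact: valid_leq vh.
have /andP[_ hm] : (0 < h m.+1 <= m.+1)%N by apply: vh; rewrite leqnn.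
by case: eqP => // hi; rewrite hi leqNgt mi in hm.
Qed.

Lemma dg_adapted m i : adapted m (dg m ^~ i).
Proof.
by move=> h h' hh; congr (_ + _)%N; apply: eq_big_nat => t /hh ->.
Qed.

Lemma chosen_upd m h i : chosen m (upd h m.+1 i) = dg m h i.
Proof.
by rewrite /chosen (adapted_upd h i (@dg_adapted m _)) /upd eqxx.
Qed.

Lemma chosen_adapted m : adapted m.+1 (chosen m).
Proof.
move=> h h' hh; rewrite /chosen hh ?leqnn//.
by apply: dg_adapted => t /andP[t0 tm]; apply: hh; rewrite t0 ltnW.
Qed.

Variable V : nmodType.

Definition node_sum m (phi : nat -> V) h := \sum_(1 <= i < m.+2) phi (dg m h i).

Lemma node_sum_adapted m phi : adapted m (node_sum m phi).
Proof. by move=> h h' hh; apply: eq_bigr => i _; rewrite (dg_adapted i hh). Qed.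

Lemma node_sum0 phi h : node_sum 0 phi h = phi 1%N.
Proof. by rewrite /node_sum big_nat1 dg0. Qed.

End degrees.

(** * Degree counts, the likelihood and the kernel of the true model *)

Section node_sums.
Variable R : realType.
Implicit Types (h : nat -> nat) (phi psi : nat -> R) (m k : nat).

Lemma node_sumS m phi h : valid m.+1 h ->
  node_sum m.+1 phi h =
  node_sum m phi h + (phi (chosen m h).+1 - phi (chosen m h)) + phi 1%N.
Proof.
move=> vh; rewrite /node_sum big_nat_recr//= dg_unborn//; congr (_ + _).
have /andP[h1 hm] : (0 < h m.+1 <= m.+1)%N by apply: vh; rewrite leqnn.
have hin : h m.+1 \in index_iota 1 m.+2 by rewrite mem_index_iota h1 ltnS.
rewrite (bigD1_seq _ hin (iota_uniq _ _)) [in RHS](bigD1_seq _ hin (iota_uniq _ _))/=.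
rewrite dgS eqxx addn1 -/(chosen m h).
rewrite (eq_bigr (fun i => phi (dg m h i))); first by ring.
by move=> i hi; rewrite dgS eq_sym (negbTE hi) addn0.
Qed.

(** A node of degree [d] has been chosen exactly once at each of the degrees 1 to [d - 1]. *)
Lemma node_sum_choices m phi h : valid m h ->
  \sum_(s < m) phi (chosen s h) = node_sum m (fun d => \sum_(1 <= k < d) phi k) h.
Proof.
elim: m => [|m IH] vh; first by rewrite big_ord0 node_sum0 big_geq.
rewrite big_ord_recr/= IH ?node_sumS//; last exact: valid_leq vh.
by rewrite big_nat_recr//= [\sum_(1 <= k < 1) _]big_geq//; ring.
Qed.

(** This is [n P_(>k)(n)] at [n = m.+1]. For [k > 0] it is also the number of past steps that chose
    a node of degree [k]. *)
Definition exceed m k h : R := node_sum m (fun d => (k < d)%N%:R) h.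

Lemma exceed_adapted m k : adapted m (exceed m k).
Proof. exact: node_sum_adapted. Qed.

Lemma exceed0 k h : exceed 0 k h = (k == 0%N)%:R.
Proof. by rewrite /exceed node_sum0; case: k. Qed.

Lemma exceed_root m h : exceed m 0 h = m.+1%:R.
Proof.
rewrite /exceed /node_sum (eq_bigr (fun=> 1)); last by move=> i _; rewrite dg_gt0.
by rewrite sumr_const_nat subSS subn0.
Qed.

Lemma exceed_big m k h : (m < k)%N -> exceed m k h = 0.
Proof.
move=> mk; apply: big1 => i _.
by rewrite ltnNge (leq_trans (dg_le m h i) mk).
Qed.

Lemma exceed_bounds m k h : 0 <= exceed m k h <= m.+1%:R.
Proof.
rewrite -(exceed_root m h) {1}/exceed sumr_ge0//=; apply: ler_sum => i _.
by rewrite dg_gt0 ler_nat leq_b1.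
Qed.

Lemma exceedS m k h : valid m.+1 h ->
  exceed m.+1 k h = exceed m k h + (chosen m h == k)%:R + (k == 0%N)%:R.
Proof.
move=> vh; rewrite /exceed node_sumS//; congr (_ + _ + _); last by case: k.
by rewrite ltnS leq_eqVlt eq_sym; case: eqP => [->|_] /=; rewrite ?ltnn ?subr0 ?subrr.
Qed.

Lemma sum_choices_exceed m phi h : valid m h ->
  \sum_(s < m) phi (chosen s h) = \sum_(1 <= k < m.+2) phi k * exceed m k h.
Proof.
move=> vh; rewrite node_sum_choices// /node_sum.
under [RHS]eq_bigr do rewrite /exceed /node_sum mulr_sumr.
rewrite exchange_big/=; apply: eq_bigr => i _.
rewrite [RHS](big_cat_nat (n := dg m h i))//=; last exact/leqW/dg_le.
rewrite [X in _ = _ + X]big_nat_cond [X in _ = _ + X]big1 ?addr0; last first.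
  by move=> k; rewrite andbT => /andP[dk _]; rewrite ltnNge dk mulr0.
by apply: eq_big_nat => k /andP[_ ->]; rewrite mulr1.
Qed.

Lemma num_degE m k h : num_deg h m.+1 k = node_sum m (fun d => (d == k : nat)) h.
Proof. by []. Qed.

Lemma natr_node_sum m (phi : nat -> nat) h :
  (node_sum m phi h)%:R = node_sum m (fun d => (phi d)%:R) h :> R.
Proof. by rewrite /node_sum natr_sum. Qed.

Lemma tail_prop_exceed m k h :
  tail_prop h R m.+1 k = m.+1%:R^-1 * exceed m k h.
Proof.
rewrite /tail_prop; congr (_ * _).
under eq_bigr do rewrite num_degE natr_node_sum /node_sum.
rewrite exchange_big/=; apply: eq_bigr => i _.
rewrite -natr_sum; congr (_ %:R); have dm := dg_le m h i.
have [kd|dk] := ltnP k (dg m h i).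
  rewrite (bigD1_seq (dg m h i)) ?iota_uniq ?mem_index_iota ?kd//= eqxx big1 => [|l /negbTE].
    by [].
  by rewrite eq_sym => ->.
rewrite big_nat_cond big1// => l /andP[/andP[kl _] _].
by rewrite (_ : _ == _ = false)//; apply/eqP; lia.
Qed.

Lemma tot_weight_node_sum m (f : nat -> R) h : tot_weight h f m.+1 = node_sum m f h.
Proof.
rewrite /tot_weight; under eq_bigr do rewrite num_degE natr_node_sum /node_sum mulr_sumr.
rewrite exchange_big/=; apply: eq_bigr => i _.
have dm := dg_le m h i.
rewrite (bigD1_seq (dg m h i)) ?iota_uniq ?mem_index_iota ?dg_gt0//= eqxx mulr1.
by rewrite big1 ?addr0// => l; rewrite eq_sym => /negbTE ->; rewrite mulr0.
Qed.

(** The log-likelihood is the sum over the steps of the logarithm of the conditional probability of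
    the choice. *)
Lemma loglikE m (f : nat -> R) h : valid m h ->
  m.+1%:R * loglik h m.+1 f =
  \sum_(s < m) (ln (f (chosen s h)) - ln (node_sum s f h)).
Proof.
move=> vh; rewrite sumrB (@sum_choices_exceed m (fun k => ln (f k)))//.
rewrite /loglik mulrBr; congr (_ - _).
  rewrite mulr_sumr; apply: eq_bigr => k _; rewrite tail_prop_exceed.
  by rewrite mulrCA mulVKf// pnatr_eq0.
rewrite mulrA divff ?pnatr_eq0// mul1r big_add1/= big_add1/= big_mkord.
by apply: eq_bigr => s _; rewrite tot_weight_node_sum.
Qed.

Variable a : R.
Hypothesis a1 : -1 < a.

(** The degrees of the [m.+1] nodes add up to [2 m + 1]. *)
Definition weight_sum m : R := (2 + a) * m%:R + (1 + a).

Definition pa_kernel h m i : R := ((dg m h i)%:R + a) / weight_sum m.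

Lemma weight_sum_ge m : (1 + a) * m.+1%:R <= weight_sum m.
Proof.
by rewrite /weight_sum -natr1; have : 0 <= m%:R :> R by []; lra.
Qed.

Lemma weight_sum_gt0 m : 0 < weight_sum m.
Proof. by apply: lt_le_trans (weight_sum_ge m); rewrite mulr_gt0// -ltrBlDl sub0r. Qed.

Lemma node_sum_weight m h : valid m h ->
  node_sum m (fun d => d%:R + a) h = weight_sum m.
Proof.
elim: m => [|m IH] vh; first by rewrite node_sum0 /weight_sum mulr0 add0r.
rewrite node_sumS// IH; last exact: valid_leq vh.
by rewrite /weight_sum -!natr1; ring.
Qed.

Lemma deg_weight_gt0 k : (0 < k)%N -> 0 < k%:R + a.
Proof.
by rewrite -(ler1n R) => k1; have := a1; lra.
Qed.

Lemma pa_transition : transition pa_kernel.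
Proof.
split=> [m h i vh im|m h vh|m i h h' hh].
- by rewrite divr_ge0 ?ltW ?weight_sum_gt0// deg_weight_gt0.
- rewrite -mulr_suml -/(node_sum m (fun d => d%:R + a) h) node_sum_weight//.
  by rewrite divff// gt_eqF// weight_sum_gt0.
- by rewrite /pa_kernel (dg_adapted i hh).
Qed.

(** The conditional mean, given the first [m] choices, of [phi] at the degree chosen next. *)
Definition cmean m phi h := node_sum m (fun d => (d%:R + a) * phi d) h / weight_sum m.

Lemma cmean_step m phi h : step pa_kernel m (fun h => phi (chosen m h)) h = cmean m phi h.
Proof.
rewrite /cmean mulr_suml; apply: eq_bigr => i _.
by rewrite chosen_upd /pa_kernel mulrAC.
Qed.

Lemma cmean_adapted m phi : adapted m (cmean m phi).
Proof. by move=> h h' hh; rewrite /cmean (node_sum_adapted _ hh). Qed.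

Lemma cmeanD m phi psi h : cmean m (fun k => phi k + psi k) h = cmean m phi h + cmean m psi h.
Proof. by rewrite -!cmean_step stepD. Qed.

Lemma cmeanZ m c phi h : cmean m (fun k => c * phi k) h = c * cmean m phi h.
Proof. by rewrite -!cmean_step stepZ. Qed.

Lemma cmean_le m phi psi h : (forall k, (0 < k <= m.+1)%N -> phi k <= psi k) ->
  cmean m phi h <= cmean m psi h.
Proof.
move=> le; apply: ler_wpM2r; first by rewrite invr_ge0 ltW// weight_sum_gt0.
apply: ler_sum => i _.
by rewrite ler_wpM2l ?le ?dg_le//; exact/ltW/deg_weight_gt0.
Qed.

Lemma cmean_eq m phi psi h : (forall k, (0 < k <= m.+1)%N -> phi k = psi k) ->
  cmean m phi h = cmean m psi h.
Proof. by move=> eq; apply/eqP; rewrite eq_le !cmean_le// => k /eq ->. Qed.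

Lemma cmean_cst m c h : valid m h -> cmean m (fun=> c) h = c.
Proof.
by move=> vh; rewrite -cmean_step (step_cst pa_transition).
Qed.

Lemma cmean_sum (I : Type) (r : seq I) (P : pred I) (F : I -> nat -> R) m h :
  cmean m (fun k => \sum_(i <- r | P i) F i k) h = \sum_(i <- r | P i) cmean m (F i) h.
Proof.
rewrite /cmean -mulr_suml; congr (_ / _); rewrite /node_sum exchange_big/=.
by apply: eq_bigr => j _; rewrite mulr_sumr.
Qed.

Lemma cmean_exceed m k h :
  cmean m (fun d => (d == k.+1)%:R) h =
  (k.+1%:R + a) * (exceed m k h - exceed m k.+1 h) / weight_sum m.
Proof.
congr (_ / _); rewrite /exceed -sumrB mulr_sumr; apply: eq_bigr => i _.
have [->|] := eqVneq (dg m h i) k.+1; first by rewrite ltnSn ltnn subr0.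
move=> ne; rewrite mulr0 (_ : (k < dg m h i)%N = (k.+1 < dg m h i)%N) ?subrr ?mulr0//.
by rewrite [RHS]ltn_neqAle eq_sym ne.
Qed.

End node_sums.

(** * Series dominated by powers *)

Section power_tails.
Variable R : realType.
Implicit Types (s e C : R) (K n k : nat) (u : nat -> R).

(** The growth of the scores; the added 1 makes it absorb constants. *)
Definition lw k : R := 1 + ln k.+1%:R.

Lemma lw_ge1 k : 1 <= lw k.
Proof. by rewrite lerDl ln_ge0// ler1n. Qed.

(** The comparison of a sum of powers with an integral, in telescoping form. *)
Lemma powR_step s k : 0 < s -> (0 < k)%N ->
  k.+1%:R `^ (- (1 + s)) <= s^-1 * (k%:R `^ (- s) - k.+1%:R `^ (- s)) :> R.
Proof.
move=> s0 k0; have k0' : 0 < k%:R :> R by rewrite ltr0n.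
have k1 : 0 < k.+1%:R :> R by rewrite ltr0n.
have d1 : ln (k%:R / k.+1%:R) <= - k.+1%:R^-1 :> R.
  have -> : k%:R / k.+1%:R = 1 + - k.+1%:R^-1 :> R.
    by rewrite -natr1; field; rewrite natr1 gt_eqF.
  by apply: le_ln1Dx; rewrite ltrN2 invf_lt1// ltr1n ltnS.
rewrite ln_div ?posrE// in d1.
have -> : k%:R `^ (- s) = k.+1%:R `^ (- s) * expR (s * (ln k.+1%:R - ln k%:R)) :> R.
  by rewrite /powR !gt_eqF// -expRD; congr expR; ring.
have -> : k.+1%:R `^ (- (1 + s)) = k.+1%:R `^ (- s) * k.+1%:R^-1 :> R.
  rewrite (_ : - (1 + s) = - s + -1); last by ring.
  by rewrite powRD ?powR_inv1 ?ler0n//; apply/implyP => _; rewrite gt_eqF.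
have e1 := expR_ge1Dx (s * (ln k.+1%:R - ln k%:R) : R).
have p0 := powR_gt0 (- s) k1.
rewrite -[X in _ - X]mulr1 -mulrBr mulrCA ler_wpM2l ?(ltW p0)//.
rewrite -ler_pdivrMl ?invr_gt0// invrK.
apply: (@le_trans _ _ (s * (ln k.+1%:R - ln k%:R))); last by lra.
by apply: ler_wpM2l; [exact: ltW|rewrite -lerN2 opprB].
Qed.

Lemma powR_tail s K n : 0 < s -> (0 < K)%N ->
  \sum_(K <= k < n) k.+1%:R `^ (- (1 + s)) <= s^-1 * K%:R `^ (- s) :> R.
Proof.
move=> s0 K0; have [Kn|nK] := leqP K n; last first.
  by rewrite big_geq ?(ltnW nK)// mulr_ge0 ?powR_ge0// invr_ge0 ltW.
apply: (@le_trans _ _ (\sum_(K <= k < n) (s^-1 * k%:R `^ (- s) - s^-1 * k.+1%:R `^ (- s)))).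
  apply: ler_sum_nat => k /andP[Kk _]; rewrite -mulrBr powR_step//.
  exact: leq_trans Kk.
rewrite (eq_bigr (fun k => - (s^-1 * k.+1%:R `^ (- s)) - - (s^-1 * k%:R `^ (- s)))); last first.
  by move=> k _; ring.
by rewrite telescope_sumr// opprK addrC gerBl mulr_ge0 ?powR_ge0// invr_ge0 ltW.
Qed.

Lemma powR_tail_small s C e : 0 < s -> 0 < e ->
  exists2 K, (0 < K)%N & forall n, C * \sum_(K <= k < n) k.+1%:R `^ (- (1 + s)) <= e.
Proof.
move=> s0 e0; pose C' := `|C| + 1; have C0 : 0 < C' by rewrite ltr_wpDl.
(* [x] solves [C' / s * x^(- s) = e], the bound of [powR_tail] at a real starting point. *)
pose x := (C' / (s * e)) `^ s^-1.
have x0 : 0 <= x by exact: powR_ge0.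
exists (Num.truncn x).+1 => // n; set K := _.+1.
have xK : x <= K%:R by rewrite ltW// truncnS_gt.
apply: (@le_trans _ _ (C' * (s^-1 * K%:R `^ (- s)))).
  apply: (@le_trans _ _ (C' * \sum_(K <= k < n) k.+1%:R `^ (- (1 + s)))).
    apply: ler_wpM2r; first by apply: sumr_ge0 => k _; exact: powR_ge0.
    by have := ler_norm C; rewrite /C'; lra.
  by rewrite ler_wpM2l ?(ltW C0)// powR_tail.
have : x `^ s <= K%:R `^ s by apply: ge0_ler_powR => //; rewrite ?ltW ?nnegrE.
rewrite /x -powRrM mulVf ?gt_eqF// powRr1; last by rewrite divr_ge0 ?mulr_ge0 ?ltW.
rewrite powRN => le; have K0 : 0 < K%:R `^ s :> R by rewrite powR_gt0.
rewrite mulrA ler_pdivrMr//; move: le; rewrite ler_pdivrMr ?mulr_gt0// => le.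
by rewrite ler_pdivrMr//; apply: (le_trans le); rewrite mulrA mulrC mulrA.
Qed.

Lemma lw_sqr_le s k : 0 < s -> lw k ^+ 2 <= (1 + s^-1) ^+ 2 * k.+1%:R `^ (2 * s).
Proof.
move=> s0; have k1 : 1 <= k.+1%:R :> R by rewrite ler1n.
have k0 : 0 < k.+1%:R :> R by exact: lt_le_trans k1.
have p0 : 0 < k.+1%:R `^ s :> R by exact: powR_gt0.
have p1 : 1 <= k.+1%:R `^ s :> R.
  by rewrite -[leLHS](powRr0 k.+1%:R); apply: ler_powR => //; exact: ltW.
have l1 : ln k.+1%:R <= s^-1 * k.+1%:R `^ s :> R.
  rewrite -ler_pdivrMl ?invr_gt0// invrK -ln_powR.
  by apply/ltW/ln_sublinear.
have -> : k.+1%:R `^ (2 * s) = (k.+1%:R `^ s) ^+ 2 :> R.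
  by rewrite mulrC powRrM powR_mulrn// ltW.
have l0 := lw_ge1 k; rewrite -exprMn ler_pXn2r ?nnegrE//.
- by rewrite /lw mulrDl mul1r lerD.
- by rewrite ltW// (lt_le_trans ltr01).
- by rewrite mulr_ge0 ?ltW// addr_gt0// invr_gt0.
Qed.

Section dominated_series.
Variables (u : nat -> R) (C s : R).
Hypothesis s0 : 0 < s.
Hypothesis uC : forall k, (0 < k)%N -> `|u k| <= C * k.+1%:R `^ (- (1 + s)).

Lemma dominated_ge0 : 0 <= C.
Proof.
have := le_trans (normr_ge0 _) (uC (ltnSn 0)).
by rewrite pmulr_lge0// powR_gt0.
Qed.

Lemma dominated_tail K n : (0 < K)%N ->
  `|\sum_(K <= k < n) u k| <= C * \sum_(K <= k < n) k.+1%:R `^ (- (1 + s)).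
Proof.
move=> K0; rewrite (le_trans (ler_norm_sum _ _ _))// mulr_sumr.
by apply: ler_sum_nat => k /andP[Kk _]; apply: uC; exact: leq_trans Kk.
Qed.

Lemma pos_series_cvg :
  (fun n => \sum_(1 <= k < n.+1) u k) @ \oo --> pos_series u.
Proof.
suff : cvgn (series (fun k => u k.+1)).
  rewrite (_ : series _ = (fun n => \sum_(1 <= k < n.+1) u k)) //.
  by apply/funext => n; rewrite seriesEnat/= [RHS]big_add1.
apply: normed_cvg; apply: nondecreasing_is_cvgn.
  by apply/nondecreasing_seqP => n; rewrite /= [leRHS]big_nat_recr//= lerDl.
exists (C * (s^-1 * 1%:R `^ (- s))) => _ [n _ <-].
rewrite (_ : _ n = \sum_(1 <= k < n.+1) `|u k|); last by rewrite [RHS]big_add1.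
apply: (@le_trans _ _ (C * \sum_(1 <= k < n.+1) k.+1%:R `^ (- (1 + s)))).
  rewrite mulr_sumr; apply: ler_sum_nat => k /andP[k1 _]; exact: uC.
by rewrite ler_wpM2l ?dominated_ge0// powR_tail.
Qed.

Lemma pos_series_tail K e : (0 < K)%N ->
  (forall n, C * \sum_(K <= k < n) k.+1%:R `^ (- (1 + s)) <= e) ->
  `|pos_series u - \sum_(1 <= k < K) u k| <= e.
Proof.
move=> K0 tail.
have cv : (fun n => `|\sum_(1 <= k < n.+1) u k - \sum_(1 <= k < K) u k|) @ \oo -->
    `|pos_series u - \sum_(1 <= k < K) u k|.
  by apply: cvg_norm; apply: cvgB; [exact: pos_series_cvg|exact: cvg_cst].
apply: (cvgr_to_le cv); exists K => // n /= Kn.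
rewrite (big_cat_nat (n := K))//=; last exact: leqW.
by rewrite addrAC subrr add0r (le_trans (dominated_tail _ K0)).
Qed.

End dominated_series.

Lemma pos_series_lin C1 C2 s u1 u2 x y : 0 < s ->
  (forall k, (0 < k)%N -> `|u1 k| <= C1 * k.+1%:R `^ (- (1 + s))) ->
  (forall k, (0 < k)%N -> `|u2 k| <= C2 * k.+1%:R `^ (- (1 + s))) ->
  pos_series (fun k => x * u1 k + y * u2 k) = x * pos_series u1 + y * pos_series u2.
Proof.
move=> s0 h1 h2; have c1 := pos_series_cvg s0 h1; have c2 := pos_series_cvg s0 h2.
apply/cvg_lim => //.
rewrite (_ : (fun n => _) = (fun n => x * \sum_(1 <= k < n.+1) u1 k + y * \sum_(1 <= k < n.+1) u2 k)).
  by apply: cvgD; apply: cvgMr.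
by apply/funext => n; rewrite big_split/= !mulr_sumr.
Qed.

Lemma eq_pos_series u1 u2 : (forall k, (0 < k)%N -> u1 k = u2 k) ->
  pos_series u1 = pos_series u2.
Proof.
move=> e12; congr (limn _); apply/funext => n.
by apply: eq_big_nat => k /andP[k0 _]; exact: e12.
Qed.

End power_tails.

(** * Limiting tail proportions of the degrees *)

Section vprod.
Variable R : realType.
Implicit Types (a rho M : R) (k n : nat).

(** At [rho = 2 + a], the value of lambda* for [f(k) = k + a], this is the limiting proportion of
    nodes of degree above [k]. A slightly smaller [rho] gives a majorant valid at all times. *)
Definition vprod a rho k : R := \prod_(1 <= j < k.+1) ((j%:R + a) / (j%:R + a + rho)).

Lemma vprod0 a rho : vprod a rho 0 = 1.
Proof. by rewrite /vprod big_geq. Qed.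

Lemma vprodS a rho k :
  vprod a rho k.+1 = vprod a rho k * ((k.+1%:R + a) / (k.+1%:R + a + rho)).
Proof. by rewrite /vprod big_nat_recr. Qed.

Section positive.
Variables (a rho : R).
Hypotheses (a1 : -1 < a) (rho0 : 0 < rho).

Let ka k : 0 < k.+1%:R + a.
Proof. by rewrite -natr1; have : 0 <= k%:R :> R by []; have := a1; lra. Qed.

Let kar k : 0 < k.+1%:R + a + rho.
Proof. exact: addr_gt0. Qed.

Lemma vprod_gt0 k : 0 < vprod a rho k.
Proof.
by elim: k => [|k IH]; rewrite ?vprod0// vprodS mulr_gt0// divr_gt0 ?kar ?ka.
Qed.

(** The balance equation: the flow out of degree [k.+1] equals the growth of the count above
    [k.+1]. *)
Lemma vprod_rec k :
  (k.+1%:R + a) * (vprod a rho k - vprod a rho k.+1) = rho * vprod a rho k.+1.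
Proof.
rewrite vprodS; field; rewrite gt_eqF//.
by have := ka k; rewrite -natr1; have := rho0; lra.
Qed.

Lemma vprod_nincr k n : (k <= n)%N -> vprod a rho n <= vprod a rho k.
Proof.
move=> /subnKC <-; elim: (n - k)%N => [|d IH]; rewrite ?addn0// addnS.
apply: le_trans IH; rewrite vprodS ler_piMr ?(ltW (vprod_gt0 _))//.
by rewrite ler_pdivrMr ?kar// mul1r lerDl ltW.
Qed.

Lemma vprod_le1 k : vprod a rho k <= 1.
Proof. by rewrite -(vprod0 a rho) vprod_nincr. Qed.

(** With [y = k.+1 + a + rho], a factor is [1 - rho / y], at most [exp (- rho / y)] and so at most
    [(y / (y + 1))^rho]; these bounds telescope. *)
Lemma vprod_powR k : vprod a rho k <= ((1 + a + rho) / (k.+1%:R + a + rho)) `^ rho.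
Proof.
have kr i : 0 < i.+1%:R + a + rho by rewrite addr_gt0 ?ka.
elim: k => [|k IH]; first by rewrite vprod0 divff ?powR1// gt_eqF// (kr 0%N).
have -> : (1 + a + rho) / (k.+2%:R + a + rho) =
    (1 + a + rho) / (k.+1%:R + a + rho) * ((k.+1%:R + a + rho) / (k.+2%:R + a + rho)).
  by rewrite mulrA divfK// gt_eqF.
rewrite powRM ?divr_ge0 ?(ltW (kr _)) ?(ltW (kr 0%N))// vprodS.
apply: ler_pM => //; first exact/ltW/vprod_gt0.
  by rewrite divr_ge0 ?ltW.
set y := k.+1%:R + a + rho.
have y0 : 0 < y by exact: kr.
have -> : k.+2%:R + a + rho = y + 1 by rewrite /y -natr1; ring.
have -> : (k.+1%:R + a) / y = 1 + - (rho / y).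
  by have -> : k.+1%:R + a = y - rho by [rewrite /y addrK]; field; rewrite gt_eqF.
apply: (le_trans (expR_ge1Dx _)).
have y10 : 0 < y / (y + 1) by rewrite divr_gt0// addr_gt0.
rewrite /powR gt_eqF// ler_expR -mulrN ler_wpM2l ?(ltW rho0)//.
rewrite -[X in ln X]invrK lnV ?posrE ?invr_gt0// lerN2 invf_div.
have -> : (y + 1) / y = 1 + y^-1 by field; rewrite gt_eqF.
by apply: le_ln1Dx; apply: lt_trans (_ : 0 < _); rewrite ?invr_gt0//; lra.
Qed.

(** Half of the excess [sg] of the decay exponent over 1 pays for the squared logarithm. The
    constant depends on [a] and [rho] only through [sg] and [M], which later makes it uniform in the
    parameter. *)
Lemma vprod_lw sg M k : 0 < sg -> 1 + sg <= rho -> 1 + a + rho <= M ->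
  vprod a rho k * lw R k ^+ 2 <=
  (M `^ (1 + sg) * (1 + (sg / 4)^-1) ^+ 2) * k.+1%:R `^ (- (1 + sg / 2)).
Proof.
move=> sg0 sgr aM; have kr : 0 < k.+1%:R + a + rho by rewrite addr_gt0 ?ka.
have k0 : 0 < k.+1%:R :> R by rewrite ltr0n.
have ar : 0 < a + rho by have := a1; lra.
have M0 : 0 < M by apply: lt_le_trans aM; rewrite -addrA addr_gt0.
have q0 : 0 < (1 + a + rho) / (k.+1%:R + a + rho).
  by rewrite divr_gt0// -addrA addr_gt0.
have v1 : vprod a rho k <= (M / k.+1%:R) `^ (1 + sg).
  apply: (le_trans (vprod_powR k)).
  apply: (@le_trans _ _ (((1 + a + rho) / (k.+1%:R + a + rho)) `^ (1 + sg))).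
    apply: ger_powR => //; rewrite q0/= ler_pdivrMr// mul1r -!addrA lerD2r.
    by rewrite ler1n.
  apply: ge0_ler_powR; rewrite ?nnegrE ?(ltW q0)//; first by lra.
    by rewrite divr_ge0 ?ltW.
  apply: ler_pM => //; first by lra.
    by rewrite invr_ge0 ltW.
  by rewrite lef_pV2 ?posrE// -addrA lerDl ltW.
have s4 : 0 < sg / 4 by rewrite divr_gt0.
have l2 := lw_sqr_le k s4.
apply: (@le_trans _ _ ((M / k.+1%:R) `^ (1 + sg) * ((1 + (sg / 4)^-1) ^+ 2 * k.+1%:R `^ (2 * (sg / 4))))).
  by apply: ler_pM => //; [exact/ltW/vprod_gt0|exact: sqr_ge0].
rewrite powRM ?invr_ge0 ?(ltW k0) ?(ltW M0)// -powR_inv1 ?(ltW k0)// -powRrM.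
set A := (1 + _) ^+ 2.
have -> : M `^ (1 + sg) * k.+1%:R `^ (-1 * (1 + sg)) * (A * k.+1%:R `^ (2 * (sg / 4))) =
  M `^ (1 + sg) * A * (k.+1%:R `^ (-1 * (1 + sg)) * k.+1%:R `^ (2 * (sg / 4))) by ring.
rewrite -powRD; last by apply/implyP => _; rewrite gt_eqF.
by rewrite (_ : -1 * (1 + sg) + 2 * (sg / 4) = - (1 + sg / 2))//; field.
Qed.

End positive.

End vprod.

(** * Law of large numbers and tail bounds for the degree counts *)

Section degree_lln.
Variables (R : realType) (a : R).
Hypothesis a1 : -1 < a.
Implicit Types (h : nat -> nat) (phi psi : nat -> R) (m k : nat).

Let p := pa_kernel a.
Let tp : transition p := pa_transition a1.
Let rho := 2 + a.

Definition ulim k : R := vprod a (2 + a) k.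

Let rho1 : 1 < rho. Proof. by rewrite /rho; have := a1; lra. Qed.
Let rho0 : 0 < 2 + a. Proof. by have := a1; lra. Qed.

Lemma weight_sumE m : weight_sum a m = rho * m.+1%:R - 1.
Proof. by rewrite /weight_sum /rho -natr1; ring. Qed.

Lemma ulim_bounds k : 0 <= ulim k <= 1.
Proof. by rewrite ltW ?vprod_gt0//= vprod_le1. Qed.

(** Induction on [k]: the deviation [X] at level [k.+1] is pulled towards the deviation [Y] at level
    [k]. The cross term [2 X (Y - X)] is at most [Y^2], of mean O(m) by induction; divided by a
    total weight of order [m] it adds O(1) per step. *)
Lemma exceed_lln k : exists2 C, 0 <= C &
  forall m, Ex p m (fun h => (exceed R m k h - m.+1%:R * ulim k) ^+ 2) <= C * m.+1%:R.
Proof.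
elim: k => [|k [C C0 IH]].
  exists 0 => // m; rewrite mul0r -(Ex_cst tp m 0); apply: (Ex_le tp) => h vh.
  by rewrite exceed_root /ulim vprod0 mulr1 subrr expr0n.
have kk : 0 < k.+1%:R + a by exact: deg_weight_gt0.
have a10 : 0 < 1 + a by have := a1; lra.
have /andP[u0 u1] := ulim_bounds k.+1.
(* The costs of one step: the pull towards level [k], the error of the drift, and the squared
   jump. *)
pose C' := (k.+1%:R + a) / (1 + a) * C + 2 / (1 + a) + 1.
have C'0 : 0 <= C'.
  have f0 : 0 <= (k.+1%:R + a) / (1 + a) * C by rewrite mulr_ge0// divr_ge0 ?ltW.
  have : 0 <= 2 / (1 + a) by rewrite divr_ge0// ltW.
  by rewrite /C'; lra.
exists (1 + C'); first by rewrite addr_ge0.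
suff H m : Ex p m (fun h => (exceed R m k.+1 h - m.+1%:R * ulim k.+1) ^+ 2) <= 1 + C' * m%:R.
  move=> m; clearbody C'; apply: (le_trans (H m)); rewrite mulrDl mul1r; apply: lerD.
    by rewrite ler1n.
  by rewrite ler_wpM2l// ler_nat.
elim: m => [|m IHm].
  rewrite mulr0 addr0 -(Ex_cst tp 0 1); apply: (Ex_le tp) => h _.
  by rewrite exceed0/= sub0r mul1r sqrrN expr2 mulr_ile1.
have -> : 1 + C' * m.+1%:R = 1 + C' * m%:R + C' by rewrite -[m.+1%:R]natr1; ring.
pose X h := exceed R m k.+1 h - m.+1%:R * ulim k.+1.
pose Y h := exceed R m k h - m.+1%:R * ulim k.
apply: (@le_trans _ _ (Ex p m (fun h => X h ^+ 2 +
   ((k.+1%:R + a) / (1 + a) / m.+1%:R * Y h ^+ 2 + (2 / (1 + a) + 1))))).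
  apply: (@Ex_le _ p tp m (step p m _)) => h vh.
  pose J h := (chosen m h == k.+1)%:R : R.
  apply: (@le_trans _ _ (step p m (fun h' => X h' ^+ 2 +
     ((2 * X h') * (J h' + - ulim k.+1) + 1)) h)).
    apply: (step_le tp vh) => h' vh'; rewrite exceedS//= addr0.
    rewrite (_ : _ - _ = X h' + (J h' - ulim k.+1)); last first.
      by rewrite /X /J -[m.+2%:R]natr1; ring.
    rewrite sqrrD -addrA lerD2l; apply: lerD; first by rewrite -mulr_natl mulrA.
    have : 0 <= J h' <= 1 by rewrite /J; case: eqP => _ /=; rewrite ?lexx ?ler01.
    move=> /andP[J0 J1]; rewrite -(real_normK (num_real _)) expr_le1//.
    by rewrite ler_norml; lra.
  have aX : adapted m X by move=> h1 h2 hh; rewrite /X (exceed_adapted _ _ hh).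
  rewrite !stepD step_adapted//; last by move=> h1 h2 hh; rewrite (aX _ _ hh).
  rewrite lerD2l addrA (step_cst tp)// lerD2r.
  rewrite (@step_adaptedM _ p m (fun h => 2 * X h)); last first.
    by move=> h1 h2 hh; rewrite (aX _ _ hh).
  rewrite stepD (step_cst tp)// (@cmean_step R a m (fun d => (d == k.+1)%:R)).
  rewrite cmean_exceed//.
  set S := weight_sum a m; have S0 : 0 < S by exact: weight_sum_gt0.
  have SE : S = rho * m.+1%:R - 1 by exact: weight_sumE.
  have urec := vprod_rec a1 rho0 k.
  have Xb : `|X h| <= m.+1%:R.
    have /andP[e0 e1] := exceed_bounds R m k.+1 h.
    have : 0 <= m.+1%:R * ulim k.+1 <= m.+1%:R by rewrite mulr_ge0//= ler_piMr.
    by move=> /andP[? ?]; rewrite /X ler_norml; lra.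
  have Sm : (1 + a) * m.+1%:R <= S by exact: weight_sum_ge.
  (* The balance equation cancels the main terms; the [- 1] in [weight_sumE] leaves [u / S]. *)
  have E : (k.+1%:R + a) * (exceed R m k h - exceed R m k.+1 h) / S - ulim k.+1 =
    (k.+1%:R + a) * (Y h - X h) / S + ulim k.+1 / S.
    have -> : Y h - X h = exceed R m k h - exceed R m k.+1 h - m.+1%:R * (ulim k - ulim k.+1).
      by rewrite /X /Y; ring.
    rewrite [in RHS]mulrBr [(k.+1%:R + a) * (m.+1%:R * _)]mulrCA urec -/(ulim k.+1).
    have -> : m.+1%:R * ((2 + a) * ulim k.+1) = (S + 1) * ulim k.+1.
      by rewrite SE /rho; ring.
    by field; rewrite gt_eqF.
  rewrite E; set f := k.+1%:R + a in kk urec *.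
  apply: (@le_trans _ _ (f / S * Y h ^+ 2 + 2 * m.+1%:R / S)).
    have -> : 2 * X h * (f * (Y h - X h) / S + ulim k.+1 / S) =
      (2 * (f * X h * (Y h - X h)) + 2 * (X h * ulim k.+1)) / S by field; rewrite gt_eqF.
    have -> : f / S * Y h ^+ 2 + 2 * m.+1%:R / S = (f * Y h ^+ 2 + 2 * m.+1%:R) / S.
      by field; rewrite gt_eqF.
    rewrite ler_wpM2r ?invr_ge0 ?(ltW S0)//; apply: lerD.
      have : 0 <= f * (Y h - X h) ^+ 2 by rewrite mulr_ge0 ?sqr_ge0 ?ltW.
      have : 0 <= f * X h ^+ 2 by rewrite mulr_ge0 ?sqr_ge0 ?ltW.
      by lra.
    rewrite ler_wpM2l//; apply: (le_trans (ler_norm _)); rewrite normrM.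
    by rewrite (ger0_norm u0) -[leRHS]mulr1 ler_pM.
  have m0 : 0 < m.+1%:R :> R by rewrite ltr0n.
  have iS : S^-1 <= ((1 + a) * m.+1%:R)^-1 by rewrite lef_pV2 ?posrE// mulr_gt0.
  apply: lerD.
    rewrite ler_wpM2r ?sqr_ge0// -mulrA -invfM ler_wpM2l// ltW//.
  apply: (le_trans (ler_wpM2l _ iS)); first by rewrite mulr_ge0.
  by rewrite invfM mulrCA !mulrA mulfK ?gt_eqF// mulrC.
rewrite (ExD tp) (ExD tp) (ExZ tp) (Ex_cst tp); apply: lerD => //.
rewrite /C' -[leRHS]addrA lerD2r -mulrA; apply: ler_wpM2l.
  by rewrite divr_ge0 ?ltW.
rewrite ler_pdivrMl ?ltr0n// mulrC; exact: IH.
Qed.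

(** The constant of [exceed_lln] depends on [k]; here uniformity in [m] and [k] is the point. For
    [r] slightly below [2 + a], a multiple of [m.+1 * vprod a r k] is a supersolution of the
    recursion of the means. *)
Lemma exceed_mean_tail : exists C rho', [/\ 0 <= C, 1 < rho' &
  forall m k, Ex p m (exceed R m k) <= C * m.+1%:R * vprod a rho' k].
Proof.
have a10 : 0 < 1 + a by have := a1; lra.
(* [1 / n0 < 1 + a] makes [r > 1], and the total weight exceeds [r * m.+1] as soon as [m.+1 >= n0];
   earlier times are absorbed by [C]. *)
pose n0 := (Num.truncn (1 + a)^-1).+1.
have n0a : (1 + a)^-1 < n0%:R by exact: truncnS_gt.
have n00 : 0 < n0%:R :> R by rewrite ltr0n.
pose r := 2 + a - n0%:R^-1.
have r1 : 1 < r.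
  have : n0%:R^-1 < 1 + a by rewrite -[ltRHS]invrK ltf_pV2 ?posrE ?invr_gt0.
  by rewrite /r; lra.
have r0 : 0 < r by exact: lt_trans r1.
have v0 k := vprod_gt0 a1 r0 k.
exists (vprod a r n0)^-1, r; split => //; first by rewrite invr_ge0 ltW.
set C := (vprod a r n0)^-1.
have C1 : 1 <= C by rewrite invf_ge1// vprod_le1.
have C0 : 0 < C by exact: lt_le_trans C1.
move=> m k; elim: m k => [|m IH] k.
  apply: (@le_trans _ _ (Ex p 0 (fun=> (k == 0%N)%:R))).
    by apply: (Ex_le tp) => h _; rewrite exceed0.
  rewrite (Ex_cst tp) mulr1; case: k => [|k] /=; first by rewrite vprod0 mulr1.
  by rewrite mulr_ge0// ltW.
have bnd c k' m' : (forall h, valid m' h -> exceed R m' k' h <= c) ->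
    Ex p m' (exceed R m' k') <= c.
  by move=> le; rewrite -(Ex_cst tp m' c); exact: (Ex_le tp).
case: k => [|k].
  by apply: bnd => h vh; rewrite exceed_root vprod0 mulr1 ler_peMl.
have [mk|km] := ltnP m.+1 k.+1.
  by apply: bnd => h vh; rewrite exceed_big// !mulr_ge0// ltW.
have [mn|nm] := ltnP m.+1 n0.
  apply: bnd => h vh; apply: (@le_trans _ _ m.+2%:R).
    by have /andP[] := exceed_bounds R m.+1 k.+1 h.
  rewrite mulrAC ler_peMl// /C mulrC ler_pdivlMr// mul1r.
  by apply: vprod_nincr => //; exact: ltnW (leq_ltn_trans km mn).
set S := weight_sum a m; have S0 : 0 < S by exact: weight_sum_gt0.
have m0 : 0 < m.+1%:R :> R by rewrite ltr0n.
have Sr : r * m.+1%:R <= S.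
  rewrite /S weight_sumE /r /rho mulrBl lerD2l lerN2 ler_pdivlMl// mulr1 ler_nat.
  exact: nm.
have kk : 0 < k.+1%:R + a by exact: deg_weight_gt0.
have fS : k.+1%:R + a <= S.
  have : k.+1%:R <= m.+1%:R :> R by rewrite ler_nat.
  have : 0 <= (1 + a) * m%:R by rewrite mulr_ge0// ltW.
  by rewrite /S /weight_sum -[m.+1%:R]natr1; lra.
(* As [k <= m], [q <= 1]: the recursion is a convex combination, through which the inductive bounds
   pass. *)
pose q := (k.+1%:R + a) / S.
have q01 : 0 <= q <= 1.
  by apply/andP; split; [rewrite divr_ge0 ?ltW|rewrite ler_pdivrMr// mul1r].
apply: (@le_trans _ _ (Ex p m (fun h => (1 - q) * exceed R m k.+1 h + q * exceed R m k h))).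
  apply: (@Ex_le _ p tp m (step p m _)) => h vh.
  rewrite (_ : _ + _ = step p m (fun h => exceed R m k.+1 h + (chosen m h == k.+1)%:R) h).
    by apply: (step_le tp vh) => h' vh'; rewrite exceedS//= addr0.
  rewrite stepD step_adapted//; last exact: exceed_adapted.
  rewrite (@cmean_step R a m (fun d => (d == k.+1)%:R)).
  by rewrite cmean_exceed// -/S /q; field; rewrite gt_eqF.
rewrite (ExD tp) !(ExZ tp); case/andP: q01 => q0 q1.
apply: (@le_trans _ _ ((1 - q) * (C * m.+1%:R * vprod a r k.+1) + q * (C * m.+1%:R * vprod a r k))).
  by apply: lerD; rewrite ler_wpM2l// subr_ge0.
have -> : (1 - q) * (C * m.+1%:R * vprod a r k.+1) + q * (C * m.+1%:R * vprod a r k) =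
  C * (m.+1%:R * vprod a r k.+1 + m.+1%:R / S * ((k.+1%:R + a) * (vprod a r k - vprod a r k.+1))).
  by rewrite /q; field; rewrite gt_eqF.
rewrite vprod_rec// -[leRHS]mulrA; apply: ler_wpM2l; first exact: ltW.
rewrite -[m.+2%:R]natr1 [leRHS]mulrDl lerD2l mul1r.
rewrite mulrA ler_piMl ?(ltW (v0 _))// mulrAC ler_pdivrMr// mul1r mulrC.
exact: Sr.
Qed.

(** In mean, a sum over time of conditional means is a sum over degrees of final counts, to which
    [exceed_mean_tail] applies. *)
Lemma sum_cmean m phi :
  \sum_(s < m) Ex p s (cmean a s phi) = \sum_(1 <= k < m.+2) phi k * Ex p m (exceed R m k).
Proof.
transitivity (Ex p m (fun h => \sum_(1 <= k < m.+2) phi k * exceed R m k h)); last first.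
  by rewrite (Ex_sum tp); apply: eq_bigr => k _; rewrite (ExZ tp).
transitivity (Ex p m (fun h => \sum_(s < m) phi (chosen s h))); last first.
  by apply: (Ex_eq tp) => h vh; rewrite sum_choices_exceed.
rewrite (Ex_sum tp); apply: eq_bigr => s _.
rewrite (@Ex_leq _ p tp s.+1 m (fun h => phi (chosen s h))); last first.
- by move=> h h' hh; rewrite (chosen_adapted hh).
- exact: ltn_ord.
by apply: (Ex_eq tp) => h vh; rewrite -cmean_step.
Qed.

Lemma sum_cmean_tail e : 0 < e -> exists2 K, (0 < K)%N &
  forall m, \sum_(s < m) Ex p s (cmean a s (fun k => (K <= k)%N%:R * lw R k ^+ 2)) <= e * m.+1%:R.
Proof.
move=> e0; have [C [r [C0 r1 H]]] := exceed_mean_tail.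
have r0 : 0 < r by exact: lt_trans r1.
have sg0 : 0 < r - 1 by rewrite subr_gt0.
have sg2 : 0 < (r - 1) / 2 by rewrite divr_gt0.
have rE : 1 + (r - 1) <= r by rewrite addrC subrK.
have D k := @vprod_lw R a r a1 r0 (r - 1) (1 + a + r) k sg0 rE (lexx _).
set B := (1 + a + r) `^ _ * _ in D.
have [K K0 tail] := @powR_tail_small R _ (C * B) e sg2 e0.
exists K => // m; rewrite sum_cmean.
have m0 : 0 <= m.+1%:R :> R by [].
apply: (@le_trans _ _ (C * B * (\sum_(K <= k < m.+2) k.+1%:R `^ (- (1 + (r - 1) / 2))) * m.+1%:R)).
  have [Km|mK] := leqP K m.+2; last first.
    rewrite [X in _ <= _ * X * _]big_geq ?(ltnW mK)// mulr0 mul0r.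
    rewrite big_nat_cond big1// => k /andP[/andP[_ km] _].
    by rewrite leqNgt (ltn_trans km mK)/= !mul0r.
  rewrite (big_cat_nat (n := K))//= big_nat_cond big1 ?add0r; last first.
    by move=> k /andP[/andP[_ km] _]; rewrite leqNgt km !mul0r.
  rewrite mulr_sumr mulr_suml; apply: ler_sum_nat => k /andP[Kk _].
  rewrite Kk mul1r; apply: (le_trans (ler_wpM2l (sqr_ge0 _) (H m k))).
  have -> : lw R k ^+ 2 * (C * m.+1%:R * vprod a r k) = C * (vprod a r k * lw R k ^+ 2) * m.+1%:R by ring.
  by rewrite ler_wpM2r// -mulrA ler_wpM2l.
by rewrite ler_wpM2r.
Qed.

Lemma sum_cmean_bounded : exists2 C, 0 <= C &
  forall m, \sum_(s < m) Ex p s (cmean a s (fun k => lw R k ^+ 2)) <= C * m.+1%:R.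
Proof.
have [K K0 H] := sum_cmean_tail ltr01.
exists (lw R K ^+ 2 + 1) => [|m]; first by rewrite addr_ge0 ?sqr_ge0.
rewrite mulrDl; apply: (le_trans _ (lerD _ (H m))); last first.
  by apply: (@ler_wpM2l _ _ (sqr_ge0 _) m%:R); rewrite ler_nat.
have -> : lw R K ^+ 2 * m%:R = \sum_(s < m) lw R K ^+ 2.
  by rewrite sumr_const card_ord mulr_natr.
rewrite -big_split; apply: ler_sum => s _ /=.
rewrite -[X in _ <= X + _](Ex_cst tp s) -(ExD tp); apply: (Ex_le tp) => h vh.
rewrite -[X in _ <= X + _](cmean_cst a1 _ vh) -cmeanD; apply: cmean_le => // k /andP[k0 _].
have [Kk|kK] := leqP K k; first by rewrite mul1r lerDr sqr_ge0.
rewrite mul0r addr0 ler_pXn2r ?nnegrE ?(le_trans ler01 (lw_ge1 _ _))//.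
by rewrite /lw lerD2l ler_ln ?posrE ?ltr0n// ler_nat ltnS ltnW.
Qed.

End degree_lln.

(** * Sequences with vanishing averages *)

Section cesaro_null.
Variable R : realType.
Implicit Types (x y : nat -> R).

Definition cesaro_null x := forall e : R, 0 < e ->
  exists N, forall m, (N <= m)%N -> \sum_(s < m) x s <= e * m.+1%:R.

Lemma cesaro_null_le x y : (forall s, x s <= y s) -> cesaro_null y -> cesaro_null x.
Proof.
move=> xy y0 e /y0[N H]; exists N => m /H; apply: le_trans.
by apply: ler_sum => s _.
Qed.

Lemma cesaro_nullD x y : cesaro_null x -> cesaro_null y -> cesaro_null (fun s => x s + y s).
Proof.
move=> x0 y0 e e0; have e2 : 0 < e / 2 by rewrite divr_gt0.
have [N1 H1] := x0 _ e2; have [N2 H2] := y0 _ e2; exists (maxn N1 N2) => m.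
rewrite geq_max => /andP[/H1 h1 /H2 h2]; rewrite big_split/=.
by rewrite [e]splitr mulrDl lerD.
Qed.

Lemma cesaro_nullZ c x : 0 <= c -> cesaro_null x -> cesaro_null (fun s => c * x s).
Proof.
move=> c0 x0 e e0; have ec : 0 < e / (c + 1) by rewrite divr_gt0// ltr_wpDl.
have [N H] := x0 _ ec; exists N => m /H le; rewrite -mulr_sumr.
apply: (le_trans (ler_wpM2l c0 le)); rewrite mulrA ler_wpM2r//.
rewrite mulrCA ger_pMr// ler_pdivrMr ?ltr_wpDl// mul1r lerDl//.
Qed.

Lemma cesaro_null_sum (I : Type) (r : seq I) (P : pred I) (F : I -> nat -> R) :
  (forall i, P i -> cesaro_null (F i)) -> cesaro_null (fun s => \sum_(i <- r | P i) F i s).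
Proof.
move=> F0; elim: r => [|i r IH].
  move=> e e0; exists 0%N => m _; rewrite big1 => [|s _]; last by rewrite big_nil.
  by rewrite mulr_ge0// ltW.
case Pi : (P i).
  by apply: cesaro_null_le (cesaro_nullD (F0 _ Pi) IH) => s; rewrite big_cons Pi.
by apply: cesaro_null_le IH => s; rewrite big_cons Pi.
Qed.

Lemma cesaro_null_cvg x : (forall s, 0 <= x s) -> x @ \oo --> (0 : R) -> cesaro_null x.
Proof.
move=> x0 /cesaro /cvgrPdist_le cv e /cv[N _ H]; exists N => m /H.
rewrite /arithmetic_mean/= sub0r normrN => le.
have := le_trans (ler_norm _) le; rewrite ler_pdivrMl ?ltr0n// mulrC => {}le.
apply: (le_trans _ le); rewrite seriesEord/= big_ord_recr/= lerDl; exact: x0.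
Qed.

Lemma cesaro_null_sqrt x c : (forall s, 0 <= x s <= c / Num.sqrt s.+1%:R) -> cesaro_null x.
Proof.
move=> xc; apply: cesaro_null_cvg => [s|]; first by have /andP[] := xc s.
apply/cvgrPdist_le => e e0; exists (Num.truncn ((c / e) ^+ 2)) => // s /= cs.
have /andP[x0 xs] := xc s; rewrite sub0r normrN ger0_norm//; apply: (le_trans xs).
have q0 : 0 < Num.sqrt s.+1%:R :> R by rewrite sqrtr_gt0 ltr0n.
rewrite ler_pdivrMr// -ler_pdivrMl//; rewrite mulrC.
apply: (le_trans (ler_norm _)); rewrite -sqrtr_sqr ler_sqrt//.
by rewrite (le_trans (ltW (truncnS_gt _)))// ler_nat.
Qed.

(* The terms of [x] split into a Cesaro-null main part and a uniformly small rest. *)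
Lemma cesaro_null_approx x :
  (forall e : R, 0 < e -> exists y z, [/\ forall s, x s <= y s + z s, cesaro_null y &
     forall m, \sum_(s < m) z s <= e * m.+1%:R]) -> cesaro_null x.
Proof.
move=> H e e0; have e2 : 0 < e / 2 by rewrite divr_gt0.
have [y [z [xyz y0 z0]]] := H _ e2; have [N HN] := y0 _ e2; exists N => m /HN le.
apply: (@le_trans _ _ (\sum_(s < m) (y s + z s))); first by apply: ler_sum => s _.
rewrite big_split/= [e]splitr mulrDl; apply: lerD => //; exact: z0.
Qed.

End cesaro_null.

(** * Averages of conditional means and variances, and the martingales *)

Section averages.
Variables (R : realType) (a : R).
Hypothesis a1 : -1 < a.
Implicit Types (h : nat -> nat) (phi psi : nat -> R) (m s k : nat).

Let p := pa_kernel a.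
Let tp : transition p := pa_transition a1.
Let u := ulim a.

(** For [k > 0], [ulim a k] is also the limiting probability that a node of degree [k] is chosen: by
    [vprod_rec], [(k + a) (u_(k-1) - u_k) / (2 + a) = u_k]. Hence this is the limit of the
    conditional means of [phi]. *)
Definition qmean phi : R := pos_series (fun k => ulim a k * phi k).

Definition qvar phi : R := qmean (fun k => phi k ^+ 2) - qmean phi ^+ 2.

Definition cvar m phi h : R := cmean a m (fun k => phi k ^+ 2) h - cmean a m phi h ^+ 2.

Let sg := (1 + a) / 2.
Let sg0 : 0 < sg. Proof. by rewrite divr_gt0//; have := a1; lra. Qed.

Lemma ulim_lw : exists2 B, 0 <= B &
  forall k, u k * lw R k ^+ 2 <= B * k.+1%:R `^ (- (1 + (1 + a) / 2)).
Proof.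
have a10 : 0 < 1 + a by have := a1; lra.
have r0 : 0 < 2 + a by have := a1; lra.
have rE : 1 + (1 + a) <= 2 + a by lra.
have D k := @vprod_lw R a (2 + a) a1 r0 (1 + a) (1 + a + (2 + a)) k a10 rE (lexx _).
by eexists; last exact: D; rewrite mulr_ge0 ?powR_ge0 ?sqr_ge0.
Qed.

Lemma ulim_dominated psi C : (forall k, (0 < k)%N -> `|psi k| <= C * lw R k ^+ 2) ->
  exists B, forall k, (0 < k)%N -> `|u k * psi k| <= B * k.+1%:R `^ (- (1 + (1 + a) / 2)).
Proof.
move=> psiC; have [B B0 H] := ulim_lw; exists (C * B) => k k0.
have /andP[u0 _] := ulim_bounds a1 k.
have C0 : 0 <= C.
  have := le_trans (normr_ge0 _) (psiC k k0); rewrite pmulr_lge0// exprn_gt0//.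
  exact: lt_le_trans (lw_ge1 _ _).
rewrite normrM ger0_norm// -mulrA; apply: (le_trans (ler_wpM2l u0 (psiC k k0))).
by rewrite mulrCA ler_wpM2l.
Qed.

Lemma lw_le_sqr k : lw R k <= lw R k ^+ 2.
Proof. by rewrite expr2 ler_peMr ?lw_ge1// (le_trans ler01 (lw_ge1 _ _)). Qed.

Lemma lw_bounded_sqr phi C : (forall k, (0 < k)%N -> `|phi k| <= C * lw R k) ->
  (forall k, (0 < k)%N -> `|phi k| <= C * lw R k ^+ 2) /\
  (forall k, (0 < k)%N -> `|phi k ^+ 2| <= C ^+ 2 * lw R k ^+ 2).
Proof.
move=> phiC; split => k k0; last first.
  rewrite normrX -exprMn ler_pXn2r ?nnegrE ?phiC//.
  exact: le_trans (phiC k k0).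
apply: (le_trans (phiC k k0)); rewrite ler_wpM2l ?lw_le_sqr//.
have := le_trans (normr_ge0 _) (phiC k k0).
by rewrite pmulr_lge0//; exact: lt_le_trans (lw_ge1 _ _).
Qed.

Lemma cmean_sqr m phi h : valid m h -> cmean a m phi h ^+ 2 <= cmean a m (fun k => phi k ^+ 2) h.
Proof.
move=> vh; set c := cmean a m phi h.
have : 0 <= cmean a m (fun k => (phi k - c) ^+ 2) h.
  by rewrite -(cmean_cst a1 0 vh); apply: (cmean_le a1) => k _; exact: sqr_ge0.
rewrite (@cmean_eq _ a a1 m _ (fun k => phi k ^+ 2 + ((- c *+ 2) * phi k + c ^+ 2))); last first.
  by move=> k _; ring.
by rewrite !cmeanD cmeanZ (cmean_cst a1 _ vh) -/c; lra.
Qed.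

Lemma cvar_ge0 m phi h : valid m h -> 0 <= cvar m phi h.
Proof. by move=> vh; rewrite subr_ge0 cmean_sqr. Qed.

Lemma cmean_norm m phi h : `|cmean a m phi h| <= cmean a m (fun k => `|phi k|) h.
Proof.
rewrite ler_norml -mulN1r -cmeanZ; apply/andP; split; apply: (cmean_le a1) => k _.
  by rewrite mulN1r lerNl -normrN ler_norm.
exact: ler_norm.
Qed.

(** Only the counts above [k - 1] and above [k] enter, so the L2 law of large numbers gives an error
    of order [1 / sqrt s]. *)
Lemma cmean_point k : (0 < k)%N ->
  cesaro_null (fun s => Ex p s (fun h => `|cmean a s (fun d => (d == k)%:R) h - u k|)).
Proof.
case: k => // k _.
have [C1 C10 H1] := exceed_lln a1 k; have [C2 C20 H2] := exceed_lln a1 k.+1.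
have a10 : 0 < 1 + a by have := a1; lra.
have kk : 0 < k.+1%:R + a by exact: deg_weight_gt0.
have /andP[u0 u1] := ulim_bounds a1 k.+1.
have r0 : 0 < 2 + a by have := a1; lra.
pose c := ((k.+1%:R + a) * (Num.sqrt C1 + Num.sqrt C2) + 1) / (1 + a).
apply: (@cesaro_null_sqrt _ _ c) => s; rewrite (Ex_ge0 tp)//=.
set n := s.+1%:R : R; have n1 : 1 <= n by rewrite ler1n.
have n0 : 0 < n by exact: lt_le_trans n1.
set S := weight_sum a s; have S0 : 0 < S by exact: weight_sum_gt0.
have SE : S = (2 + a) * n - 1 by exact: weight_sumE.
pose X k h := exceed R s k h - n * ulim a k.
apply: (@le_trans _ _ (Ex p s (fun h => (k.+1%:R + a) / S * (`|X k h| + `|X k.+1 h|) + S^-1))).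
  apply: (Ex_le tp) => h vh; rewrite cmean_exceed//.
  have urec : (k.+1%:R + a) * (ulim a k - ulim a k.+1) = (2 + a) * ulim a k.+1.
    exact: (vprod_rec a1 r0 k).
  have -> : (k.+1%:R + a) * (exceed R s k h - exceed R s k.+1 h) / weight_sum a s - u k.+1 =
    (k.+1%:R + a) / S * (X k h - X k.+1 h) + u k.+1 / S.
    have -> : X k h - X k.+1 h = exceed R s k h - exceed R s k.+1 h - n * (ulim a k - ulim a k.+1).
      by rewrite /X; ring.
    have E : n * ((2 + a) * ulim a k.+1) = (S + 1) * ulim a k.+1 by rewrite SE; ring.
    transitivity (((k.+1%:R + a) * (exceed R s k h - exceed R s k.+1 h) -
      n * ((k.+1%:R + a) * (ulim a k - ulim a k.+1)) + ulim a k.+1) / S).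
      by rewrite urec E -/S /u; field; rewrite gt_eqF.
    by rewrite /u; field; rewrite gt_eqF.
  rewrite (le_trans (ler_normD _ _))// !normrM [`|S^-1|]ger0_norm ?invr_ge0 ?(ltW S0)//.
  rewrite (ger0_norm (ltW kk)) (ger0_norm u0); apply: lerD.
    by apply: ler_wpM2l; [rewrite divr_ge0 ?ltW|exact: ler_normB].
  by rewrite ler_piMl// invr_ge0 ltW.
rewrite (ExD tp) (ExZ tp) (ExD tp) (Ex_cst tp).
have E1 := Ex_abs_sqrt tp (H1 s); have E2 := Ex_abs_sqrt tp (H2 s).
rewrite -/n !sqrtrM// in E1 E2.
set q := Num.sqrt n in E1 E2 *; have q0 : 0 < q by rewrite sqrtr_gt0.
have q1 : 1 <= q by rewrite -[leLHS]sqrtr1 ler_sqrt.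
have qq : q ^+ 2 = n by rewrite sqr_sqrtr// ltW.
apply: (@le_trans _ _ (((k.+1%:R + a) * (Num.sqrt C1 + Num.sqrt C2) + 1) * q / S)).
  rewrite mulrAC -[X in _ + X]mul1r -mulrDl; apply: ler_wpM2r; first by rewrite invr_ge0 ltW.
  rewrite [leRHS]mulrDl mul1r; apply: lerD => //; rewrite -mulrA; apply: ler_wpM2l; first exact: ltW.
  by rewrite [leRHS]mulrDl; apply: lerD.
rewrite /c -!mulrA; apply: ler_wpM2l.
  by rewrite addr_ge0// mulr_ge0 ?(ltW kk)// addr_ge0.
rewrite ler_pdivrMr// -invfM mulrC ler_pdivlMr ?mulr_gt0//.
rewrite mulrCA -expr2 qq; exact: weight_sum_ge.
Qed.

(** Truncation at a degree [K]: below it finitely many point masses converge, and above it both the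
    conditional means, on average over time, and the limit series are small against [lw^2]. *)
Lemma cmean_avg psi C : (forall k, (0 < k)%N -> `|psi k| <= C * lw R k ^+ 2) ->
  cesaro_null (fun s => Ex p s (fun h => `|cmean a s psi h - qmean psi|)).
Proof.
move=> psiC; have [B HB] := ulim_dominated psiC.
pose C' := `|C| + 1; have C'0 : 0 < C' by rewrite ltr_wpDl.
have psiC' k : (0 < k)%N -> `|psi k| <= C' * lw R k ^+ 2.
  move=> /psiC le; apply: (le_trans le); apply: ler_wpM2r; first exact: sqr_ge0.
  by have := ler_norm C; rewrite /C'; lra.
apply: cesaro_null_approx => e e0; have e2 : 0 < e / 2 by rewrite divr_gt0.
have eC : 0 < e / 2 / C' by rewrite divr_gt0.
have [K1 K10 T1] := sum_cmean_tail a1 eC.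
have [K2 K20 T2] := powR_tail_small B sg0 e2.
pose K := maxn K1 K2.
have K0 : (0 < K)%N by rewrite leq_max K10.
exists (fun s => \sum_(1 <= k < K) `|psi k| * Ex p s (fun h => `|cmean a s (fun d => (d == k)%:R) h - u k|)).
exists (fun s => C' * Ex p s (cmean a s (fun k => (K1 <= k)%N%:R * lw R k ^+ 2)) + e / 2).
split.
- move=> s; rewrite -(ExZ tp) -[X in _ <= _ + (_ + X)](Ex_cst tp s) -(ExD tp).
  have -> : \sum_(1 <= k < K) `|psi k| * Ex p s (fun h => `|cmean a s (fun d => (d == k)%:R) h - u k|)
    = Ex p s (fun h => \sum_(1 <= k < K) `|psi k| * `|cmean a s (fun d => (d == k)%:R) h - u k|).
    by rewrite (Ex_sum tp); apply: eq_bigr => k _; rewrite (ExZ tp).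
  rewrite -(ExD tp); apply: (Ex_le tp) => h vh.
  have T2' := @pos_series_tail _ _ _ _ sg0 HB K (e / 2) K0.
  have {}T2' : `|qmean psi - \sum_(1 <= k < K) u k * psi k| <= e / 2.
    apply: T2' => n; apply: le_trans (T2 n).
    have B0 := dominated_ge0 HB.
    apply: ler_wpM2l => //; have [K2n|nK] := leqP K n; last first.
      by rewrite big_geq ?(ltnW nK)// sumr_ge0// => k _; exact: powR_ge0.
    rewrite [leRHS](big_cat_nat (n := K))//= ?leq_maxr// lerDr.
    by apply: sumr_ge0 => k _; exact: powR_ge0.
  have -> : cmean a s psi h - qmean psi = \sum_(1 <= k < K) psi k * (cmean a s (fun d => (d == k)%:R) h - u k)
     + (cmean a s (fun k => (K <= k)%N%:R * psi k) h - (qmean psi - \sum_(1 <= k < K) u k * psi k)).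
    have -> : cmean a s psi h = \sum_(1 <= k < K) psi k * cmean a s (fun d => (d == k)%:R) h +
       cmean a s (fun k => (K <= k)%N%:R * psi k) h.
      under eq_bigr do rewrite -cmeanZ.
      rewrite -cmean_sum -cmeanD; apply: (cmean_eq a1) => d /andP[d0 _].
      have [Kd|dK] := leqP K d.
        rewrite mul1r big_nat_cond big1 ?add0r// => k /andP[/andP[_ kK] _].
        by rewrite gtn_eqF ?mulr0// (leq_trans kK Kd).
      rewrite mul0r addr0 (bigD1_seq d) ?iota_uniq ?mem_index_iota ?d0//= eqxx mulr1.
      by rewrite big1 ?addr0// => k /negbTE; rewrite eq_sym => ->; rewrite mulr0.
    under [X in _ = X + _]eq_bigr do rewrite mulrBr.
    rewrite sumrB; under [X in _ = _ - X + _]eq_bigr do rewrite mulrC.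
    by ring.
  apply: (le_trans (ler_normD _ _)); apply: lerD.
    by rewrite (le_trans (ler_norm_sum _ _ _))//; apply: ler_sum => k _; rewrite normrM.
  apply: (le_trans (ler_normB _ _)); apply: lerD => //.
  apply: (le_trans (cmean_norm _ _ _)); rewrite -cmeanZ; apply: (cmean_le a1) => k /andP[k0 _].
  rewrite normrM normr_nat mulrCA.
  have [Kk|kK] := leqP K k; last first.
    by rewrite mul0r; apply: mulr_ge0 => //; apply: mulr_ge0; [exact: ltW|exact: sqr_ge0].
  by rewrite (leq_trans (leq_maxl _ _) Kk) !mul1r psiC'.
- have N := @cesaro_null_sum _ _ (index_iota 1 K) (fun k => (1 <= k < K)%N && true)
    (fun k s => `|psi k| * Ex p s (fun h => `|cmean a s (fun d => (d == k)%:R) h - u k|)).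
  apply: cesaro_null_le (N _) => [s|k /andP[/andP[k0 _] _]]; first by rewrite -big_nat_cond.
  by apply: cesaro_nullZ => //; exact: cmean_point.
- move=> m; rewrite big_split/= -mulr_sumr sumr_const card_ord.
  have -> : e * m.+1%:R = e / 2 * m.+1%:R + e / 2 * m.+1%:R by field.
  apply: lerD.
    rewrite -ler_pdivlMl//; apply: (le_trans (T1 m)); rewrite mulrA ler_wpM2r// mulrC //.
  by rewrite -[leLHS]mulr_natr ler_wpM2l ?(ltW e2)// ler_nat.
Qed.


(** The same truncation. The part below [K] has a bounded deviation, whose square is at most a
    constant times its absolute value; the part above is handled by Jensen's inequality. *)
Lemma cmean_sqr_avg phi C : (forall k, (0 < k)%N -> `|phi k| <= C * lw R k) ->
  cesaro_null (fun s => Ex p s (fun h => (cmean a s phi h - qmean phi) ^+ 2)).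
Proof.
move=> phiC; have [phiC1 phiC2] := lw_bounded_sqr phiC.
have [B HB] := ulim_dominated phiC1.
have C0 : 0 <= C.
  have := le_trans (normr_ge0 _) (phiC 1%N (ltn0Sn 0)); rewrite pmulr_lge0//.
  exact: lt_le_trans (lw_ge1 _ _).
apply: cesaro_null_approx => e e0.
pose e' := Num.min (e / 6) 1; have e'0 : 0 < e' by rewrite lt_min ltr01 divr_gt0.
have e'e : e' <= e / 6 by rewrite ge_min lexx.
have e'1 : e' <= 1 by rewrite ge_min lexx orbT.
have eC : 0 < e' / (C ^+ 2 + 1) by rewrite divr_gt0// ltr_wpDl// sqr_ge0.
have [K1 K10 T1] := sum_cmean_tail a1 eC.
have [K2 K20 T2] := powR_tail_small B sg0 e'0.
pose K := maxn K1 K2; have K0 : (0 < K)%N by rewrite leq_max K10.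
pose phi1 k := (k < K)%N%:R * phi k; pose phi2 k := (K <= k)%N%:R * phi k.
have phi12 k : phi k = phi1 k + phi2 k.
  by rewrite /phi1 /phi2 ltnNge; case: (K <= k)%N; rewrite /= ?mul0r ?mul1r ?addr0 ?add0r.
have phi1C k : (0 < k)%N -> `|phi1 k| <= C * lw R k ^+ 2.
  move=> k0; rewrite /phi1 normrM normr_nat; apply: le_trans (phiC1 k k0).
  by rewrite ler_piMl// lern1 leq_b1.
have phi2C k : (0 < k)%N -> `|phi2 k| <= C * lw R k ^+ 2.
  move=> k0; rewrite /phi2 normrM normr_nat; apply: le_trans (phiC1 k k0).
  by rewrite ler_piMl// lern1 leq_b1.
have [B1 HB1] := ulim_dominated phi1C; have [B2 HB2] := ulim_dominated phi2C.
have q12 : qmean phi = qmean phi1 + qmean phi2.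
  have := pos_series_lin 1 1 sg0 HB1 HB2; rewrite !mul1r -/(qmean phi1) -/(qmean phi2) => <-.
  by apply: eq_pos_series => k _; rewrite !mul1r phi12 mulrDr.
have q2 : `|qmean phi2| <= e'.
  have HB2' k : (0 < k)%N -> `|u k * phi2 k| <= B * k.+1%:R `^ (- (1 + (1 + a) / 2)).
    move=> k0; apply: le_trans (HB k k0); rewrite /phi2 mulrCA normrM normr_nat.
    by rewrite ler_piMl// lern1 leq_b1.
  have B0 := dominated_ge0 HB.
  have := @pos_series_tail _ _ _ _ sg0 HB2' K e' K0.
  rewrite big_nat_cond big1 ?subr0; last first.
    by move=> k /andP[/andP[_ kK] _]; rewrite /phi2 leqNgt kK mul0r mulr0.
  apply=> n; apply: le_trans (T2 n); apply: ler_wpM2l => //.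
  have [K2n|nK] := leqP K n; last first.
    by rewrite big_geq ?(ltnW nK)// sumr_ge0// => k _; exact: powR_ge0.
  rewrite [leRHS](big_cat_nat (n := K))//= ?leq_maxr// lerDr.
  by apply: sumr_ge0 => k _; exact: powR_ge0.
pose b := C * lw R K + `|qmean phi1|.
have b0 : 0 <= b by rewrite addr_ge0// mulr_ge0// (le_trans ler01 (lw_ge1 _ _)).
exists (fun s => (3 * b) * Ex p s (fun h => `|cmean a s phi1 h - qmean phi1|)).
exists (fun s => 3 * C ^+ 2 * Ex p s (cmean a s (fun k => (K1 <= k)%N%:R * lw R k ^+ 2)) + 3 * e').
split.
- move=> s; rewrite -!(ExZ tp) -[X in _ <= _ + (_ + X)](Ex_cst tp s) -!(ExD tp).
  apply: (Ex_le tp) => h vh.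
  have -> : cmean a s phi h - qmean phi = (cmean a s phi1 h - qmean phi1) + cmean a s phi2 h - qmean phi2.
    have E : cmean a s phi h = cmean a s phi1 h + cmean a s phi2 h.
      by rewrite -cmeanD; exact: (cmean_eq a1).
    by rewrite q12 E; ring.
  set x := cmean a s phi1 h - _; set y := cmean a s phi2 h; set z := qmean phi2 in q2 *.
  have xyz : (x + y - z) ^+ 2 <= 3 * (x ^+ 2 + y ^+ 2 + z ^+ 2).
    have : 0 <= (x - y) ^+ 2 by exact: sqr_ge0.
    have : 0 <= (x + z) ^+ 2 by exact: sqr_ge0.
    have : 0 <= (y + z) ^+ 2 by exact: sqr_ge0.
    by lra.
  apply: (le_trans xyz); set w := cmean a s _ h.
  have -> : 3 * b * `|x| + (3 * C ^+ 2 * w + 3 * e') = 3 * (b * `|x| + (C ^+ 2 * w + e')).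
    by ring.
  apply: ler_wpM2l => //; rewrite -addrA; apply: lerD.
    rewrite -(real_normK (num_real x)) expr2; apply: ler_wpM2r => //.
    apply: (le_trans (ler_normB _ _)); rewrite lerD2r.
    apply: (le_trans (cmean_norm _ _ _)).
    rewrite -(cmean_cst a1 (C * lw R K) vh); apply: (cmean_le a1) => k /andP[k0 _].
    rewrite /phi1 normrM normr_nat; case: ltnP => kK; last first.
      by rewrite mul0r mulr_ge0// (le_trans ler01 (lw_ge1 _ _)).
    rewrite mul1r; apply: (le_trans (phiC k k0)); apply: ler_wpM2l => //.
    by rewrite /lw lerD2l ler_ln ?posrE ?ltr0n// ler_nat ltnS ltnW.
  apply: lerD; last first.
    rewrite -(real_normK (num_real z)) expr2; apply: (@le_trans _ _ (e' * 1)); last by rewrite mulr1.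
    by apply: ler_pM => //; exact: le_trans q2 e'1.
  apply: (le_trans (cmean_sqr _ vh)); rewrite -cmeanZ; apply: (cmean_le a1) => k /andP[k0 _].
  rewrite /phi2 exprMn; have [Kk|kK] := leqP K k; last first.
    by rewrite expr0n mul0r; apply: mulr_ge0; rewrite ?sqr_ge0// mulr_ge0// sqr_ge0.
  rewrite (leq_trans (leq_maxl _ _) Kk) !mul1r expr1n mul1r.
  by have := phiC2 k k0; rewrite ger0_norm ?sqr_ge0.
- apply: cesaro_nullZ; first by rewrite mulr_ge0.
  exact: (cmean_avg phi1C).
- move=> m; rewrite big_split/= -mulr_sumr sumr_const card_ord.
  have T1m := T1 m.
  have m0 : 0 <= m%:R :> R by [].
  have m1 : m.+1%:R = m%:R + 1 :> R by rewrite natr1.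
  apply: (@le_trans _ _ (3 * (e' * m.+1%:R) + 3 * e' * m%:R)).
    apply: lerD; last by rewrite mulr_natr.
    rewrite -mulrA ler_wpM2l//; apply: (le_trans (ler_wpM2l (sqr_ge0 C) T1m)).
    rewrite mulrA ler_wpM2r// mulrA ler_pdivrMr ?ltr_wpDl ?sqr_ge0//.
    by rewrite mulrC ler_wpM2l ?(ltW e'0)// lerDl.
  rewrite m1; have : e' * (m%:R + 1) <= e / 6 * (m%:R + 1) by rewrite ler_wpM2r// addr_ge0.
  by lra.
Qed.

Lemma cvar_avg phi C : (forall k, (0 < k)%N -> `|phi k| <= C * lw R k) ->
  cesaro_null (fun s => Ex p s (fun h => `|cvar s phi h - qvar phi|)).
Proof.
move=> phiC; have [phiC1 phiC2] := lw_bounded_sqr phiC.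
have A1 := cmean_avg phiC1; have A2 := cmean_avg phiC2; have A3 := cmean_sqr_avg phiC.
have c0 : 0 <= 2 * `|qmean phi| by rewrite mulr_ge0.
apply: cesaro_null_le (cesaro_nullD A2 (cesaro_nullD A3 (cesaro_nullZ c0 A1))) => s.
rewrite -(ExZ tp) -!(ExD tp); apply: (Ex_le tp) => h vh.
rewrite /cvar /qvar; set x := cmean a s _ h; set y := qmean _; set c := cmean a s phi h.
set q := qmean phi.
have -> : x - c ^+ 2 - (y - q ^+ 2) = (x - y) - ((c - q) ^+ 2 + 2 * q * (c - q)) by ring.
apply: (le_trans (ler_normB _ _)); rewrite lerD2l; apply: (le_trans (ler_normD _ _)).
by rewrite (ger0_norm (sqr_ge0 _)) lerD2l normrM [`|2 * q|]normrM normr_nat.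
Qed.

Definition mart m phi h : R := \sum_(s < m) (phi (chosen s h) - cmean a s phi h).

Lemma mart_step s phi h : valid s h ->
  step p s (fun h => phi (chosen s h) - cmean a s phi h) h = 0.
Proof.
move=> vh; rewrite stepD (@cmean_step R a s phi).
rewrite (_ : step p s _ h = - cmean a s phi h) ?subrr//.
by apply: (step_adapted tp vh) => h1 h2 hh; congr (- _); exact: cmean_adapted.
Qed.

Lemma mart_step_sqr s phi h : valid s h ->
  step p s (fun h => (phi (chosen s h) - cmean a s phi h) ^+ 2) h = cvar s phi h.
Proof.
move=> vh.
have ac : adapted s (cmean a s phi) by exact: cmean_adapted.
transitivity (step p s (fun h => (phi (chosen s h)) ^+ 2 +
   ((- 2 * cmean a s phi h) * phi (chosen s h) + cmean a s phi h ^+ 2)) h).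
  by apply: eq_bigr => i _; congr (_ * _); ring.
rewrite !stepD (@cmean_step R a s (fun d => phi d ^+ 2)).
rewrite (@step_adaptedM _ p s (fun h => - 2 * cmean a s phi h)); last first.
  by move=> h1 h2 hh; rewrite (ac _ _ hh).
rewrite (@cmean_step R a s phi) step_adapted//; last by move=> h1 h2 hh; rewrite (ac _ _ hh).
by rewrite /cvar; ring.
Qed.

Lemma mart_adapted s phi : adapted s.+1 (fun h => phi (chosen s h) - cmean a s phi h).
Proof.
move=> h1 h2 hh; rewrite (chosen_adapted hh) (@cmean_adapted _ a s phi h1 h2)//.
by move=> t /andP[t0 ts]; apply: hh; rewrite t0 ltnW.
Qed.

Lemma mart_sqr m phi :
  Ex p m (fun h => mart m phi h ^+ 2) = \sum_(s < m) Ex p s (cvar s phi).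
Proof.
apply: (@martingale_sqr R p tp m (fun s h => phi (chosen s h) - cmean a s phi h)
  (fun s => cvar s phi)) => [s|s h _|s h _]; first exact: mart_adapted.
  exact: mart_step.
exact: mart_step_sqr.
Qed.

Lemma mart_sqr_le phi C : (forall k, (0 < k)%N -> `|phi k| <= C * lw R k) ->
  exists2 B, 0 <= B & forall m, Ex p m (fun h => mart m phi h ^+ 2) <= B * m.+1%:R.
Proof.
move=> phiC; have [_ phiC2] := lw_bounded_sqr phiC.
have [B B0 HB] := sum_cmean_bounded a1; exists (C ^+ 2 * B) => [|m].
  by rewrite mulr_ge0 ?sqr_ge0.
rewrite mart_sqr -mulrA; apply: le_trans (ler_wpM2l (sqr_ge0 C) (HB m)).
rewrite mulr_sumr; apply: ler_sum => s _; rewrite -(ExZ tp); apply: (Ex_le tp) => h vh.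
rewrite /cvar -cmeanZ; apply: (@le_trans _ _ (cmean a s (fun k => phi k ^+ 2) h)).
  by rewrite gerBl sqr_ge0.
by apply: (cmean_le a1) => k /andP[k0 _]; apply: le_trans (phiC2 k k0); exact: ler_norm.
Qed.

(** [mart] is linear in [phi], so the martingales of the single degrees control it for all bounded
    [phi] at once, in particular for the remainder at an estimator that depends on the history. *)
Definition count_mart m h : R :=
  \sum_(1 <= k < m.+2) `|mart m (fun d => (d == k)%:R) h|.

Lemma mart_count_le m phi b h : (forall k, (0 < k <= m.+1)%N -> `|phi k| <= b) ->
  `|mart m phi h| <= b * count_mart m h.
Proof.
move=> phib.
have -> : mart m phi h = \sum_(1 <= k < m.+2) phi k * mart m (fun d => (d == k)%:R) h.
  under [RHS]eq_bigr do rewrite /mart mulr_sumr.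
  rewrite exchange_big/=; apply: eq_bigr => s _.
  under [RHS]eq_bigr do rewrite mulrBr -cmeanZ.
  have pick d : (0 < d <= m.+1)%N -> \sum_(1 <= k < m.+2) phi k * (d == k)%:R = phi d.
    move=> /andP[d0 dm]; rewrite (bigD1_seq d) ?iota_uniq ?mem_index_iota ?d0//= eqxx mulr1.
    by rewrite big1 ?addr0// => k /negbTE; rewrite eq_sym => ->; rewrite mulr0.
  rewrite sumrB; congr (_ - _).
    by rewrite pick// /chosen dg_gt0 (leq_trans (dg_le _ _ _))// ltnS ltnW.
  rewrite -cmean_sum; apply: (cmean_eq a1) => d /andP[d0 ds]; rewrite pick// d0.
  by rewrite (leq_trans ds)// ltnS ltnW.
rewrite (le_trans (ler_norm_sum _ _ _))// mulr_sumr; apply: ler_sum_nat => k kM.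
by rewrite normrM ler_wpM2r// phib.
Qed.

(** The degrees below some [K] contribute [O(sqrt m)] each, by orthogonality. The others contribute
    in mean at most twice the expected number of choices of degrees at least [K], a small proportion
    of [m]. *)
Lemma count_mart_avg e : 0 < e -> exists N, forall m, (N <= m)%N ->
  Ex p m (count_mart m) <= e * m.+1%:R.
Proof.
move=> e0; have e4 : 0 < e / 4 by rewrite divr_gt0.
have [K K0 T] := sum_cmean_tail a1 e4.
exists (Num.truncn ((2 * K%:R / e) ^+ 2)) => m Nm.
have fin k : Ex p m (fun h => `|mart m (fun d => (d == k)%:R) h|) <= Num.sqrt m.+1%:R.
  apply: (Ex_abs_sqrt tp); rewrite mart_sqr.
  apply: (@le_trans _ _ (\sum_(s < m) 1)); last by rewrite sumr_const card_ord ler_nat.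
  apply: ler_sum => s _; rewrite -[leRHS](Ex_cst tp s); apply: (Ex_le tp) => h vh.
  rewrite -[leRHS](cmean_cst a1 1 vh) /cvar.
  apply: (@le_trans _ _ (cmean a s (fun d => (d == k)%:R ^+ 2) h)); first by rewrite gerBl sqr_ge0.
  by apply: (cmean_le a1) => d _; rewrite -natrX lern1; case: eqP.
have tl k : Ex p m (fun h => `|mart m (fun d => (d == k)%:R) h|) <=
    2 * \sum_(s < m) Ex p s (cmean a s (fun d => (d == k)%:R)).
  apply: (@le_trans _ _ (Ex p m (fun h => \sum_(s < m) ((chosen s h == k)%:R + cmean a s (fun d => (d == k)%:R) h)))).
    apply: (Ex_le tp) => h vh; rewrite (le_trans (ler_norm_sum _ _ _))//; apply: ler_sum => s _.
    apply: (le_trans (ler_normB _ _)); rewrite normr_nat lerD2l ger0_norm//.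
    rewrite -(cmean_cst a1 0 (valid_leq (ltnW (ltn_ord s)) vh)); apply: (cmean_le a1) => d _.
    exact: ler0n.
  rewrite (Ex_sum tp) mulr_sumr; apply: ler_sum => s _; rewrite (ExD tp) mulr_natl mulr2n.
  rewrite (@Ex_leq _ p tp s.+1 m (fun h => (chosen s h == k)%:R)); last first.
  - by move=> h1 h2 hh; rewrite (chosen_adapted hh).
  - exact: ltn_ord.
  apply: lerD; last first.
    rewrite (@Ex_leq _ p tp s m)//; first exact/ltnW/ltn_ord.
    by move=> h1 h2 hh; exact: cmean_adapted.
  by apply: (@Ex_le _ p tp s (step p s _)) => h vh; rewrite (@cmean_step R a s (fun d => (d == k)%:R)).
rewrite (Ex_sum tp).
apply: (@le_trans _ _ (K%:R * Num.sqrt m.+1%:R + 2 * \sum_(s < m) Ex p s (cmean a s (fun k => (K <= k)%N%:R * lw R k ^+ 2)))).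
  apply: (@le_trans _ _ (\sum_(1 <= k < m.+2) ((k < K)%N%:R * Num.sqrt m.+1%:R +
     2 * \sum_(s < m) Ex p s (cmean a s (fun d => (K <= k)%N%:R * (d == k)%:R))))).
    apply: ler_sum => k _; have [Kk|kK] := leqP K k.
      rewrite mul0r add0r; apply: (le_trans (tl k)); rewrite ler_wpM2l//; apply: ler_sum => s _.
      by apply: (Ex_le tp) => h _; apply: (cmean_le a1) => d _; rewrite mul1r.
    rewrite mul1r; apply: (le_trans (fin k)); rewrite lerDl mulr_ge0//; apply: sumr_ge0 => s _.
    apply: (Ex_ge0 tp) => h vh; rewrite -(cmean_cst a1 0 vh); apply: (cmean_le a1) => d _.
    by rewrite mul0r.
  rewrite big_split/=; apply: lerD.
    rewrite -mulr_suml ler_wpM2r ?sqrtr_ge0// -natr_sum ler_nat.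
    have [Km|mK] := leqP K m.+2; last first.
      apply: (@leq_trans (\sum_(1 <= k < m.+2) 1)%N); first by apply: leq_sum => k _; exact: leq_b1.
      by rewrite sum_nat_const_nat muln1 subSS subn0 (leq_trans _ mK)// ltnW.
    rewrite (big_cat_nat (n := K))//= [X in (_ + X)%N]big_nat_cond [X in (_ + X)%N]big1; last first.
      by move=> k /andP[/andP[Kk _] _]; rewrite ltnNge Kk.
    rewrite addn0; apply: (@leq_trans (\sum_(1 <= k < K) 1)%N); first by apply: leq_sum => k _; exact: leq_b1.
    by rewrite sum_nat_const_nat muln1 leq_subr.
  rewrite -mulr_sumr ler_wpM2l// exchange_big/=; apply: ler_sum => s _.
  rewrite -(Ex_sum tp); apply: (Ex_le tp) => h _; rewrite -cmean_sum; apply: (cmean_le a1) => d /andP[d0 ds].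
  have dm : (d <= m.+1)%N by rewrite (leq_trans ds)// ltnS ltnW.
  rewrite (bigD1_seq d) ?iota_uniq ?mem_index_iota ?d0//= eqxx mulr1 big1 ?addr0.
    rewrite ler_peMr//; apply: (le_trans (lw_ge1 R d)); exact: lw_le_sqr.
  by move=> k /negbTE; rewrite eq_sym => ->; rewrite mulr0.
set n := m.+1%:R : R; have n0 : 0 < n by rewrite ltr0n.
have q0 : 0 < Num.sqrt n by rewrite sqrtr_gt0.
have Kq : K%:R * Num.sqrt n <= e / 2 * n.
  rewrite -[X in _ <= _ * X](sqr_sqrtr (ltW n0)) expr2 mulrA ler_wpM2r ?(ltW q0)//.
  rewrite -ler_pdivrMl ?divr_gt0//; apply: (@le_trans _ _ (2 * K%:R / e)).
    by rewrite invf_div mulrAC.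
  apply: (le_trans (ler_norm _)); rewrite -sqrtr_sqr ler_sqrt ?(ltW n0)//.
  by rewrite (le_trans (ltW (truncnS_gt _)))// ler_nat.
by have := T m; rewrite -/n; lra.
Qed.

End averages.

(** * Quadratic bounds for the exponential *)

Section exp_bounds.
Variable R : realType.
Implicit Types (x b d : R).

(** For [x >= -2], [exp x >= (1 + x / 2)^2] leaves [x^2 / 4]. Below, [- 1 - x >= - x / 2] is enough,
    and [- x <= b] turns it into a square. *)
Lemma expR_quad_ge x b : 2 <= b -> - b <= x -> x ^+ 2 / (2 * b) <= expR x - 1 - x.
Proof.
move=> b2 bx; have b0 : 0 < 2 * b by lra.
have [x2|x2] := leP (-2) x.
  have e1 : 1 + x / 2 <= expR (x / 2) by exact: expR_ge1Dx.
  have : (1 + x / 2) ^+ 2 <= expR (x / 2) ^+ 2.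
    by rewrite ler_pXn2r ?nnegrE ?expR_ge0//; lra.
  rewrite -expRM_natr (_ : x / 2 * 2 = x); last by field.
  move=> le; apply: (@le_trans _ _ (x ^+ 2 / 4)); last by lra.
  by rewrite ler_wpM2l ?sqr_ge0// lef_pV2 ?posrE//; lra.
apply: (@le_trans _ _ (- x / 2)); last by have := expR_gt0 x; lra.
rewrite ler_pdivrMr//; have : 0 <= (- x) * (b + x) by rewrite mulr_ge0//; lra.
by lra.
Qed.

Lemma expR_quad_approx x d : `|x| <= d -> d <= 1 / 2 ->
  `|expR x - 1 - x - x ^+ 2 / 2| <= 2 * d * x ^+ 2.
Proof.
move=> xd d12.
pose g (z : R) := expR z - 1 - z - z ^+ 2 / 2.
have g0 : g 0 = 0 by rewrite /g expR0; ring.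
have quad (z : R) : `|z| <= 1 / 2 -> `|expR z - 1 - z| <= 2 * z ^+ 2.
  rewrite ler_norml => /andP[z1 z2].
  have e1 := expR_ge1Dx z; have e2 := expR_ge1Dx (- z).
  rewrite ger0_norm; last by lra.
  rewrite expRN in e2.
  have z10 : 0 < 1 - z by lra.
  have : expR z <= (1 - z)^-1.
    by rewrite -[leLHS]invrK lef_pV2 ?posrE ?invr_gt0 ?expR_gt0.
  move=> le; suff : (1 - z)^-1 <= 1 + z + 2 * z ^+ 2 by lra.
  rewrite -[leLHS]mul1r ler_pdivrMr//.
  have : 0 <= z ^+ 2 * (1 - 2 * z) by rewrite mulr_ge0 ?sqr_ge0//; lra.
  by lra.
have -> : expR x - 1 - x - x ^+ 2 / 2 = g x - g 0 by rewrite g0 subr0.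
apply: (@le_trans _ _ (2 * x ^+ 2 * `|x - 0|)); last first.
  by rewrite subr0 [leRHS]mulrAC ler_wpM2l// mulr_ge0 ?sqr_ge0.
apply: (@MVT_le _ g (fun z => expR z - 1 - z)) => z zx.
  by apply: is_derive_eq; rewrite /GRing.scale/=; field.
have zx' : `|z| <= `|x|.
  move: zx; case: (leP 0 x) => x0 /andP[z1 z2]; first by rewrite !ger0_norm//; lra.
  by rewrite !ler0_norm//; lra.
apply: (le_trans (quad z _)); first by lra.
rewrite ler_wpM2l// -(real_normK (num_real z)) -(real_normK (num_real x)).
by rewrite ler_pXn2r.
Qed.

End exp_bounds.

(** * Conditional Kullback-Leibler divergences *)

Section log_laplace.
Variables (R : realType) (a : R).
Hypothesis a1 : -1 < a.
Implicit Types (h : nat -> nat) (g phi : nat -> R) (s k : nat).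

Definition log_mgf s g h : R := ln (cmean a s (fun k => expR (g k)) h).

(** The divergence of the true law of the next choice from the law with density proportional to
    [expR g] with respect to it. *)
Definition kl_term s g h : R := log_mgf s g h - cmean a s g h.

Lemma cmean_gt0 s phi h : valid s h -> (forall k, (0 < k <= s.+1)%N -> 0 < phi k) ->
  0 < cmean a s phi h.
Proof.
move=> vh phi0; rewrite divr_gt0 ?weight_sum_gt0// /node_sum.
rewrite big_nat_recr//= ltr_wpDl//.
  apply: sumr_ge0 => i _; rewrite mulr_ge0 ?ltW ?deg_weight_gt0 ?dg_gt0// phi0//.
  by rewrite dg_gt0 dg_le.
by rewrite mulr_gt0 ?deg_weight_gt0 ?dg_gt0// phi0// dg_gt0 dg_le.
Qed.

Lemma log_mgf_bounds s g h l r : valid s h -> (forall k, (0 < k <= s.+1)%N -> l <= g k <= r) ->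
  l <= log_mgf s g h <= r.
Proof.
move=> vh lgr; have e0 : 0 < cmean a s (fun k => expR (g k)) h.
  by apply: cmean_gt0 => // k _; exact: expR_gt0.
rewrite /log_mgf -[X in X <= _ <= _]expRK -[X in _ <= _ <= X]expRK !ler_ln ?posrE ?expR_gt0//.
rewrite -{1}(cmean_cst a1 (expR l) vh) -(cmean_cst a1 (expR r) vh).
by apply/andP; split; apply: (cmean_le a1) => k /lgr/andP[]; rewrite ler_expR.
Qed.

(** Centering at [log_mgf] gives [expR] of the centered variable mean 1, so the divergence is a mean
    of the nonnegative function [exp x - 1 - x]. *)
Lemma kl_termE s g h : valid s h ->
  kl_term s g h =
  cmean a s (fun k => expR (g k - log_mgf s g h) - 1 - (g k - log_mgf s g h)) h.
Proof.
move=> vh; set M := log_mgf s g h; have e0 : 0 < cmean a s (fun k => expR (g k)) h.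
  by apply: cmean_gt0 => // k _; exact: expR_gt0.
rewrite (@cmean_eq _ a a1 s _ (fun k => expR (- M) * expR (g k) + ((M - 1) + (-1) * g k))); last first.
  by move=> k _; rewrite [g k - M]addrC expRD; ring.
rewrite cmeanD cmeanZ cmeanD cmeanZ (cmean_cst a1 _ vh) expRN /M {1}/log_mgf lnK ?posrE//.
by rewrite mulVf ?gt_eqF// /kl_term; ring.
Qed.

Lemma kl_term_ge0 s g h : valid s h -> 0 <= kl_term s g h.
Proof.
move=> vh; rewrite kl_termE// -(cmean_cst a1 0 vh); apply: (cmean_le a1) => k _.
by have := expR_ge1Dx (g k - log_mgf s g h); lra.
Qed.

(** Centering at the mean instead of [log_mgf] can only increase the right-hand side, by
    [1 + t <= exp t]. *)
Lemma kl_term_le s g h : valid s h ->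
  kl_term s g h <=
  cmean a s (fun k => expR (g k - cmean a s g h) - 1 - (g k - cmean a s g h)) h.
Proof.
move=> vh; set c := cmean a s g h; have e0 : 0 < cmean a s (fun k => expR (g k)) h.
  by apply: cmean_gt0 => // k _; exact: expR_gt0.
rewrite (@cmean_eq _ a a1 s _ (fun k => expR (- c) * expR (g k) + ((c - 1) + (-1) * g k))); last first.
  by move=> k _; rewrite [g k - c]addrC expRD; ring.
rewrite cmeanD cmeanZ cmeanD cmeanZ (cmean_cst a1 _ vh) -/c.
have : 1 + (log_mgf s g h - c) <= expR (log_mgf s g h - c) by exact: expR_ge1Dx.
rewrite expRD /log_mgf lnK ?posrE// -/(log_mgf s g h) /kl_term -/c mulrC.
by lra.
Qed.

(** [kl_termE] serves for the lower bound and [kl_term_le] for the upper one. Both centers lie in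
    [[-d, d]], so [exp x - 1 - x] is [x^2 / 2] up to [4 d x^2]. *)
Lemma kl_term_cvar s g h d : valid s h -> d <= 1 / 4 ->
  (forall k, (0 < k <= s.+1)%N -> `|g k| <= d) ->
  `|kl_term s g h - cvar a s g h / 2| <= 4 * d * cvar a s g h.
Proof.
move=> vh d4 gd; have cv0 := cvar_ge0 a1 g vh.
have gd' k : (0 < k <= s.+1)%N -> - d <= g k <= d by move=> /gd; rewrite ler_norml.
have /andP[M1 M2] := log_mgf_bounds vh gd'.
set M := log_mgf s g h in M1 M2; set c := cmean a s g h.
have cvE t : cmean a s (fun k => (g k - t) ^+ 2) h = cvar a s g h + (c - t) ^+ 2.
  rewrite (@cmean_eq _ a a1 s _ (fun k => g k ^+ 2 + ((- t *+ 2) * g k + t ^+ 2))); last first.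
    by move=> k _; ring.
  by rewrite !cmeanD !cmeanZ (cmean_cst a1 _ vh) /cvar -/c; ring.
have c12 : - d <= c <= d.
  rewrite -(cmean_cst a1 (- d) vh) -(cmean_cst a1 d vh).
  apply/andP; split; apply: (cmean_le a1) => k /gd' /andP[? ?] //.
  by rewrite (cmean_cst a1 _ vh).
case/andP: c12 => c1 c2.
have approx t k : - d <= t <= d -> (0 < k <= s.+1)%N ->
    `|expR (g k - t) - 1 - (g k - t) - (g k - t) ^+ 2 / 2| <= 4 * d * (g k - t) ^+ 2.
  move=> /andP[t1 t2] /gd' /andP[g1 g2].
  apply: (le_trans (@expR_quad_approx _ _ (2 * d) _ _)); [|lra|lra].
  by rewrite ler_norml; apply/andP; split; lra.
rewrite ler_norml; apply/andP; split.
  have : (1 / 2 - 4 * d) * cmean a s (fun k => (g k - M) ^+ 2) h <= kl_term s g h.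
    rewrite kl_termE// -/M -cmeanZ; apply: (cmean_le a1) => k kk.
    have := approx M k _ kk; rewrite M1 M2 => /(_ isT); rewrite ler_norml => /andP[]; lra.
  rewrite cvE => le.
  (* For [d > 1/8] this coefficient is negative, and the nonnegativity of [kl_term] suffices. *)
  have : 0 <= (1 / 2 - 4 * d) * (c - M) ^+ 2 \/ 1 / 2 - 4 * d < 0.
    by have [?|?] := leP 0 (1 / 2 - 4 * d); [left; rewrite mulr_ge0 ?sqr_ge0|right].
  case=> [?|neg]; first by lra.
  have := kl_term_ge0 g vh; have : (1 / 2 - 4 * d) * cvar a s g h <= 0.
    by rewrite mulr_le0_ge0// ltW.
  by lra.
have : kl_term s g h <= (1 / 2 + 4 * d) * cmean a s (fun k => (g k - c) ^+ 2) h.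
  apply: (le_trans (kl_term_le g vh)); rewrite -/c -cmeanZ; apply: (cmean_le a1) => k kk.
  have := approx c k _ kk; rewrite c1 c2 => /(_ isT); rewrite ler_norml => /andP[]; lra.
by rewrite cvE subrr expr0n/= addr0; lra.
Qed.

(** Four degrees are enough: differences over the pairs 1, 2 and 3, 4 identify the two
    parameters. *)
Definition point_err s h : R :=
  \sum_(1 <= k < 5) `|cmean a s (fun d => (d == k)%:R) h - ulim a k|.

Lemma ulim_nincr k n : (k <= n)%N -> ulim a n <= ulim a k.
Proof.
have a2 : 0 < 2 + a by have := a1; lra.
exact: (vprod_nincr a1 a2).
Qed.

(** Only the degrees 1 to 4 are kept, each of conditional probability at least
    [ulim a 4 - point_err]. The center [M] is eliminated by
    [(x - M)^2 + (y - M)^2 >= (x - y)^2 / 2]. *)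
Lemma kl_term_ge s g h (b : R) : valid s h -> 2 <= b ->
  (forall k, (0 < k)%N -> g k <= b / 2) -> (forall k, (0 < k < 5)%N -> - (b / 2) <= g k) ->
  (ulim a 4 - point_err s h) / (4 * b) * ((g 2%N - g 1%N) ^+ 2 + (g 4%N - g 3%N) ^+ 2) <= kl_term s g h.
Proof.
move=> vh b2 gb gl; set G := _ ^+ 2 + _ ^+ 2; have G0 : 0 <= G by rewrite addr_ge0 ?sqr_ge0.
have b0 : 0 < 4 * b by lra.
have [neg|pos] := leP (ulim a 4 - point_err s h) 0.
  apply: le_trans (kl_term_ge0 g vh); rewrite mulr_le0_ge0//.
  by rewrite mulr_le0_ge0// invr_ge0 ltW.
set M := log_mgf s g h.
have Mb : M <= b / 2.
  (* A crude lower bound of [g], there only to apply [log_mgf_bounds]. *)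
  pose l := - \sum_(1 <= k < s.+2) `|g k|.
  have lb k : (0 < k <= s.+1)%N -> l <= g k <= b / 2.
    move=> /andP[k0 ks]; rewrite gb// andbT /l lerNl.
    rewrite (bigD1_seq k) ?iota_uniq ?mem_index_iota ?k0//=.
    by rewrite ler_wpDr ?sumr_ge0// -normrN ler_norm.
  by have /andP[] := log_mgf_bounds vh lb.
have psi0 k : 0 <= expR (g k - M) - 1 - (g k - M).
  by have := expR_ge1Dx (g k - M); lra.
have cmk k : (0 < k < 5)%N -> ulim a 4 - point_err s h <= cmean a s (fun d => (d == k)%:R) h.
  move=> /andP[k0 k5].
  have u4 : ulim a 4 <= ulim a k by apply: ulim_nincr; rewrite -ltnS.
  have : `|cmean a s (fun d => (d == k)%:R) h - ulim a k| <= point_err s h.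
    rewrite /point_err (bigD1_seq k) ?iota_uniq ?mem_index_iota ?k0//=.
    by rewrite ler_wpDr ?sumr_ge0.
  by rewrite ler_norml => /andP[]; lra.
apply: (@le_trans _ _ (cmean a s (fun d => \sum_(1 <= k < 5) ((g k - M) ^+ 2 / (2 * b)) * (d == k)%:R) h)); last first.
  rewrite kl_termE// -/M; apply: (cmean_le a1) => d _.
  have [/andP[d0 d5]|dn] := boolP (0 < d < 5)%N.
    rewrite (bigD1_seq d) ?iota_uniq ?mem_index_iota ?d0//= eqxx mulr1 big1 ?addr0; last first.
      by move=> k /negbTE; rewrite eq_sym => ->; rewrite mulr0.
    by apply: expR_quad_ge => //; have := gl d; rewrite d0 d5 => /(_ isT); lra.
  rewrite big_nat_cond big1// => k /andP[k5 _].
  by rewrite (_ : d == k = false) ?mulr0//; apply/eqP => dk; rewrite dk k5 in dn.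
rewrite cmean_sum; under eq_bigr do rewrite cmeanZ.
apply: (@le_trans _ _ (\sum_(1 <= k < 5) (g k - M) ^+ 2 / (2 * b) * (ulim a 4 - point_err s h))); last first.
  by apply: ler_sum_nat => k k5; rewrite ler_wpM2l ?cmk// divr_ge0 ?sqr_ge0//; lra.
rewrite -mulr_suml -mulr_suml -mulrA mulrC; apply: ler_wpM2r; first exact: ltW.
rewrite /index_iota /= !big_cons big_nil addr0 /G.
have -> : (4 * b)^-1 = 2^-1 / (2 * b) by field; rewrite gt_eqF//; lra.
rewrite mulrAC; apply: ler_wpM2r; first by rewrite invr_ge0; lra.
have : 0 <= (g 1%N - M + (g 2%N - M)) ^+ 2 by exact: sqr_ge0.
have : 0 <= (g 3%N - M + (g 4%N - M)) ^+ 2 by exact: sqr_ge0.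
by lra.
Qed.

End log_laplace.

(** * Log-likelihood ratios in the parametric family *)

Section family.
Variables (R : realType) (eps a : R).
Hypotheses (eps0 : 0 < eps) (aeps : -1 + eps < a < eps^-1).
Implicit Types (h : nat -> nat) (al be : R) (s m k : nat).

Let a1 : -1 < a. Proof. by have := eps0; case/andP: aeps => + _; lra. Qed.

Lemma alpha_gtN1 al : -1 + eps < al < eps^-1 -> -1 < al.
Proof. by have := eps0; move=> ? /andP[+ _]; lra. Qed.

Lemma deg_alpha_gt al k : -1 + eps < al -> (0 < k)%N -> eps < k%:R + al.
Proof. by rewrite -(ler1n R) => ? ?; lra. Qed.

Definition log_ratio al be k : R := be * ln (k%:R + al) - ln (k%:R + a).

Lemma pa_fun_ratio al be k : -1 + eps < al -> (0 < k)%N ->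
  pa_fun al be k = (k%:R + a) * expR (log_ratio al be k).
Proof.
move=> ale k0; have ka : 0 < k%:R + a by exact: deg_weight_gt0.
have kal : 0 < k%:R + al by apply: lt_trans (deg_alpha_gt ale k0).
rewrite /pa_fun /log_ratio expRD expRN lnK ?posrE// /powR gt_eqF//.
by rewrite mulrCA divff ?mulr1// gt_eqF.
Qed.

Lemma loglik_diff m h al be : valid m h -> -1 + eps < al ->
  m.+1%:R * (loglik h m.+1 (pa_fun al be) - loglik h m.+1 (pa_fun a 1)) =
  mart a m (log_ratio al be) h - \sum_(s < m) kl_term a s (log_ratio al be) h.
Proof.
move=> vh ale; rewrite mulrBr !loglikE// -!sumrB; apply: eq_bigr => s _.
have vs : valid s h by apply: valid_leq vh; exact: ltnW.
have aea : -1 + eps < a by case/andP: aeps.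
set d := chosen s h; have d0 : (0 < d)%N by exact: dg_gt0.
have ka : 0 < d%:R + a by exact: deg_weight_gt0.
have kal : 0 < d%:R + al by apply: lt_trans (deg_alpha_gt ale d0).
have nE be' al' : -1 + eps < al' -> node_sum s (pa_fun al' be') h =
    weight_sum a s * cmean a s (fun k => expR (log_ratio al' be' k)) h.
  move=> ale'; rewrite /cmean mulrC divfK ?gt_eqF ?weight_sum_gt0//.
  by apply: eq_bigr => i _; rewrite (pa_fun_ratio _ ale')// dg_gt0.
have -> : node_sum s (pa_fun a 1) h = weight_sum a s.
  rewrite -(node_sum_weight a vs); apply: eq_bigr => i _; rewrite /pa_fun powRr1//.
  exact/ltW/deg_weight_gt0/dg_gt0.
rewrite nE// lnM ?posrE ?weight_sum_gt0//; last first.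
  by apply: cmean_gt0 => // k _; exact: expR_gt0.
rewrite /pa_fun !ln_powR mul1r -/(log_mgf a s (log_ratio al be) h) /kl_term /log_ratio.
by ring.
Qed.

(** The two scores are the derivatives of [log_ratio al be k] in [al] and in [be] at [(a, 1)]. *)
Definition score1 k : R := (k%:R + a)^-1.
Definition score2 k : R := ln (k%:R + a).

Lemma ln_deg_bound : exists2 C, 0 <= C & forall al k, -1 + eps < al < eps^-1 -> (0 < k)%N ->
  `|ln (k%:R + al)| <= C * lw R k.
Proof.
have l1 : 0 <= ln (1 + eps^-1) by rewrite ln_ge0// lerDl invr_ge0 ltW.
exists (`|ln eps| + ln (1 + eps^-1) + 1) => [|al k ale k0]; first by rewrite !addr_ge0.
have kal : eps < k%:R + al by apply: deg_alpha_gt => //; case/andP: ale.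
have kal0 : 0 < k%:R + al by exact: lt_trans kal.
have lw1 := lw_ge1 R k.
have k1 : 1 <= k.+1%:R :> R by rewrite ler1n.
have i0 : 0 < eps^-1 by rewrite invr_gt0.
have e0 := normr_ge0 (ln eps).
have lo : - `|ln eps| <= ln (k%:R + al).
  apply: (@le_trans _ _ (ln eps)); first by rewrite lerNl -normrN ler_norm.
  by rewrite ler_ln ?posrE// ltW.
have up : ln (k%:R + al) <= ln (1 + eps^-1) + ln k.+1%:R.
  have i1 : 0 < 1 + eps^-1 by rewrite addr_gt0.
  have k2 : 0 < k.+1%:R :> R by rewrite ltr0n.
  rewrite -lnM ?posrE// ler_ln ?posrE ?mulr_gt0//.
  rewrite mulrDl mul1r -natr1; case/andP: ale => _ ale.
  have : 0 <= eps^-1 * k%:R by rewrite mulr_ge0// ltW.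
  by lra.
have lnk : 0 <= ln k.+1%:R :> R by rewrite ln_ge0.
rewrite ler_norml; apply/andP; split.
  apply: le_trans lo; rewrite lerN2; apply: (@le_trans _ _ (`|ln eps| * lw R k)).
    by rewrite ler_peMr.
  by rewrite ler_wpM2r ?(le_trans ler01)//; lra.
apply: (le_trans up); rewrite /lw mulrDr mulr1; apply: lerD; first by lra.
by rewrite ler_peMl//; lra.
Qed.

Lemma score1_bound k : (0 < k)%N -> `|score1 k| <= eps^-1 * lw R k.
Proof.
move=> k0; have ka := deg_alpha_gt (proj1 (andP aeps)) k0.
have ka0 := lt_trans eps0 ka.
rewrite /score1 ger0_norm ?invr_ge0 ?(ltW ka0)//.
apply: (@le_trans _ _ eps^-1); first by rewrite lef_pV2 ?posrE// ltW.
by rewrite ler_peMr ?lw_ge1// invr_ge0 ltW.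
Qed.

(** The remainder is bounded in [k] although [score2] is not: with [x = (al - a) / (k + a)], it is
    [(ln (1 + x) - x) + (be - 1) ln (1 + x)], and [x] is [O(al - a)] uniformly in [k]. *)
Lemma log_ratio_expand : exists2 D, 0 <= D & forall al be k,
  -1 + eps < al < eps^-1 -> 0 <= be <= 1 -> (0 < k)%N ->
  `|log_ratio al be k - ((al - a) * score1 k + (be - 1) * score2 k)| <=
  D * ((al - a) ^+ 2 + (be - 1) ^+ 2).
Proof.
have a10 : 0 < 1 + a by have := a1; lra.
(* A lower bound of [1 + x = (k + al) / (k + a)]: this ratio is at least 1 if [al >= a], and
   otherwise increases with [k] from [(1 + al) / (1 + a)]. *)
pose c0 := Num.min 1 (eps / (1 + a)).
have c00 : 0 < c0 by rewrite lt_min ltr01 divr_gt0.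
have c01 : c0 <= 1 by rewrite ge_min lexx.
pose i := (1 + a)^-1; have i0 : 0 < i by rewrite invr_gt0.
exists (c0^-1 * (i ^+ 2 + i)) => [|al be k ale be01 k0].
  by rewrite mulr_ge0 ?addr_ge0 ?sqr_ge0 ?invr_ge0 ?ltW.
have ka : 0 < k%:R + a by exact: deg_weight_gt0.
have ke : eps < k%:R + al by apply: deg_alpha_gt => //; case/andP: ale.
have kal : 0 < k%:R + al by exact: lt_trans ke.
pose x := (al - a) / (k%:R + a).
have x1 : 1 + x = (k%:R + al) / (k%:R + a) by rewrite /x; field; rewrite gt_eqF.
have x10 : 0 < 1 + x by rewrite x1 divr_gt0.
have k1 : 1 <= k%:R :> R by rewrite ler1n.
have c0x : c0 <= 1 + x.
  have [aal|ala] := leP a al.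
    by apply: (le_trans c01); rewrite lerDl /x divr_ge0 ?subr_ge0// ltW.
  apply: (@le_trans _ _ (eps / (1 + a))); first by rewrite ge_min lexx orbT.
  rewrite x1 ler_pdivrMr// mulrAC ler_pdivlMr//.
  have : 0 <= (k%:R - 1) * (a - al) by rewrite mulr_ge0//; lra.
  have : 0 <= (k%:R + a) * (1 + al - eps) by rewrite mulr_ge0 ?(ltW ka)//; case/andP: ale; lra.
  by lra.
have xi : `|x| <= `|al - a| * i.
  rewrite /x normrM [`|_^-1|]ger0_norm ?invr_ge0 ?(ltW ka)// ler_wpM2l//.
  by rewrite lef_pV2 ?posrE//; lra.
pose l := ln (1 + x).
have l1 : l <= x by apply: le_ln1Dx; lra.
have l2 : x / (1 + x) <= l.
  have : ln (1 + - (x / (1 + x))) <= - (x / (1 + x)).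
    apply: le_ln1Dx; rewrite ltrN2 ltr_pdivrMr//; lra.
  have -> : 1 + - (x / (1 + x)) = (1 + x)^-1 by field; rewrite gt_eqF.
  by rewrite lnV ?posrE// -/l; lra.
have inv : (1 + x)^-1 <= c0^-1 by rewrite lef_pV2 ?posrE.
have lx2 : `|l - x| <= c0^-1 * x ^+ 2.
  have -> : `|l - x| = x - l by rewrite ler0_norm; lra.
  apply: (@le_trans _ _ ((1 + x)^-1 * x ^+ 2)); last by rewrite ler_wpM2r ?sqr_ge0.
  have : (1 + x)^-1 * x ^+ 2 = x - x / (1 + x) by field; rewrite gt_eqF.
  by lra.
have labs : `|l| <= c0^-1 * `|x|.
  have c1 : `|x| <= c0^-1 * `|x| by rewrite ler_peMl// invf_ge1.
  have : `|x / (1 + x)| <= c0^-1 * `|x|.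
    rewrite [`|x / _|]normrM mulrC [`|(1 + x)^-1|]ger0_norm ?invr_ge0 ?(ltW x10)//.
    exact: ler_wpM2r.
  have := ler_norm x; rewrite !ler_norml => xx /andP[? ?]; apply/andP; split; lra.
have -> : log_ratio al be k - ((al - a) * score1 k + (be - 1) * score2 k) =
    (l - x) + (be - 1) * l.
  rewrite /log_ratio (_ : ln (k%:R + al) = ln (k%:R + a) + l); last by rewrite /l x1 ln_div ?posrE//; ring.
  by rewrite /score1 /score2 /x; ring.
apply: (le_trans (ler_normD _ _)); rewrite normrM.
set u := `|al - a| in xi; set v := `|be - 1|.
have u0 : 0 <= u by exact: normr_ge0.
have v0 : 0 <= v by exact: normr_ge0.
have -> : (al - a) ^+ 2 = u ^+ 2 by rewrite real_normK// num_real.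
have -> : (be - 1) ^+ 2 = v ^+ 2 by rewrite real_normK// num_real.
apply: (@le_trans _ _ (c0^-1 * (u * i) ^+ 2 + v * (c0^-1 * (u * i)))).
  apply: lerD.
    apply: (le_trans lx2); rewrite ler_wpM2l ?invr_ge0 ?(ltW c00)//.
    by rewrite -(real_normK (num_real x)) ler_pXn2r ?nnegrE ?mulr_ge0 ?(ltW i0).
  rewrite ler_wpM2l//; apply: (le_trans labs); rewrite ler_wpM2l ?invr_ge0 ?(ltW c00)//.
have -> : c0^-1 * (u * i) ^+ 2 + v * (c0^-1 * (u * i)) = c0^-1 * (i ^+ 2 * u ^+ 2 + i * (u * v)) by ring.
rewrite -[leRHS]mulrA; apply: ler_wpM2l; first by rewrite invr_ge0 ltW.
rewrite [leRHS]mulrDl; apply: lerD.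
  by rewrite ler_wpM2l ?sqr_ge0// lerDl sqr_ge0.
rewrite ler_wpM2l ?(ltW i0)//.
have : 0 <= (u - v) ^+ 2 by exact: sqr_ge0.
have : 0 <= u ^+ 2 by exact: sqr_ge0.
have : 0 <= v ^+ 2 by exact: sqr_ge0.
by lra.
Qed.

(** The upper bound is uniform in [k] because [be <= 1]. For [be < 1] the ratio tends to minus
    infinity with [k], so a lower bound is asked only at the degrees that [kl_term_ge] uses. *)
Lemma log_ratio_upper : exists2 b, 2 <= b & forall al be, -1 + eps < al < eps^-1 -> 0 <= be <= 1 ->
  (forall k, (0 < k)%N -> log_ratio al be k <= b / 2) /\
  (forall k, (0 < k < 5)%N -> - (b / 2) <= log_ratio al be k).
Proof.
have [C C0 HC] := ln_deg_bound.
have a10 : 0 < 1 + a by have := a1; lra.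
pose b1 := 2 * ln (1 + (2 + eps^-1) / (1 + a)).
pose b2 := 2 * (2 * C * lw R 5).
exists (Num.max 2 (Num.max b1 b2)) => [|al be ale /andP[be0 be1]]; first by rewrite le_max lexx.
set b := Num.max _ _; have bb1 : b1 <= b by rewrite !le_max lexx orbT.
have bb2 : b2 <= b by rewrite !le_max lexx !orbT.
have i0 : 0 < eps^-1 by rewrite invr_gt0.
split=> k; last first.
  move=> /andP[k0 k5]; have := HC al k ale k0; have := HC a k aeps k0.
  have lk : C * lw R k <= C * lw R 5.
    by rewrite ler_wpM2l// /lw lerD2l ler_ln ?posrE ?ltr0n// ler_nat ltnS ltnW.
  rewrite !ler_norml => /andP[l1 l2] /andP[l3 l4].
  have : be * ln (k%:R + al) >= - (C * lw R 5).
    apply: (@le_trans _ _ (be * - (C * lw R 5))).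
      by rewrite mulrN lerN2 ler_piMl// mulr_ge0// (le_trans ler01 (lw_ge1 _ _)).
    by rewrite ler_wpM2l//; lra.
  by rewrite /log_ratio /b2 in bb2 *; lra.
move=> k0; have ka : 0 < k%:R + a by exact: deg_weight_gt0.
have ke : eps < k%:R + al by apply: deg_alpha_gt => //; case/andP: ale.
have kal : 0 < k%:R + al by exact: lt_trans ke.
have k1 : 1 <= k%:R :> R by rewrite ler1n.
apply: (@le_trans _ _ (b1 / 2)); last by lra.
rewrite /b1 mulrAC divff// mul1r.
have q0 : 0 < (2 + eps^-1) / (1 + a) by rewrite divr_gt0// addr_gt0.
have -> : log_ratio al be k = ln (pa_fun al be k / (k%:R + a)).
  by rewrite ln_div ?posrE ?powR_gt0// /pa_fun ln_powR.
rewrite ler_ln ?posrE; [|by rewrite divr_gt0 ?powR_gt0|by rewrite addr_gt0].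
rewrite ler_pdivrMr// mulrDl mul1r.
have p1 : pa_fun al be k <= 1 + (k%:R + al).
  rewrite /pa_fun; have [x1|x1] := leP 1 (k%:R + al).
    apply: (@le_trans _ _ ((k%:R + al) `^ 1)); first exact: ler_powR.
    by rewrite powRr1 ?(ltW kal)// lerDr.
  apply: (@le_trans _ _ ((k%:R + al) `^ 0)); last by rewrite powRr0 lerDl ltW.
  by apply: ger_powR; rewrite ?kal//= ltW.
apply: (le_trans p1).
have : (2 + eps^-1) * 1 <= (2 + eps^-1) / (1 + a) * (k%:R + a).
  rewrite -mulrA ler_wpM2l ?addr_ge0 ?(ltW i0)// mulrC ler_pdivlMr// mul1r; lra.
by case/andP: ale => _; lra.
Qed.

(** By the mean value theorem a difference over consecutive degrees is [((be - 1) (x + a) - (al -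
    a)) / ((x + al) (x + a))]. The points [x] in [1, 2] and [3, 4] are at distance at least 1, so
    the two numerators determine [be - 1], then [al - a]. *)
Lemma log_ratio_identified : exists2 c, 0 < c & forall al be,
  -1 + eps < al < eps^-1 -> 0 <= be <= 1 ->
  c * ((al - a) ^+ 2 + (be - 1) ^+ 2) <=
  (log_ratio al be 2 - log_ratio al be 1) ^+ 2 + (log_ratio al be 4 - log_ratio al be 3) ^+ 2.
Proof.
have i0 : 0 < eps^-1 by rewrite invr_gt0.
(* [M] bounds the denominators, and [L] bounds [|al - a| + |be - 1|] in terms of the sum of the two
   absolute differences. *)
pose M := (4 + eps^-1) ^+ 2; have M0 : 0 < M by rewrite exprn_gt0// addr_gt0.
pose L := 2 * M + 8 * M * (4 + eps^-1).
exists (L ^+ 2 * 2 + 1)^-1 => [|al be ale be01].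
  by rewrite invr_gt0 ltr_wpDl// mulr_ge0 ?sqr_ge0.
have der k : (0 < k <= 3)%N -> exists2 x : R, k%:R <= x <= k.+1%:R &
    `|(be - 1) * (x + a) - (al - a)| <= M * `|log_ratio al be k.+1 - log_ratio al be k|.
  move=> /andP[k0 k3].
  have k1 : 1 <= k%:R :> R by rewrite ler1n.
  have k4 : k.+1%:R <= 4 :> R by rewrite (ler_nat R k.+1 4) ltnS.
  have kk : k%:R <= k.+1%:R :> R by rewrite ler_nat.
  pose g (z : R) := be * ln (z + al) - ln (z + a).
  have pos (z : R) : 1 <= z -> 0 < z + al /\ 0 < z + a.
    by case/andP: ale => ? _; case/andP: aeps => ? _; have := eps0; lra.
  have dg (z : R) : Num.min k%:R k.+1%:R <= z <= Num.max k%:R k.+1%:R ->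
      is_derive z 1 g (be / (z + al) - (z + a)^-1).
    rewrite min_l// => /andP[kz _]; have [p1 p2] := pos z (le_trans k1 kz).
    have d1 := @is_derive1_comp _ (@ln R) (fun z : R => z + al) z _ 1 (is_derive1_ln p1).
    have d2 := @is_derive1_comp _ (@ln R) (fun z : R => z + a) z _ 1 (is_derive1_ln p2).
    have {}d1 : is_derive z 1 (fun z : R => ln (z + al)) ((z + al)^-1 * 1).
      by apply: d1; apply: is_derive_eq; rewrite addr0.
    have {}d2 : is_derive z 1 (fun z : R => ln (z + a)) ((z + a)^-1 * 1).
      by apply: d2; apply: is_derive_eq; rewrite addr0.
    apply: (is_derive_eq (is_deriveB (is_deriveZ be d1) d2)).
    by rewrite /GRing.scale/= !mulr1.
  have [x] := MVT_minmax dg; rewrite min_l// max_r// => kx E; exists x => //.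
  have [p1 p2] := pos x (le_trans k1 (proj1 (andP kx))).
  rewrite (_ : k.+1%:R - k%:R = 1) ?mulr1 in E; last by rewrite -natr1; ring.
  have -> : log_ratio al be k.+1 - log_ratio al be k = ((be - 1) * (x + a) - (al - a)) / ((x + al) * (x + a)).
    rewrite -[LHS]/(g k.+1%:R - g k%:R) E; field; by rewrite !gt_eqF.
  rewrite normrM [`|_^-1|]ger0_norm ?invr_ge0 ?mulr_ge0 ?(ltW p1) ?(ltW p2)//.
  rewrite mulrCA; apply: ler_peMr => //; rewrite ler_pdivlMr ?mulr_gt0// mul1r /M expr2.
  case/andP: kx => _ kx.
  by apply: ler_pM; rewrite ?(ltW p1) ?(ltW p2)//; case/andP: ale => _ ?; case/andP: aeps => _ ?; lra.
have [x1 /andP[x11 x12] E1] := der 1%N isT; have [x2 /andP[x21 x22] E2] := der 3%N isT.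
set g1 := _ - log_ratio al be 1 in E1 *; set g2 := _ - log_ratio al be 3 in E2 *.
set h1 := al - a in E1 E2 *; set h2 := be - 1 in E1 E2 *.
have H2 : `|h2| <= M * (`|g1| + `|g2|).
  have x12' : 1 <= x2 - x1 by lra.
  apply: (@le_trans _ _ (`|h2 * (x2 - x1)|)).
    by rewrite normrM ler_peMr// ger0_norm; lra.
  have -> : h2 * (x2 - x1) = (h2 * (x2 + a) - h1) - (h2 * (x1 + a) - h1) by ring.
  by apply: (le_trans (ler_normB _ _)); lra.
have xa : `|x1 + a| <= 4 + eps^-1.
  by case/andP: aeps => ? ?; have := eps0; rewrite ler_norml => ?; apply/andP; split; lra.
have H1 : `|h1| <= (M * (4 + eps^-1) + M) * (`|g1| + `|g2|).
  have -> : h1 = h2 * (x1 + a) - (h2 * (x1 + a) - h1) by ring.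
  apply: (le_trans (ler_normB _ _)); rewrite [leRHS]mulrDl; apply: lerD.
    by rewrite normrM mulrAC; apply: ler_pM.
  by apply: (le_trans E1); rewrite ler_wpM2l ?(ltW M0)// lerDl.
set G := `|g1| + `|g2| in H1 H2.
have G0 : 0 <= G by rewrite addr_ge0.
have L0 : 0 <= L by rewrite addr_ge0 ?mulr_ge0 ?addr_ge0 ?ltW.
have HL : `|h1| + `|h2| <= L * G.
  have : 0 <= M * (4 + eps^-1) * G by rewrite !mulr_ge0 ?addr_ge0 ?(ltW M0) ?(ltW i0).
  by rewrite /L; lra.
rewrite ler_pdivrMl ?ltr_wpDl// ?mulr_ge0 ?sqr_ge0//.
have -> : h1 ^+ 2 = `|h1| ^+ 2 by rewrite real_normK// num_real.
have -> : h2 ^+ 2 = `|h2| ^+ 2 by rewrite real_normK// num_real.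
have -> : g1 ^+ 2 = `|g1| ^+ 2 by rewrite real_normK// num_real.
have -> : g2 ^+ 2 = `|g2| ^+ 2 by rewrite real_normK// num_real.
apply: (@le_trans _ _ ((`|h1| + `|h2|) ^+ 2)).
  by have : 0 <= `|h1| * `|h2| by [rewrite mulr_ge0]; lra.
apply: (@le_trans _ _ ((L * G) ^+ 2)).
  by rewrite ler_pXn2r ?nnegrE ?addr_ge0// mulr_ge0.
rewrite exprMn mulrDl mul1r -mulrA.
have : L ^+ 2 * G ^+ 2 <= L ^+ 2 * (2 * (`|g1| ^+ 2 + `|g2| ^+ 2)).
  rewrite ler_wpM2l ?sqr_ge0// /G.
  by have : 0 <= (`|g1| - `|g2|) ^+ 2 by [exact: sqr_ge0]; lra.
by have := sqr_ge0 `|g1|; have := sqr_ge0 `|g2|; lra.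
Qed.

End family.

(** * Limiting means and covariances *)

Section information.
Variables (R : realType) (a : R).
Hypothesis a1 : -1 < a.
Implicit Types (phi psi : nat -> R).

Definition log_dominated phi := exists C, forall k, (0 < k)%N -> `|phi k| <= C * lw R k.

Definition log2_dominated phi := exists C, forall k, (0 < k)%N -> `|phi k| <= C * lw R k ^+ 2.

Lemma log_dominated_ge0 phi : log_dominated phi ->
  exists2 C, 0 <= C & forall k, (0 < k)%N -> `|phi k| <= C * lw R k.
Proof.
move=> [C H]; exists C => //; have := le_trans (normr_ge0 _) (H 1%N isT).
by rewrite pmulr_lge0//; exact: lt_le_trans (lw_ge1 _ _).
Qed.

Lemma log_dominated_lin x y phi psi : log_dominated phi -> log_dominated psi ->
  log_dominated (fun k => x * phi k + y * psi k).
Proof.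
move=> [C H] [D K]; exists (`|x| * C + `|y| * D) => k k0.
rewrite mulrDl -!mulrA; apply: (le_trans (ler_normD _ _)); rewrite !normrM.
by apply: lerD; apply: ler_wpM2l => //; [exact: H|exact: K].
Qed.

Lemma log_dominated_cst c : log_dominated (fun=> c).
Proof. by exists `|c| => k _; rewrite ler_peMr// lw_ge1. Qed.

Lemma log_dominated2 phi : log_dominated phi -> log2_dominated phi.
Proof. by move=> [C H]; exists C; case: (lw_bounded_sqr H). Qed.

Lemma log2_dominatedM phi psi : log_dominated phi -> log_dominated psi ->
  log2_dominated (fun k => phi k * psi k).
Proof.
move=> [C H] [D K]; exists (C * D) => k k0.
by rewrite normrM expr2 mulrACA; apply: ler_pM => //; [exact: H|exact: K].
Qed.

Lemma log2_dominated_lin x y phi psi : log2_dominated phi -> log2_dominated psi ->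
  log2_dominated (fun k => x * phi k + y * psi k).
Proof.
move=> [C H] [D K]; exists (`|x| * C + `|y| * D) => k k0.
rewrite mulrDl -!mulrA; apply: (le_trans (ler_normD _ _)); rewrite !normrM.
by apply: lerD; apply: ler_wpM2l => //; [exact: H|exact: K].
Qed.

Lemma eq_qmean phi psi : (forall k, (0 < k)%N -> phi k = psi k) -> qmean a phi = qmean a psi.
Proof. by move=> e; apply: eq_pos_series => k /e ->. Qed.

Lemma qmean_lin x y phi psi : log2_dominated phi -> log2_dominated psi ->
  qmean a (fun k => x * phi k + y * psi k) = x * qmean a phi + y * qmean a psi.
Proof.
move=> [C H] [D K]; have [B1 H1] := ulim_dominated a1 H; have [B2 H2] := ulim_dominated a1 K.
rewrite -(pos_series_lin x y _ H1 H2); last by have := a1; lra.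
by apply: eq_pos_series => k _; ring.
Qed.

(* The conditional means of the constant 1 are all 1, and their averages converge to its limit mean. *)
Lemma qmean_cst c : qmean a (fun=> c) = c.
Proof.
have [C H] := log_dominated2 (log_dominated_cst c).
have avg := cmean_avg a1 H; apply/eqP; rewrite eq_sym -subr_eq0 -normr_eq0.
rewrite eq_le normr_ge0 andbT; apply/ler_addgt0Pl => e e0; rewrite addr0.
have [N HN] := avg _ (divr_gt0 e0 (ltr0n R 2)).
have := HN N.+1 (leqnSn _); rewrite (eq_bigr (fun=> `|c - qmean a (fun=> c)|)); last first.
  move=> s _; rewrite -[RHS](Ex_cst (pa_transition a1) s); apply: (Ex_eq (pa_transition a1)) => h vh.
  by rewrite (cmean_cst a1 c vh).
rewrite sumr_const card_ord -[leLHS]mulr_natr => le.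
have n0 : 0 < N.+1%:R :> R by rewrite ltr0n.
rewrite -(ler_pM2r n0); apply: (le_trans le); rewrite -[N.+2%:R]natr1.
have : 1 <= N.+1%:R :> R by rewrite ler1n.
move=> n1; have : 0 <= e * (N.+1%:R - 1) by rewrite mulr_ge0 ?(ltW e0)// subr_ge0.
by lra.
Qed.

Lemma qmean_ge_partial phi K : log2_dominated phi -> (forall k, (0 < k)%N -> 0 <= phi k) ->
  \sum_(1 <= k < K.+1) ulim a k * phi k <= qmean a phi.
Proof.
move=> [C H] phi0; have [B HB] := ulim_dominated a1 H.
have s0 : 0 < (1 + a) / 2 by have := a1; lra.
have cv := pos_series_cvg s0 HB.
rewrite /qmean -(cvg_lim _ cv)//.
apply: (@nondecreasing_cvgn_le R (fun n => \sum_(1 <= k < n.+1) ulim a k * phi k)).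
  apply/nondecreasing_seqP => n; rewrite [leRHS]big_nat_recr//= lerDl mulr_ge0 ?phi0//.
  by case/andP: (ulim_bounds a1 n.+1).
by apply/cvg_ex; eexists; exact: cv.
Qed.

Definition qcov phi psi : R := qmean a (fun k => phi k * psi k) - qmean a phi * qmean a psi.

Lemma qvarE phi : qvar a phi = qcov phi phi.
Proof. by rewrite /qvar /qcov -expr2; congr (_ - _); apply: eq_qmean => k _; rewrite expr2. Qed.

Lemma qcovC phi psi : qcov phi psi = qcov psi phi.
Proof. by rewrite /qcov mulrC; congr (_ - _); apply: eq_qmean => k _; rewrite mulrC. Qed.

Lemma qcov_linr x y phi psi chi : log_dominated phi -> log_dominated psi -> log_dominated chi ->
  qcov chi (fun k => x * phi k + y * psi k) = x * qcov chi phi + y * qcov chi psi.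
Proof.
move=> d1 d2 d3; rewrite /qcov (qmean_lin x y (log_dominated2 d1) (log_dominated2 d2)).
rewrite (@eq_qmean _ (fun k => x * (chi k * phi k) + y * (chi k * psi k))); last by move=> k _; ring.
by rewrite (qmean_lin x y (log2_dominatedM d3 d1) (log2_dominatedM d3 d2)); ring.
Qed.

Lemma qvar_lin x y phi psi : log_dominated phi -> log_dominated psi ->
  qvar a (fun k => x * phi k + y * psi k) =
  x ^+ 2 * qvar a phi + 2 * x * y * qcov phi psi + y ^+ 2 * qvar a psi.
Proof.
move=> d1 d2; rewrite !qvarE qcov_linr//; last exact: log_dominated_lin.
by rewrite ![qcov (fun k => _ + _) _]qcovC !qcov_linr// (qcovC psi phi); ring.
Qed.

Lemma qvar_centered phi : log_dominated phi ->
  qvar a phi = qmean a (fun k => (phi k - qmean a phi) ^+ 2).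
Proof.
move=> d1; set c := qmean a phi.
have d0 := log_dominated_lin 1 (- c) d1 (log_dominated_cst 1).
rewrite (@eq_qmean _ (fun k => 1 * (phi k * phi k) + 1 * ((- 2 * c) * phi k + c ^+ 2 * 1))); last first.
  by move=> k _; ring.
rewrite qmean_lin; [|exact: log2_dominatedM|]; last first.
  apply: log2_dominated_lin; first exact: log_dominated2.
  by apply: log_dominated2; exact: log_dominated_cst.
rewrite (qmean_lin _ _ (log_dominated2 d1) (log_dominated2 (log_dominated_cst 1))) qmean_cst.
by rewrite qvarE /qcov -/c; ring.
Qed.

(** Every degree has positive limiting probability, and one of the two distinct values differs from
    the mean. *)
Lemma qvar_gt0 phi j k : log_dominated phi -> (0 < j < k)%N -> phi j != phi k -> 0 < qvar a phi.
Proof.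
move=> d1 /andP[j0 jk] njk; rewrite qvar_centered//; set c := qmean a phi.
have d2 : log2_dominated (fun k => (phi k - c) ^+ 2).
  have d3 := log_dominated_lin 1 (- c) d1 (log_dominated_cst 1).
  have [C H] := log2_dominatedM d3 d3; exists C => i i0.
  by apply: le_trans (H i i0); rewrite (_ : _ ^+ 2 = (1 * phi i + - c * 1) * (1 * phi i + - c * 1))//; ring.
have le := @qmean_ge_partial _ k d2 (fun i _ => sqr_ge0 _).
apply: lt_le_trans le; have k0 : (0 < k)%N by exact: ltn_trans jk.
have a2 : 0 < 2 + a by have := a1; lra.
have u0 i : 0 < ulim a i by exact: (vprod_gt0 a1 a2).
rewrite (bigD1_seq j) ?mem_index_iota ?iota_uniq ?j0 ?ltnS 1?ltnW//=.
rewrite big_mkcond (bigD1_seq k) ?mem_index_iota ?iota_uniq ?k0 ?ltnSn//= gtn_eqF//=.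
have u1 := u0 j; have u2 := u0 k.
have rest : 0 <= \sum_(1 <= i < k.+1 | i != k) if i != j then ulim a i * (phi i - c) ^+ 2 else 0.
  by apply: sumr_ge0 => i _; case: ifP => // _; rewrite mulr_ge0 ?sqr_ge0// ltW.
have t1 : 0 <= ulim a j * (phi j - c) ^+ 2 by rewrite mulr_ge0 ?sqr_ge0// ltW.
have t2 : 0 <= ulim a k * (phi k - c) ^+ 2 by rewrite mulr_ge0 ?sqr_ge0// ltW.
have [jc|jc] := eqVneq (phi j) c.
  have : 0 < ulim a k * (phi k - c) ^+ 2.
    by rewrite mulr_gt0// exprn_even_gt0//= subr_eq0 -jc eq_sym.
  by lra.
have : 0 < ulim a j * (phi j - c) ^+ 2 by rewrite mulr_gt0// exprn_even_gt0//= subr_eq0.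
by lra.
Qed.

End information.

(** * The information matrix of the two scores *)

Section fisher.
Variables (R : realType) (eps a : R).
Hypotheses (eps0 : 0 < eps) (aeps : -1 + eps < a < eps^-1).

Let a1 : -1 < a := alpha_gtN1 eps0 aeps.

Lemma score1_dominated : log_dominated (score1 a).
Proof. by exists eps^-1 => k; exact: score1_bound. Qed.

Lemma score2_dominated : log_dominated (score2 a).
Proof. by have [C C0 H] := ln_deg_bound eps0; exists C => k k0; exact: H. Qed.

Lemma info1_gt0 : 0 < qvar a (score1 a).
Proof.
apply: (qvar_gt0 a1 (j := 1%N) (k := 2%N) score1_dominated) => //.
have p1 : 0 < 1%:R + a by exact: deg_weight_gt0.
have p2 : 0 < 2%:R + a by exact: deg_weight_gt0.
by apply/eqP => /invr_inj; lra.
Qed.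

(** The coefficient of the regression of [score2] on [score1] under the limit law. *)
Definition kappa := qcov a (score1 a) (score2 a) / qvar a (score1 a).

(* The score of beta, orthogonalized with respect to the score of alpha. *)
Definition eff_score k : R := 1 * score2 a k + - kappa * score1 a k.

Definition eff_info := qvar a eff_score.

Lemma eff_score_dominated : log_dominated eff_score.
Proof. by apply: log_dominated_lin; [exact: score2_dominated|exact: score1_dominated]. Qed.

Lemma eff_score_orth : qcov a (score1 a) eff_score = 0.
Proof.
rewrite (qcov_linr a1 _ _ score2_dominated score1_dominated score1_dominated) -qvarE.
by rewrite /kappa mulNr divfK ?gt_eqF ?info1_gt0// mul1r subrr.
Qed.

Lemma qvar_scores x y :
  qvar a (fun k => x * score1 a k + y * eff_score k) =
  x ^+ 2 * qvar a (score1 a) + y ^+ 2 * eff_info.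
Proof.
rewrite (qvar_lin a1 _ _ score1_dominated eff_score_dominated) eff_score_orth.
by rewrite mulr0 addr0.
Qed.

Lemma eff_infoE : eff_info =
  qvar a (score2 a) - qcov a (score1 a) (score2 a) ^+ 2 / qvar a (score1 a).
Proof.
rewrite /eff_info (qvar_lin a1 _ _ score2_dominated score1_dominated).
by rewrite (qcovC a (score2 a)) /kappa; field; rewrite gt_eqF ?info1_gt0.
Qed.

(** If [eff_score] took equal values at 1 and 2 and also at 3 and 4, its derivative
    [(x + a + kappa) / (x + a)^2] would vanish both in [1, 2] and in [3, 4]. *)
Lemma eff_info_gt0 : 0 < eff_info.
Proof.
pose g (z : R) := ln (z + a) - kappa * (z + a)^-1.
have pos (z : R) : 1 <= z -> 0 < z + a by have := a1; lra.
have dg (j k : nat) : (0 < j)%N -> (j < k)%N -> eff_score j = eff_score k ->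
    exists2 x : R, j%:R <= x <= k%:R & x + a = - kappa.
  move=> j0 jk E.
  have j1 : 1 <= j%:R :> R by rewrite ler1n.
  have jkR : j%:R < k%:R :> R by rewrite ltr_nat.
  have D (z : R) : Num.min j%:R k%:R <= z <= Num.max j%:R k%:R ->
      is_derive z 1 g ((z + a)^-1 + kappa * (z + a)^-2).
    rewrite min_l ?(ltW jkR)// => /andP[kz _]; have p := pos z (le_trans j1 kz).
    have i1 : is_derive z 1 (fun z : R => z + a) 1 by apply: is_derive_eq; rewrite addr0.
    have i2 : is_derive z 1 (fun z : R => ln (z + a)) ((z + a)^-1 * 1).
      exact: (@is_derive1_comp _ (@ln R) (fun z : R => z + a) z _ 1 (is_derive1_ln p) i1).
    have i3 : is_derive z 1 (fun z : R => (z + a)^-1) (- (z + a)^-2 *: 1).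
      by apply: is_deriveV; rewrite gt_eqF.
    apply: (is_derive_eq (is_deriveB i2 (is_deriveZ kappa i3))).
    by rewrite /GRing.scale/= mulr1; ring.
  have [x] := MVT_minmax D; rewrite min_l ?max_r ?(ltW jkR)// => jx.
  have -> : g k%:R - g j%:R = 0.
    have gE i : g i%:R = eff_score i by rewrite /g /eff_score /score1 /score2; ring.
    by rewrite !gE E subrr.
  move=> /esym/eqP; rewrite mulf_eq0 [X in _ || X]subr_eq0 [X in _ || X]gt_eqF// orbF => /eqP F.
  exists x => //; have p := pos x (le_trans j1 (proj1 (andP jx))).
  have : (x + a) ^+ 2 * ((x + a)^-1 + kappa * (x + a)^-2) = x + a + kappa.
    by field; rewrite gt_eqF.
  by rewrite F mulr0 => /esym; lra.
have [E1|] := eqVneq (eff_score 1%N) (eff_score 2%N); last first.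
  exact: (qvar_gt0 a1 eff_score_dominated).
have [E2|] := eqVneq (eff_score 3%N) (eff_score 4%N); last first.
  exact: (qvar_gt0 a1 eff_score_dominated).
have [x /andP[_ x2] ex] := dg 1%N 2%N isT isT E1.
have [y /andP[y3 _] ey] := dg 3%N 4%N isT isT E2.
by lra.
Qed.

End fisher.

(** * Conditional variances of combinations of the scores *)

Section conditional_variance.
Variables (R : realType) (a : R).
Hypothesis a1 : -1 < a.
Implicit Types (h : nat -> nat) (phi psi : nat -> R) (m s k : nat).

Lemma lw_sqrt_small (e : R) : 0 < e ->
  exists N, forall m, (N <= m)%N -> lw R m.+1 <= e * Num.sqrt m.+1%:R.
Proof.
(* 50 is [2 (1 + 4)^2]: [lw_sqr_le] at the exponent 1/4, and a factor 2 to pass from [m.+2] to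
   [m.+1] under the root. *)
move=> e0; pose c := 50 / e ^+ 2; have c0 : 0 < c by rewrite divr_gt0// exprn_gt0.
exists (Num.truncn (c ^+ 2)) => m Nm; set n : R := m.+1%:R.
have n0 : 0 < n by rewrite ltr0n.
have n1 : 1 <= n by rewrite ler1n.
have cn : c <= Num.sqrt n.
  rewrite -[leLHS](ger0_norm (ltW c0)) -sqrtr_sqr ler_sqrt ?(ltW n0)// ltW//.
  by apply: lt_le_trans (truncnS_gt _) _; rewrite ler_nat.
have lw0 : 0 <= lw R m.+1 by apply: le_trans ler01 (lw_ge1 _ _).
rewrite -(ler_pXn2r (n := 2))// ?nnegrE// ?mulr_ge0 ?(ltW e0) ?sqrtr_ge0//.
rewrite exprMn sqr_sqrtr ?(ltW n0)//.
have q0 : 0 < 4^-1 :> R by rewrite invr_gt0.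
have := lw_sqr_le m.+1 q0; rewrite invrK (_ : 2 * 4^-1 = 2^-1 :> R); last by field.
rewrite powR12_sqrt ?ler0n// => /le_trans; apply.
have s2 : Num.sqrt m.+2%:R <= 2 * Num.sqrt n.
  have -> : 2 = Num.sqrt (2 ^+ 2) :> R by rewrite sqrtr_sqr ger0_norm.
  rewrite -sqrtrM ?sqr_ge0// ler_sqrt ?mulr_ge0 ?sqr_ge0 ?(ltW n0)//.
  by rewrite -natr1 -/n; lra.
have s0 : 0 < Num.sqrt n by rewrite sqrtr_gt0.
apply: (@le_trans _ _ (50 * Num.sqrt n)).
  by rewrite (_ : (1 + 4) ^+ 2 = 25 :> R); [lra|ring].
have -> : e ^+ 2 * n = e ^+ 2 * Num.sqrt n * Num.sqrt n.
  by rewrite -mulrA -expr2 sqr_sqrtr// ltW.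
rewrite ler_wpM2r ?(ltW s0)//.
by rewrite -ler_pdivrMl ?exprn_gt0// mulrC.
Qed.

Lemma cmean_abs_le s phi b h : valid s h -> (forall k, (0 < k <= s.+1)%N -> `|phi k| <= b) ->
  `|cmean a s phi h| <= b.
Proof.
move=> vh phib; apply: (le_trans (cmean_norm a1 _ _ _)).
by rewrite -[leRHS](cmean_cst a1 b vh); apply: (cmean_le a1).
Qed.

Lemma cvar_perturb s phi r (d b : R) h : valid s h ->
  (forall k, (0 < k <= s.+1)%N -> `|phi k| <= d) ->
  (forall k, (0 < k <= s.+1)%N -> `|r k| <= b) ->
  `|cvar a s (fun k => phi k + r k) h - cvar a s phi h| <= 4 * d * b + 2 * b ^+ 2.
Proof.
move=> vh phid rb.
have d0 : 0 <= d by apply: le_trans (phid 1%N isT).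
have b0 : 0 <= b by apply: le_trans (rb 1%N isT).
have -> : cvar a s (fun k => phi k + r k) h - cvar a s phi h =
    (2 * cmean a s (fun k => phi k * r k) h + cmean a s (fun k => r k * r k) h) -
    (2 * (cmean a s phi h * cmean a s r h) + cmean a s r h * cmean a s r h).
  rewrite /cvar (@cmean_eq _ a a1 s _ (fun k => phi k ^+ 2 + (2 * (phi k * r k) + r k * r k))); last first.
    by move=> k _; ring.
  by rewrite !cmeanD cmeanZ; ring.
have B1 : `|cmean a s (fun k => phi k * r k) h| <= d * b.
  by apply: cmean_abs_le => // k kk; rewrite normrM; apply: ler_pM; rewrite ?phid ?rb.
have B2 : `|cmean a s (fun k => r k * r k) h| <= b * b.
  by apply: cmean_abs_le => // k kk; rewrite normrM; apply: ler_pM; rewrite ?phid ?rb.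
have B3 : `|cmean a s phi h * cmean a s r h| <= d * b.
  by rewrite normrM; apply: ler_pM => //; exact: cmean_abs_le.
have B4 : `|cmean a s r h * cmean a s r h| <= b * b.
  by rewrite normrM; apply: ler_pM => //; exact: cmean_abs_le.
move: B1 B2 B3 B4; rewrite !ler_norml expr2 -!mulrA.
by move=> /andP[? ?] /andP[? ?] /andP[? ?] /andP[? ?]; apply/andP; split; lra.
Qed.

(** Polarization: three conditional variances determine the others, so three limits control all
    coefficients [x], [y] at once, even random ones. *)
Lemma cvar_lin s x y phi psi h :
  cvar a s (fun k => x * phi k + y * psi k) h =
  (x ^+ 2 - x * y) * cvar a s phi h + (y ^+ 2 - x * y) * cvar a s psi h +
  x * y * cvar a s (fun k => phi k + psi k) h.
Proof.
have sqE u v : cmean a s (fun k => (u * phi k + v * psi k) ^+ 2) h =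
    u ^+ 2 * cmean a s (fun k => phi k ^+ 2) h + (2 * u * v) * cmean a s (fun k => phi k * psi k) h +
    v ^+ 2 * cmean a s (fun k => psi k ^+ 2) h.
  rewrite (@cmean_eq _ a a1 s _ (fun k => u ^+ 2 * phi k ^+ 2 +
    ((2 * u * v) * (phi k * psi k) + v ^+ 2 * psi k ^+ 2))); last by move=> k _; ring.
  by rewrite !cmeanD !cmeanZ; ring.
rewrite /cvar sqE.
rewrite (@cmean_eq _ a a1 s (fun k => (phi k + psi k) ^+ 2) (fun k => (1 * phi k + 1 * psi k) ^+ 2)).
  by rewrite sqE !cmeanD !cmeanZ; ring.
by move=> k _; rewrite !mul1r.
Qed.

Lemma mart_lin m x y phi psi h :
  mart a m (fun k => x * phi k + y * psi k) h = x * mart a m phi h + y * mart a m psi h.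
Proof.
rewrite /mart !mulr_sumr -big_split; apply: eq_bigr => s _ /=.
by rewrite cmeanD !cmeanZ; ring.
Qed.

Lemma eq_mart m phi psi h : (forall k, (0 < k)%N -> phi k = psi k) ->
  mart a m phi h = mart a m psi h.
Proof.
move=> e; apply: eq_bigr => s _; rewrite e ?dg_gt0//.
by congr (_ - _); apply: (cmean_eq a1) => k /andP[/e].
Qed.

Definition cvar_dev m phi h : R := `|\sum_(s < m) cvar a s phi h - m.+1%:R * qvar a phi|.

Lemma cvar_dev_lin m x y phi psi (eta : R) h : log_dominated phi -> log_dominated psi ->
  cvar_dev m phi h <= eta -> cvar_dev m psi h <= eta ->
  cvar_dev m (fun k => 1 * phi k + 1 * psi k) h <= eta ->
  cvar_dev m (fun k => x * phi k + y * psi k) h <= 3 * eta * (x ^+ 2 + y ^+ 2).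
Proof.
move=> d1 d2 e1 e2 e3; have eta0 : 0 <= eta by apply: le_trans e1; exact: normr_ge0.
rewrite /cvar_dev; set n : R := m.+1%:R.
have -> : \sum_(s < m) cvar a s (fun k => x * phi k + y * psi k) h -
    n * qvar a (fun k => x * phi k + y * psi k) =
    (x ^+ 2 - x * y) * (\sum_(s < m) cvar a s phi h - n * qvar a phi) +
    (y ^+ 2 - x * y) * (\sum_(s < m) cvar a s psi h - n * qvar a psi) +
    x * y * (\sum_(s < m) cvar a s (fun k => 1 * phi k + 1 * psi k) h -
      n * qvar a (fun k => 1 * phi k + 1 * psi k)).
  have SE u v : \sum_(s < m) cvar a s (fun k => u * phi k + v * psi k) h =
      (u ^+ 2 - u * v) * \sum_(s < m) cvar a s phi h + (v ^+ 2 - u * v) * \sum_(s < m) cvar a s psi h +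
      u * v * \sum_(s < m) cvar a s (fun k => phi k + psi k) h.
    by under eq_bigr do rewrite cvar_lin; rewrite big_split big_split/= -!mulr_sumr.
  by rewrite !SE !(qvar_lin a1)//; ring.
apply: (le_trans (ler_normD _ _)).
apply: (@le_trans _ _ (`|x ^+ 2 - x * y| * eta + `|y ^+ 2 - x * y| * eta + `|x * y| * eta)).
  apply: lerD; last by rewrite normrM ler_wpM2l.
  apply: (le_trans (ler_normD _ _)).
  by apply: lerD; rewrite normrM ler_wpM2l.
rewrite -!mulrDl mulrAC ler_wpM2r//.
have xy : `|x * y| <= (x ^+ 2 + y ^+ 2) / 2.
  rewrite ler_norml; have := sqr_ge0 (x + y); have := sqr_ge0 (x - y).
  by move=> ? ?; apply/andP; split; lra.
have X0 := sqr_ge0 x; have Y0 := sqr_ge0 y.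
have t1 : `|x ^+ 2 - x * y| <= x ^+ 2 + `|x * y|.
  by apply: (le_trans (ler_normB _ _)); rewrite [`|x ^+ 2|]ger0_norm.
have t2 : `|y ^+ 2 - x * y| <= y ^+ 2 + `|x * y|.
  by apply: (le_trans (ler_normB _ _)); rewrite [`|y ^+ 2|]ger0_norm.
by lra.
Qed.

End conditional_variance.

Section real_arithmetic.
Variable R : realType.
Implicit Types x y : R.

Lemma sqr_norm_sum x y : x ^+ 2 + y ^+ 2 <= (`|x| + `|y|) ^+ 2.
Proof.
rewrite -(real_normK (num_real x)) -(real_normK (num_real y)) sqrrD.
by rewrite lerD2r lerDl mulrn_wge0 ?mulr_ge0.
Qed.

Lemma half_approx (s1 s2 s3 s4 S T e1 e2 e3 e4 : R) :
  `|s1 - s2| <= e1 -> `|s3 - S / 2| <= e2 -> `|S - T| <= e3 -> `|T - s4| <= e4 ->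
  `|s1 - s3 - (s2 - s4 / 2)| <= e1 + e2 + (e3 + e4) / 2.
Proof.
rewrite !ler_norml => /andP[? ?] /andP[? ?] /andP[? ?] /andP[? ?].
by apply/andP; split; lra.
Qed.

Lemma two_approx (L1 L2 Q1 Q2 X e : R) : L1 <= L2 ->
  `|L2 - (Q2 + X)| <= e -> `|L1 - (Q1 + X)| <= e -> Q1 - Q2 <= 2 * e.
Proof. by rewrite !ler_norml => ? /andP[? ?] /andP[? ?]; lra. Qed.

Lemma cvg_sumr (T I : Type) (F : set_system T) {FF : Filter F} (r : seq I)
    (f : I -> T -> R) (l : I -> R) :
  (forall i, f i @ F --> l i) ->
  (fun t => \sum_(i <- r) f i t) @ F --> \sum_(i <- r) l i.
Proof.
move=> fl; elim: r => [|i r IH].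
  by rewrite big_nil; under eq_fun do rewrite big_nil; exact: cvg_cst.
by rewrite big_cons; under eq_fun do rewrite big_cons; exact: cvgD.
Qed.

End real_arithmetic.

(** * Deterministic analysis of the estimator on the regular event *)

Section estimation.
Variables (R : realType) (eps a : R).
Hypotheses (eps0 : 0 < eps) (aeps : -1 + eps < a < eps^-1).
Implicit Types (h : nat -> nat) (th : R * R) (s m k : nat).

Let a1 : -1 < a := alpha_gtN1 eps0 aeps.
Let w := score1 a.
Let ef := eff_score a.
Let K := kappa a.
Let V1 := qvar a w.
Let Vt := eff_info a.
Let Vt0 : 0 < Vt. Proof. exact: eff_info_gt0 aeps. Qed.
Let V10 : 0 < V1. Proof. exact: info1_gt0 aeps. Qed.

Lemma sqrt_large (c e : R) : 0 < e -> exists N, forall m, (N <= m)%N -> c <= e * Num.sqrt m.+1%:R.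
Proof.
move=> e0; have c0 : 0 < `|c| + 1 by rewrite ltr_wpDl.
have [N HN] := lw_sqrt_small (divr_gt0 e0 c0); exists N => m /HN.
rewrite mulrAC ler_pdivlMr// => le; apply: le_trans le.
apply: (@le_trans _ _ (1 * (`|c| + 1))); first by have := ler_norm c; lra.
by rewrite ler_wpM2r ?lw_ge1// ltW.
Qed.

(** For a valid history this is [n (loglik th - loglik (a, 1))] at [n = m.+1], for every [th] in
    [Theta]. *)
Definition ell m h th : R :=
  mart a m (log_ratio a th.1 th.2) h - \sum_(s < m) kl_term a s (log_ratio a th.1 th.2) h.

Definition dist_true th : R := `|th.1 - a| + `|th.2 - 1|.

(** [B0] is fixed first and makes the two martingale bounds likely; [eta] can then be taken as small
    as the expansion requires. The condition on [point_err] keeps the divergences quadratic, and the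
    last three feed the polarization. *)
Definition regular (B0 eta : R) m h : Prop :=
  [/\ `|mart a m w h| <= B0 * Num.sqrt m.+1%:R, `|mart a m ef h| <= B0 * Num.sqrt m.+1%:R,
      count_mart a m h <= eta * m.+1%:R,
      \sum_(s < m) point_err a s h <= ulim a 4 / 4 * m.+1%:R &
      [/\ cvar_dev a m w h <= eta * m.+1%:R, cvar_dev a m ef h <= eta * m.+1%:R &
          cvar_dev a m (fun k => 1 * w k + 1 * ef k) h <= eta * m.+1%:R]].

Lemma true_Theta : Theta eps (a, 1).
Proof. by split => //=; rewrite ler01 lexx. Qed.

(** The coordinates [al - a + K (be - 1)] and [be - 1] are dual to [score1] and [eff_score], which
    are uncorrelated in the limit. *)
Lemma log_ratio_scores : exists2 D, 0 <= D & forall th k, Theta eps th -> (0 < k)%N ->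
  `|log_ratio a th.1 th.2 k -
    ((th.1 - a + K * (th.2 - 1)) * w k + (th.2 - 1) * ef k)| <= D * dist_true th ^+ 2.
Proof.
have [D D0 H] := log_ratio_expand eps0 aeps; exists D => // th k [t1 t2] k0.
have := H _ _ k t1 t2 k0.
have -> : (th.1 - a) * score1 a k + (th.2 - 1) * score2 a k =
    (th.1 - a + K * (th.2 - 1)) * w k + (th.2 - 1) * ef k.
  by rewrite /ef /eff_score -/K -/w; ring.
move=> /le_trans; apply; apply: ler_wpM2l => //.
exact: sqr_norm_sum.
Qed.

Lemma score_coord_le th :
  `|th.1 - a + K * (th.2 - 1)| + `|th.2 - 1| <= (2 + `|K|) * dist_true th.
Proof.
have : `|th.1 - a + K * (th.2 - 1)| <= `|th.1 - a| + `|K| * `|th.2 - 1|.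
  by apply: (le_trans (ler_normD _ _)); rewrite normrM.
have : 0 <= `|K| * `|th.1 - a| by exact: mulr_ge0.
have := normr_ge0 (th.1 - a); have := normr_ge0 (th.2 - 1); rewrite /dist_true.
by lra.
Qed.

Lemma ell_mart : exists2 D, 0 <= D & forall m h th, Theta eps th ->
  `|mart a m (log_ratio a th.1 th.2) h -
    ((th.1 - a + K * (th.2 - 1)) * mart a m w h + (th.2 - 1) * mart a m ef h)| <=
  D * dist_true th ^+ 2 * count_mart a m h.
Proof.
have [D D0 H] := log_ratio_scores; exists D => // m h th tth.
set x := _ + K * _; set y := th.2 - 1.
pose r k := log_ratio a th.1 th.2 k - (x * w k + y * ef k).
have -> : mart a m (log_ratio a th.1 th.2) h =
    1 * mart a m (fun k => x * w k + y * ef k) h + 1 * mart a m r h.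
  by rewrite -mart_lin; apply: (eq_mart a1) => k _; rewrite /r; ring.
rewrite mart_lin !mul1r addrAC subrr add0r; apply: (mart_count_le a1) => k /andP[k0 _].
exact: H.
Qed.

(** Global on [Theta]: a linear minus a quadratic function of [sqrt n] times the distance to the
    truth, which confines the maximizer to a ball of radius [O(1 / sqrt n)]. *)
Lemma ell_upper : exists c eta0 : R, [/\ 0 < c, 0 < eta0 &
  forall B0 eta m h th, 0 <= B0 -> eta <= eta0 -> (0 < m)%N -> valid m h ->
  regular B0 eta m h -> Theta eps th ->
  ell m h th <= (2 + `|K|) * B0 * (Num.sqrt m.+1%:R * dist_true th) -
    c * (Num.sqrt m.+1%:R * dist_true th) ^+ 2].
Proof.
have [D D0 HD] := ell_mart.
have [c1 c10 Hc1] := log_ratio_identified eps0 aeps.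
have [b b2 Hb] := log_ratio_upper eps0 aeps.
have a2 : 0 < 2 + a by have := a1; lra.
have u40 : 0 < ulim a 4 by exact: (vprod_gt0 a1 a2).
have b0 : 0 < b by lra.
(* The divergences give [2 c n q^2]; one half absorbs the remainder of the martingale, at most
   [D eta n q^2]. *)
pose c := ulim a 4 * c1 / (64 * b).
have c0 : 0 < c by rewrite divr_gt0 ?mulr_gt0.
exists c, (c / (D + 1)); split=> // [|B0 eta m h th B00 etale m0 vh reg tth].
  by rewrite divr_gt0// ltr_wpDl.
set n : R := m.+1%:R; set q := dist_true th.
have n0 : 0 < n by rewrite ltr0n.
have q0 : 0 <= q by rewrite addr_ge0.
have [t1 t2] := tth; have [Hb1 Hb2] := Hb _ _ t1 t2.
set G := (log_ratio a th.1 th.2 2 - log_ratio a th.1 th.2 1) ^+ 2 +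
    (log_ratio a th.1 th.2 4 - log_ratio a th.1 th.2 3) ^+ 2.
have G0 : 0 <= G by rewrite addr_ge0 ?sqr_ge0.
have Gq : c1 * (q ^+ 2 / 2) <= G.
  apply: le_trans (Hc1 _ _ t1 t2); rewrite ler_wpM2l ?(ltW c10)// /q /dist_true.
  rewrite -(real_normK (num_real (th.1 - a))) -(real_normK (num_real (th.2 - 1))).
  have : 0 <= (`|th.1 - a| - `|th.2 - 1|) ^+ 2 by exact: sqr_ge0.
  by lra.
case: reg => M1 M2 cm pe _.
have kl : (2 * c) * (n * q ^+ 2) <= \sum_(s < m) kl_term a s (log_ratio a th.1 th.2) h.
  apply: (@le_trans _ _ (\sum_(s < m) (ulim a 4 - point_err a s h) / (4 * b) * G)); last first.
    apply: ler_sum => s _; apply: (kl_term_ge a1) => //.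
    by apply: valid_leq vh; exact: ltnW.
  rewrite -!mulr_suml sumrB sumr_const card_ord -[ulim a 4 *+ m]mulr_natr.
  have mn : n / 2 <= m%:R.
    have : 1 <= m%:R :> R by rewrite ler1n.
    by rewrite /n -natr1; lra.
  have un : ulim a 4 / 4 * n <= ulim a 4 * m%:R - \sum_(s < m) point_err a s h.
    have := ler_wpM2l (ltW u40) mn; rewrite -/n in pe; lra.
  apply: (@le_trans _ _ (ulim a 4 / 4 * n / (4 * b) * (c1 * (q ^+ 2 / 2)))).
    by rewrite /c le_eqVlt; apply/orP; left; apply/eqP; field; rewrite gt_eqF.
  apply: ler_pM => //; last first.
  - by rewrite ler_wpM2r// invr_ge0 mulr_ge0// ltW.
  - by rewrite mulr_ge0 ?(ltW c10)// divr_ge0 ?sqr_ge0.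
  by rewrite !divr_ge0 ?mulr_ge0 ?divr_ge0 ?(ltW u40) ?(ltW n0) ?(ltW b0).
have mt : mart a m (log_ratio a th.1 th.2) h <=
    (2 + `|K|) * B0 * (Num.sqrt n * q) + c * (n * q ^+ 2).
  have := HD m h th tth; set x := _ + K * _; set y := th.2 - 1; set M := mart a m w h.
  set M' := mart a m ef h => le.
  have e1 : D * q ^+ 2 * count_mart a m h <= c * (n * q ^+ 2).
    apply: (@le_trans _ _ (D * q ^+ 2 * (eta * n))).
      by rewrite ler_wpM2l// mulr_ge0 ?sqr_ge0.
    rewrite (_ : D * q ^+ 2 * (eta * n) = D * eta * (n * q ^+ 2)); last by ring.
    rewrite ler_wpM2r ?mulr_ge0 ?sqr_ge0 ?(ltW n0)//.
    apply: (@le_trans _ _ (D * (c / (D + 1)))); first by rewrite ler_wpM2l.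
    by rewrite mulrCA ler_piMr ?(ltW c0)// ler_pdivrMr ?ltr_wpDl// mul1r lerDl.
  have e2 : x * M + y * M' <= (2 + `|K|) * q * (B0 * Num.sqrt n).
    apply: (@le_trans _ _ ((`|x| + `|y|) * (B0 * Num.sqrt n))); last first.
      by rewrite ler_wpM2r ?mulr_ge0 ?sqrtr_ge0// score_coord_le.
    apply: (le_trans (ler_norm _)); apply: (le_trans (ler_normD _ _)).
    by rewrite [leRHS]mulrDl !normrM; apply: lerD; rewrite ler_wpM2l.
  move: le; rewrite ler_norml => /andP[_ le].
  rewrite (_ : (2 + `|K|) * B0 * (Num.sqrt n * q) = (2 + `|K|) * q * (B0 * Num.sqrt n)); last by ring.
  by rewrite -/q in le; lra.
rewrite /ell exprMn sqr_sqrtr ?(ltW n0)//.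
by lra.
Qed.

(** At distance [O(1 / sqrt n)] the log ratios are [O(log n / sqrt n)] on all degrees reached, so
    divergences are half conditional variances, whose sum is close to [n] times the limiting
    quadratic form. *)
Lemma ell_local (B zeta : R) : 0 <= B -> 0 < zeta -> exists2 eta, 0 < eta & exists N,
  forall B0 m h th, (N <= m)%N -> valid m h -> regular B0 eta m h -> Theta eps th ->
  Num.sqrt m.+1%:R * dist_true th <= B ->
  forall x y, x = th.1 - a + K * (th.2 - 1) -> y = th.2 - 1 ->
  `|ell m h th - (x * mart a m w h + y * mart a m ef h -
     m.+1%:R / 2 * (x ^+ 2 * V1 + y ^+ 2 * Vt))| <= zeta.
Proof.
move=> B00 z0.
have [D D0 HD] := ell_mart.
have [D' D'0 HD'] := log_ratio_scores.
have [C1 C10 HC1] := log_dominated_ge0 (score1_dominated eps0 aeps).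
have [C2 C20 HC2] := log_dominated_ge0 (eff_score_dominated eps0 aeps).
(* [A] bounds [n (x^2 + y^2)], [E] bounds [n] times the remainder of [log_ratio], and [S0] bounds
   the sum of the conditional variances. *)
pose A := ((2 + `|K|) * B) ^+ 2.
pose E := D' * B ^+ 2.
pose S0 := A * (V1 + Vt + 3) + 6 * E.
have A0 : 0 <= A by exact: sqr_ge0.
have E0 : 0 <= E by rewrite mulr_ge0 ?sqr_ge0.
have V3 : 0 <= V1 + Vt + 3 by have := V10; have := Vt0; lra.
have S00 : 0 <= S0 by rewrite addr_ge0 ?mulr_ge0.
pose eta := Num.min 1 (zeta / (2 * (D * B ^+ 2 + 2 * A + 1))).
have den1 : 0 < 2 * (D * B ^+ 2 + 2 * A + 1).
  by rewrite mulr_gt0// ltr_wpDl// addr_ge0 ?mulr_ge0 ?sqr_ge0.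
have eta0 : 0 < eta by rewrite lt_min ltr01 divr_gt0.
have eta1 : eta <= 1 by rewrite ge_min lexx.
have etaz : (D * B ^+ 2 + 2 * A) * eta <= zeta / 2.
  have : eta * (2 * (D * B ^+ 2 + 2 * A + 1)) <= zeta.
    by rewrite -ler_pdivlMr// ge_min lexx orbT.
  by have := eta0; lra.
pose delta := Num.min (1 / 8) (zeta / (2 * (8 * S0 + 3 * E + 1))).
have den2 : 0 < 2 * (8 * S0 + 3 * E + 1).
  by rewrite mulr_gt0// ltr_wpDl// addr_ge0 ?mulr_ge0.
have del0 : 0 < delta by rewrite lt_min divr_gt0//= divr_gt0.
have del8 : delta <= 1 / 8 by rewrite ge_min lexx.
have delz : (8 * S0 + 3 * E) * delta <= zeta / 2.
  have : delta * (2 * (8 * S0 + 3 * E + 1)) <= zeta.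
    by rewrite -ler_pdivlMr// ge_min lexx orbT.
  by have := del0; lra.
have fin : D * B ^+ 2 * eta + 4 * (delta * S0) + (6 * E * delta + 3 * eta * A) / 2 <= zeta.
  by have := ltW eta0; have := mulr_ge0 A0 (ltW eta0); have := mulr_ge0 S00 (ltW del0); lra.
have del1 : delta <= 1 by lra.
have del4 : delta <= 1 / 4 by lra.
pose F := (2 + `|K|) * B * (C1 + C2) + E.
have F0 : 0 <= F by rewrite addr_ge0 ?mulr_ge0 ?addr_ge0.
have [N HN] := lw_sqrt_small (divr_gt0 del0 (ltr_wpDl F0 ltr01)).
exists eta => //; exists N => B1 m h th Nm vh reg tth uB x y xE yE.
set n : R := m.+1%:R; have n0 : 0 < n by rewrite ltr0n.
have n1 : 1 <= n by rewrite ler1n.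
have s0 : 0 < Num.sqrt n by rewrite sqrtr_gt0.
have s1 : 1 <= Num.sqrt n by rewrite -sqrtr1 ler_sqrt// ltW.
set q := dist_true th in uB *; have q0 : 0 <= q by rewrite addr_ge0.
have nq : n * q ^+ 2 <= B ^+ 2.
  rewrite -[n in leLHS](sqr_sqrtr (ltW n0)) -exprMn ler_pXn2r ?nnegrE//.
  by rewrite mulr_ge0// ltW.
have q2 : q ^+ 2 <= B ^+ 2 / n by rewrite ler_pdivlMr// mulrC.
have qB : q <= B / Num.sqrt n by rewrite ler_pdivlMr// mulrC.
pose r k := log_ratio a th.1 th.2 k - (x * w k + y * ef k).
pose b := E / n; have b0 : 0 <= b by rewrite divr_ge0// ltW.
have rb k : (0 < k)%N -> `|r k| <= b.
  move=> k0; have := HD' _ _ tth k0; rewrite -xE -yE => /le_trans; apply.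
  by rewrite /b /E -mulrA ler_wpM2l.
have Hlw := HN m Nm; rewrite -/n in Hlw.
have lw1 := lw_ge1 R m.+1.
have xy := score_coord_le th; rewrite -xE -yE -/q in xy.
(* [d] bounds the linear part of [log_ratio] on the degrees up to [m.+1], and [b] its remainder on
   all degrees. *)
pose d := (2 + `|K|) * B * (C1 + C2) * (lw R m.+1 / Num.sqrt n).
have K2 : 0 <= 2 + `|K| by exact: addr_ge0.
have C12 : 0 <= C1 + C2 by exact: addr_ge0.
have lw0 : 0 <= lw R m.+1 by exact: le_trans lw1.
have d0 : 0 <= d.
  apply: mulr_ge0; first by rewrite !mulr_ge0.
  by rewrite divr_ge0// ltW.
have lind k : (0 < k <= m.+1)%N -> `|x * w k + y * ef k| <= d.
  move=> /andP[k0 km].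
  have lwk : lw R k <= lw R m.+1 by rewrite /lw lerD2l ler_ln ?posrE ?ltr0n// ler_nat ltnS.
  have lwk0 : 0 <= lw R k by apply: le_trans ler01 (lw_ge1 _ _).
  have W1 : `|w k| <= (C1 + C2) * lw R m.+1.
    apply: (le_trans (HC1 k k0)); apply: ler_pM => //; by rewrite lerDl.
  have W2 : `|ef k| <= (C1 + C2) * lw R m.+1.
    apply: (le_trans (HC2 k k0)); apply: ler_pM => //; by rewrite lerDr.
  apply: (@le_trans _ _ ((`|x| + `|y|) * ((C1 + C2) * lw R m.+1))).
    apply: (le_trans (ler_normD _ _)); rewrite [leRHS]mulrDl !normrM.
    by apply: lerD; rewrite ler_wpM2l.
  rewrite (_ : d = (2 + `|K|) * (B / Num.sqrt n) * ((C1 + C2) * lw R m.+1)); last first.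
    by rewrite /d; ring.
  apply: ler_wpM2r; first exact: mulr_ge0.
  by apply: (le_trans xy); apply: ler_wpM2l.
have db : d + b <= delta.
  have bE : b <= E * (lw R m.+1 / Num.sqrt n).
    rewrite /b ler_wpM2l// ler_pdivlMr// mulrC ler_pdivrMr//.
    apply: (@le_trans _ _ (1 * n)); last by rewrite ler_wpM2r ?(ltW n0).
    rewrite mul1r -[leRHS](sqr_sqrtr (ltW n0)) expr2.
    by rewrite ler_peMl ?(ltW s0).
  apply: (@le_trans _ _ (F * (lw R m.+1 / Num.sqrt n))); first by rewrite /F mulrDl lerD2l.
  rewrite mulrA ler_pdivrMr//; apply: (@le_trans _ _ (F * (delta / (F + 1) * Num.sqrt n))).
    by rewrite ler_wpM2l.
  rewrite mulrA ler_wpM2r ?(ltW s0)// mulrCA ler_piMr ?(ltW del0)//.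
  by rewrite ler_pdivrMr ?ltr_wpDl// mul1r lerDl.
case: reg => M1 M2 cm pe [v1 v2 v3].
have nA : n * (x ^+ 2 + y ^+ 2) <= A.
  have : x ^+ 2 + y ^+ 2 <= ((2 + `|K|) * q) ^+ 2.
    apply: (le_trans (sqr_norm_sum _ _)).
    by rewrite ler_pXn2r ?nnegrE ?mulr_ge0 ?addr_ge0.
  move=> /(ler_wpM2l (ltW n0)) /le_trans; apply.
  by rewrite /A !exprMn mulrCA ler_wpM2l ?sqr_ge0.
pose Q := x ^+ 2 * V1 + y ^+ 2 * Vt.
pose T := \sum_(s < m) cvar a s (fun k => x * w k + y * ef k) h.
have TQ : `|T - n * Q| <= 3 * eta * A.
  have d1 := score1_dominated eps0 aeps; have d2 := eff_score_dominated eps0 aeps.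
  have := cvar_dev_lin a1 x y d1 d2 v1 v2 v3.
  rewrite /cvar_dev (qvar_scores eps0 aeps) -/V1 -/Vt -/n -/Q -/T => /le_trans; apply.
  by rewrite -!mulrA; do 2 apply: ler_wpM2l => //; exact: ltW.
have nQ : n * Q <= A * (V1 + Vt).
  apply: (@le_trans _ _ (n * (x ^+ 2 + y ^+ 2) * (V1 + Vt))); last first.
    by rewrite ler_wpM2r// addr_ge0 ?(ltW V10) ?(ltW Vt0).
  rewrite -mulrA ler_wpM2l ?(ltW n0)// /Q.
  have := mulr_ge0 (sqr_ge0 x) (ltW Vt0); have := mulr_ge0 (sqr_ge0 y) (ltW V10).
  move=> yV xV.
  rewrite (_ : (x ^+ 2 + y ^+ 2) * (V1 + Vt) =
    x ^+ 2 * V1 + y ^+ 2 * Vt + (y ^+ 2 * V1 + x ^+ 2 * Vt)); last by ring.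
  by rewrite lerDl addr_ge0.
pose g := log_ratio a th.1 th.2.
pose S := \sum_(s < m) cvar a s g h.
have gE : g = (fun k => (x * w k + y * ef k) + r k) by apply/funext => k; rewrite /r -/(g k); ring.
have vs (s : 'I_m) : valid s h by apply: valid_leq vh; exact: ltnW.
have sm (s : 'I_m) k : (0 < k <= s.+1)%N -> (0 < k <= m.+1)%N.
  by move=> /andP[-> ks] /=; rewrite (leq_trans ks)// ltnS ltnW.
have nb : n * b = E by rewrite /b mulrC divfK// gt_eqF.
have ST : `|S - T| <= 6 * E * delta.
  rewrite -sumrB; apply: (le_trans (ler_norm_sum _ _ _)).
  apply: (@le_trans _ _ (\sum_(s < m) (4 * d * b + 2 * b ^+ 2))).
    apply: ler_sum => s _; rewrite gE; apply: (cvar_perturb a1 (vs s)) => k ks.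
      exact/lind/(sm s).
    by apply: rb; case/andP: ks.
  rewrite sumr_const card_ord -[leLHS]mulr_natl.
  apply: (@le_trans _ _ (n * (4 * d * b + 2 * b ^+ 2))).
    apply: ler_wpM2r; last by rewrite /n ler_nat.
    by apply: addr_ge0; [apply: mulr_ge0 => //; exact: mulr_ge0|rewrite mulr_ge0 ?sqr_ge0].
  have -> : n * (4 * d * b + 2 * b ^+ 2) = (n * b) * (4 * d + 2 * b) by ring.
  rewrite nb (_ : 6 * E * delta = E * (6 * delta)); last by ring.
  apply: ler_wpM2l => //; apply: (@le_trans _ _ (6 * (d + b))); last exact: ler_wpM2l.
  by rewrite mulrDr; apply: lerD; apply: ler_wpM2r => //; rewrite ler_nat.
have S0' : 0 <= S by apply: sumr_ge0 => s _; exact: cvar_ge0.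
have kS : `|\sum_(s < m) kl_term a s g h - S / 2| <= 4 * delta * S.
  rewrite mulr_suml -sumrB; apply: (le_trans (ler_norm_sum _ _ _)).
  rewrite mulr_sumr; apply: ler_sum => s _; apply: (kl_term_cvar a1 (vs s)) => //.
  move=> k ks; rewrite gE; apply: (le_trans (ler_normD _ _)); apply: le_trans db.
  by apply: lerD; [exact/lind/(sm s)|apply: rb; case/andP: ks].
have mg : `|mart a m g h - (x * mart a m w h + y * mart a m ef h)| <= D * B ^+ 2 * eta.
  have := HD m h th tth; rewrite -xE -yE => /le_trans; apply.
  apply: (@le_trans _ _ (D * q ^+ 2 * (eta * n))).
    by rewrite ler_wpM2l// mulr_ge0 ?sqr_ge0.
  rewrite (_ : D * q ^+ 2 * (eta * n) = D * (n * q ^+ 2) * eta); last by ring.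
  by rewrite ler_wpM2r ?(ltW eta0)// ler_wpM2l.
have SS0 : S <= S0.
  have e1 : 3 * eta * A <= 3 * A by rewrite -mulrA ler_wpM2l// ler_piMl.
  have e2 : 6 * E * delta <= 6 * E by rewrite ler_piMr ?mulr_ge0.
  have -> : S0 = 6 * E + (3 * A + A * (V1 + Vt)) by rewrite /S0; ring.
  have -> : S = (S - T) + ((T - n * Q) + n * Q) by ring.
  apply: lerD; first by apply: le_trans e2; apply: le_trans ST; exact: ler_norm.
  by apply: lerD => //; apply: le_trans e1; apply: le_trans TQ; exact: ler_norm.
have nh : n / 2 * (x ^+ 2 * V1 + y ^+ 2 * Vt) = n * Q / 2 by rewrite /Q; field.
rewrite /ell -/g nh; apply: le_trans fin.
apply: (le_trans (half_approx mg kS ST TQ)).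
rewrite lerD2r lerD2l -mulrA; apply: ler_wpM2l => //.
by apply: ler_wpM2l => //; exact: ltW.
Qed.

Lemma ell_loglik m h th : valid m h -> Theta eps th ->
  ell m h th = m.+1%:R * (loglik h m.+1 (pa_fun th.1 th.2) - loglik h m.+1 (pa_fun a 1)).
Proof. by move=> vh [/andP[t1 _] _]; rewrite (loglik_diff eps0 aeps). Qed.

Lemma maximizes_ell m h th : valid m h -> Theta eps th ->
  (forall th', Theta eps th' -> ell m h th' <= ell m h th) <-> maximizes eps h m.+1 th.
Proof.
move=> vh tth; have n0 : 0 < m.+1%:R :> R by rewrite ltr0n.
have le th' : Theta eps th' -> (ell m h th' <= ell m h th) =
    (loglik h m.+1 (pa_fun th'.1 th'.2) <= loglik h m.+1 (pa_fun th.1 th.2)).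
  by move=> tth'; rewrite !ell_loglik// ler_pM2l// lerD2r.
split=> [H|[_ H] th' tth']; first by split=> // th' tth'; rewrite -le//; exact: H.
by rewrite le//; exact: H.
Qed.

Lemma ell_true m h : valid m h -> ell m h (a, 1) = 0.
Proof. by move=> vh; rewrite (ell_loglik vh true_Theta) subrr mulr0. Qed.

Lemma log_ratio_continuous th k : -1 < th.1 -> (0 < k)%N ->
  {for th, continuous (fun th : R * R => log_ratio a th.1 th.2 k)}.
Proof.
move=> th1 k0; have kth : 0 < k%:R + th.1 by exact: deg_weight_gt0.
apply: cvgB; last exact: cvg_cst.
apply: cvgM; first exact: cvg_snd.
have lnc : {for k%:R + th.1, continuous (@ln R)} by exact: continuous_ln.
apply: (@cvg_comp _ _ _ (fun th : R * R => k%:R + th.1) (@ln R) _ _ _ _ lnc).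
by apply: cvgD; [exact: cvg_cst|exact: cvg_fst].
Qed.

Lemma ell_continuous m h th : valid m h -> -1 < th.1 -> {for th, continuous (ell m h)}.
Proof.
move=> vh th1.
have -> : ell m h = (fun th => \sum_(s < m)
    (log_ratio a th.1 th.2 (chosen s h) - log_mgf a s (log_ratio a th.1 th.2) h)).
  apply/funext => t; rewrite /ell /mart -sumrB; apply: eq_bigr => s _.
  by rewrite /kl_term; ring.
apply: cvg_sumr => s.
have vs : valid s h by apply: valid_leq vh; exact: ltnW.
apply: cvgB; first by apply: log_ratio_continuous => //; exact: dg_gt0.
have lnc : {for cmean a s (fun k => expR (log_ratio a th.1 th.2 k)) h, continuous (@ln R)}.
  by apply: continuous_ln; apply: cmean_gt0 => // k _; exact: expR_gt0.
apply: (@cvg_comp _ _ _ (fun th : R * R => cmean a s (fun k => expR (log_ratio a th.1 th.2 k)) h)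
  (@ln R) _ _ _ _ lnc).
apply: cvgM; last exact: cvg_cst.
apply: cvg_sumr => i; apply: cvgM; first exact: cvg_cst.
apply: (@cvg_comp _ _ _ (fun th : R * R => log_ratio a th.1 th.2 (dg s h i)) (@expR R)).
  by apply: log_ratio_continuous => //; exact: dg_gt0.
exact: continuous_expR.
Qed.

(** [Z] maximizes the parabola over the half-line. For [D < 0] the gap is exactly the squared
    distance; otherwise [Z = 0] and the linear term only adds to it. *)
Lemma quad_max (D Y Z : R) : Y <= 0 -> Z = Num.min 0 (D / Vt) ->
  Vt / 2 * (Y - Z) ^+ 2 <= (Z * D - Vt / 2 * Z ^+ 2) - (Y * D - Vt / 2 * Y ^+ 2).
Proof.
move=> Y0 ->; have [D0|D0] := leP 0 (D / Vt).
  have D0' : 0 <= D by move: D0; rewrite pmulr_lge0// invr_gt0.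
  have : 0 <= (- Y) * D by rewrite mulr_ge0// oppr_ge0.
  by lra.
rewrite le_eqVlt; apply/orP; left; apply/eqP; field.
by rewrite gt_eqF.
Qed.

(** Existence: [ell] is 0 at the truth and negative far from it, so its maximum over a compact box
    is global. Expansion: moving only the second orthogonal coordinate to its predicted value
    cancels all terms in [x], and the maximizer cannot lose by more than the error of
    [ell_local]. *)
Lemma mle_expansion B0 zeta : 0 <= B0 -> 0 < zeta -> exists eta B : R, [/\ 0 < eta, 0 <= B &
  exists N, forall m h, (N <= m)%N -> valid m h -> regular B0 eta m h ->
  (exists th, maximizes eps h m.+1 th) /\
  forall th, maximizes eps h m.+1 th ->
    Num.sqrt m.+1%:R * dist_true th <= B /\
    `|Num.sqrt m.+1%:R * (th.2 - 1) -
      Num.min 0 (mart a m ef h / Num.sqrt m.+1%:R / Vt)| <= zeta].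
Proof.
move=> B00 z0.
have [c [eta0 [c0 eta00 up]]] := ell_upper.
pose B := (2 + `|K|) * B0 / c + 1.
have B1 : 0 < B by rewrite ltr_wpDl// divr_ge0 ?(ltW c0)// mulr_ge0// addr_ge0.
(* A radius that covers both the box of half-widths [B / sqrt n], hence [2 B], and the comparison
   point [th']. *)
pose B2 := (2 + `|K|) * B + (1 + `|K|) * (B0 / Vt).
have K1 : 0 <= 1 + `|K| by exact: addr_ge0.
have BV : 0 <= B0 / Vt by rewrite divr_ge0// ltW.
have BB2 : 2 * B <= B2.
  apply: (@le_trans _ _ ((2 + `|K|) * B)); last by rewrite lerDl mulr_ge0.
  by apply: ler_wpM2r; [exact: ltW|rewrite lerDl].
have B20 : 0 <= B2 by apply: le_trans BB2; rewrite mulr_ge0// ltW.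
(* Chosen so that [2 z' = Vt / 2 * zeta^2], the gap that [quad_max] converts into the distance
   [zeta]. *)
pose z' := Vt * zeta ^+ 2 / 4.
have z'0 : 0 < z' by rewrite divr_gt0// mulr_gt0// exprn_gt0.
have [eta1 eta10 [N1 loc]] := ell_local B20 z'0.
(* Points within [rho] of the truth and with [be <= 1] lie in [Theta]; the 1 in the minimum ensures
   [be >= 0]. *)
pose rho := Num.min (Num.min (a - (-1 + eps)) (eps^-1 - a)) 1 / 2.
have rho0 : 0 < rho.
  by case/andP: aeps => l r; rewrite divr_gt0// !lt_min !subr_gt0 l r ltr01.
have rhoa : [/\ rho < a - (-1 + eps), rho < eps^-1 - a & rho < 1].
  have lt x : 0 < x -> 2 * rho <= x -> rho < x by have := rho0; lra.
  case/andP: aeps => l r.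
  have r2 : 2 * rho = Num.min (Num.min (a - (-1 + eps)) (eps^-1 - a)) 1 by rewrite /rho; field.
  by split; apply: lt; rewrite ?subr_gt0 ?ltr01// r2 !ge_min lexx ?orbT.
have [N2 HN2] := sqrt_large B2 rho0.
exists (Num.min eta0 eta1), B; split; rewrite ?(ltW B1) ?lt_min ?eta00//.
exists (maxn (maxn N1 N2) 1) => m h; rewrite !geq_max -andbA => /and3P[mN1 mN2 m0] vh reg.
set n : R := m.+1%:R; have n0 : 0 < n by rewrite ltr0n.
have s0 : 0 < Num.sqrt n by rewrite sqrtr_gt0.
have reg_le eta : Num.min eta0 eta1 <= eta -> regular B0 eta m h.
  move=> le; have le' : Num.min eta0 eta1 * n <= eta * n by rewrite ler_wpM2r// ltW.
  case: reg => r1 r2 r3 r4 [r5 r6 r7]; split=> //; last split; exact: le_trans le'.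
have reg0 : regular B0 eta0 m h by apply: reg_le; rewrite ge_min lexx.
have reg1 : regular B0 eta1 m h by apply: reg_le; rewrite ge_min lexx orbT.
have outside th : Theta eps th -> B < Num.sqrt n * dist_true th -> ell m h th < 0.
  move=> tth uB; apply: (le_lt_trans (up _ _ _ _ _ B00 (lexx _) m0 vh reg0 tth)).
  move: uB; rewrite -/n; set u := _ * dist_true th => uB.
  rewrite (_ : _ - _ = u * ((2 + `|K|) * B0 - c * u)); last by ring.
  rewrite pmulr_rlt0; last exact: lt_trans uB.
  by rewrite subr_lt0 -ltr_pdivrMl// mulrC; apply: lt_trans uB; rewrite /B ltrDl.
have inside th : Num.sqrt n * dist_true th <= B2 -> th.2 <= 1 -> Theta eps th.
  move=> uB th2; have le : dist_true th <= rho.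
    by rewrite -(ler_pM2l s0); apply: (le_trans uB); rewrite mulrC; exact: HN2.
  have [R1 R2 R3] := rhoa.
  have le1 : `|th.1 - a| <= rho by apply: le_trans le; rewrite lerDl.
  have le2 : `|th.2 - 1| <= rho by apply: le_trans le; rewrite lerDr.
  move: le1 le2; rewrite !ler_norml => /andP[? ?] /andP[? ?]; split; apply/andP; split=> //; lra.
have sB r : (Num.sqrt n * r <= B) = (r <= B / Num.sqrt n) by rewrite ler_pdivlMr// mulrC.
split.
  pose A := [set` `[a - B / Num.sqrt n, a + B / Num.sqrt n]] `*`
    [set` `[1 - B / Num.sqrt n, 1]] : set (R * R).
  have Bs : 0 <= B / Num.sqrt n by rewrite divr_ge0// ltW.
  have tA : A (a, 1) by split => /=; rewrite in_itv/=; apply/andP; split; lra.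
  have cA : compact A by apply: compact_setX; exact: segment_compact.
  have Adist th : A th -> Theta eps th.
    move=> [/= ]; rewrite !in_itv/= => /andP[t1 t2] /andP[t3 t4]; apply: inside => //.
    apply: le_trans BB2; rewrite mulrC -ler_pdivlMr// -mulrA mulr_natl mulr2n /dist_true.
    by apply: lerD; rewrite ler_norml; apply/andP; split; lra.
  have cf : {within A, continuous (ell m h)}.
    apply: continuous_in_subspaceT => th; rewrite inE => /Adist [t1 _].
    by apply: (ell_continuous vh); exact: alpha_gtN1 t1.
  have [th thA mx] := compact_EVT_max (ex_intro _ _ tA) cA cf.
  exists th; have tth := Adist _ (set_mem thA); apply/(maximizes_ell vh tth) => th' tth'.
  have [uB|uB] := leP (Num.sqrt n * dist_true th') B; last first.
    apply: (le_trans (ltW (outside _ tth' uB))); rewrite -(ell_true vh); apply: mx.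
    exact: mem_set.
  apply: mx; apply/mem_set; move: uB; rewrite sB => uB.
  have le1 : `|th'.1 - a| <= B / Num.sqrt n by apply: le_trans uB; rewrite lerDl.
  have le2 : `|th'.2 - 1| <= B / Num.sqrt n by apply: le_trans uB; rewrite lerDr.
  case: tth' => _ /andP[_ t4].
  move: le1 le2; rewrite !ler_norml => /andP[? ?] /andP[? ?].
  by split=> /=; rewrite in_itv/=; apply/andP; split=> //; lra.
move=> th mx; have [tth _] := mx.
have tmax := (maximizes_ell vh tth).2 mx.
have uB : Num.sqrt n * dist_true th <= B.
  rewrite leNgt; apply/negP => /(outside _ tth).
  by rewrite ltNge -(ell_true vh) tmax//; exact: true_Theta.
split=> //.
set D := mart a m ef h / Num.sqrt n.
pose Z := Num.min 0 (D / Vt); pose Y := Num.sqrt n * (th.2 - 1).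
have DE : mart a m ef h = Num.sqrt n * D by rewrite /D mulrC divfK// gt_eqF.
have Z0 : Z <= 0 by rewrite ge_min lexx.
have DB : `|D| <= B0.
  rewrite /D normrM [`|_^-1|]ger0_norm ?invr_ge0 ?(ltW s0)// ler_pdivrMr//.
  by case: reg0.
have ZB : `|Z| <= B0 / Vt.
  apply: (@le_trans _ _ `|D / Vt|).
    rewrite /Z; have [_|d0] := leP 0 (D / Vt); first by rewrite normr0.
    by [].
  by rewrite normrM [`|_^-1|]ger0_norm ?invr_ge0 ?(ltW Vt0)// ler_wpM2r// invr_ge0 ltW.
have Y0 : Y <= 0.
  by rewrite mulr_ge0_le0 ?(ltW s0)// subr_le0; case: tth => _ /andP[].
pose x := th.1 - a + K * (th.2 - 1).
pose z := Z / Num.sqrt n.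
have zE : Z = Num.sqrt n * z by rewrite /z mulrC divfK// gt_eqF.
(* The point with the same [x] as [th] and with [z] as second coordinate. *)
pose th' := (a + (x - K * z), 1 + z).
have uB' : Num.sqrt n * dist_true th' <= B2.
  have xle : `|x| <= (2 + `|K|) * dist_true th.
    by apply: le_trans (score_coord_le th); rewrite lerDl.
  have d' : dist_true th' <= (2 + `|K|) * dist_true th + (1 + `|K|) * `|z|.
    rewrite /dist_true /= (_ : a + _ - a = x - K * z); last by ring.
    rewrite (_ : 1 + z - 1 = z); last by ring.
    have : `|x - K * z| <= `|x| + `|K| * `|z| by apply: (le_trans (ler_normB _ _)); rewrite normrM.
    rewrite (_ : (1 + `|K|) * `|z| = `|K| * `|z| + `|z|); last by ring.
    by move=> le; rewrite [leRHS]addrA lerD2r; apply: (le_trans le); rewrite lerD2r.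
  apply: (le_trans (ler_wpM2l (ltW s0) d')); rewrite mulrDr /B2; apply: lerD.
    by rewrite mulrCA; apply: ler_wpM2l => //; exact: addr_ge0.
  rewrite mulrCA; apply: ler_wpM2l => //; apply: le_trans ZB.
  by rewrite [in leRHS]zE [leRHS]normrM [X in _ <= X * _]ger0_norm ?(ltW s0).
have th'2 : th'.2 <= 1 by rewrite /= gerDl; rewrite -(pmulr_rle0 _ s0) -zE.
have tth' := inside _ uB' th'2.
have uB2 : Num.sqrt n * dist_true th <= B2 by apply: (le_trans uB); lra.
have E1 := loc B0 m h th mN1 vh reg1 tth uB2 x _ erefl erefl.
have x'E : x = th'.1 - a + K * (th'.2 - 1) by rewrite /th' /=; ring.
have z'E : z = th'.2 - 1 by rewrite /th' /=; ring.
have E2 := loc B0 m h th' mN1 vh reg1 tth' uB' x z x'E z'E.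
have mx' := tmax _ tth'.
have Q : Vt / 2 * (Y - Z) ^+ 2 <= 2 * z'.
  apply: (le_trans (@quad_max D Y Z Y0 erefl)).
  have F t : x * mart a m w h + t * mart a m ef h - n / 2 * (x ^+ 2 * V1 + t ^+ 2 * Vt) =
      (Num.sqrt n * t * D - Vt / 2 * (Num.sqrt n * t) ^+ 2) +
      (x * mart a m w h - n / 2 * x ^+ 2 * V1).
    by rewrite DE exprMn sqr_sqrtr ?(ltW n0)//; ring.
  move: E1 E2; rewrite !F -zE -/Y; move: mx'.
  set X := _ - n / 2 * _ * _; set L1 := ell _ _ _; set L2 := ell _ _ _.
  set Q1 := Z * D - _; set Q2 := Y * D - _; exact: two_approx.
rewrite -/Z -/Y -(ler_pXn2r (n := 2))// ?nnegrE// ?(ltW z0)// real_normK ?num_real//.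
have Vt2 : 0 < Vt / 2 by rewrite divr_gt0.
by rewrite -(ler_pM2l Vt2); apply: (le_trans Q); rewrite /z' le_eqVlt; apply/orP; left; apply/eqP; field.
Qed.

End estimation.

(** * Probability of the regular event and the limit law of the score *)

Section regularity.
Variables (R : realType) (eps a : R).
Hypotheses (eps0 : 0 < eps) (aeps : -1 + eps < a < eps^-1).
Implicit Types (h : nat -> nat) (s m k : nat).

Let a1 : -1 < a := alpha_gtN1 eps0 aeps.
Let p := pa_kernel a.
Let tp : transition p := pa_transition a1.

Definition mean_null (Y : nat -> (nat -> nat) -> R) := forall e : R, 0 < e ->
  exists N, forall m, (N <= m)%N -> Ex p m (Y m) <= e * m.+1%:R.

Lemma mean_null_sum (Y : nat -> (nat -> nat) -> R) :
  (forall s, adapted s (Y s)) -> cesaro_null (fun s => Ex p s (Y s)) ->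
  mean_null (fun m h => \sum_(s < m) Y s h).
Proof.
move=> aY cY e /cY[N HN]; exists N => m /HN; rewrite (Ex_sum tp).
apply: le_trans; rewrite le_eqVlt; apply/orP; left; apply/eqP.
apply: eq_bigr => s _; apply: (Ex_leq tp); last exact: aY.
exact: ltnW.
Qed.

Lemma point_err_null : mean_null (fun m h => \sum_(s < m) point_err a s h).
Proof.
apply: mean_null_sum => [s h h' hh|].
  by apply: eq_bigr => k _; rewrite (@cmean_adapted _ a s _ h h').
have : cesaro_null (fun s => \sum_(k <- index_iota 1 5 | (0 < k)%N)
    Ex p s (fun h => `|cmean a s (fun d => (d == k)%:R) h - ulim a k|)).
  by apply: cesaro_null_sum => k k0; exact: cmean_point.
apply: cesaro_null_le => s; rewrite /point_err (Ex_sum tp) big_nat_cond [leRHS]big_seq_cond.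
rewrite le_eqVlt; apply/orP; left; apply/eqP; apply: eq_bigl => k.
by rewrite mem_index_iota; case: k.
Qed.

Lemma cvar_dev_null phi : log_dominated phi -> mean_null (fun m => cvar_dev a m phi).
Proof.
move=> [C H] e e0; have e2 : 0 < e / 2 by rewrite divr_gt0.
have ac s : adapted s (fun h => `|cvar a s phi h - qvar a phi|).
  move=> h h' hh; rewrite /cvar (@cmean_adapted _ a s phi h h')//.
  by rewrite (@cmean_adapted _ a s (fun k => phi k ^+ 2) h h').
have [N HN] := mean_null_sum ac (cvar_avg a1 H) e2.
pose M := Num.truncn (`|qvar a phi| / (e / 2)).
exists (maxn N M) => m; rewrite geq_max => /andP[/HN Nm Mm].
apply: (@le_trans _ _ (Ex p m (fun h => \sum_(s < m) `|cvar a s phi h - qvar a phi| + `|qvar a phi|))).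
  apply: (Ex_le tp) => h vh; rewrite /cvar_dev -natr1 mulrDl mul1r opprD addrA.
  apply: (le_trans (ler_normB _ _)); rewrite lerD2r.
  rewrite mulr_natl -[X in _ *+ X]card_ord -sumr_const -sumrB.
  exact: ler_norm_sum.
rewrite (ExD tp) (Ex_cst tp) -[leRHS](_ : e / 2 * m.+1%:R + e / 2 * m.+1%:R = _); last by field.
apply: lerD => //; rewrite -ler_pdivrMl// mulrC; apply/ltW.
by apply: lt_le_trans (truncnS_gt _) _; rewrite ler_nat.
Qed.

Lemma mean_null_prob Y c e : mean_null Y -> (forall m h, valid m h -> 0 <= Y m h) ->
  0 < c -> 0 < e -> exists N, forall m, (N <= m)%N ->
  Ex p m (fun h => (c * m.+1%:R < Y m h)%R%:R) <= e.
Proof.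
move=> Y0 Yge c0 e0; have [N HN] := Y0 _ (mulr_gt0 c0 e0); exists N => m Nm.
have cn : 0 < c * m.+1%:R by rewrite mulr_gt0// ltr0n.
apply: (@le_trans _ _ (Ex p m (fun h => (c * m.+1%:R <= Y m h)%R%:R))).
  by apply: (Ex_le tp) => h vh; rewrite ler_nat; case: ltP => [/ltW->|].
apply: (le_trans (Ex_markov tp cn (Yge m))).
by rewrite ler_pdivrMl// mulrAC; exact: HN.
Qed.

Lemma mart_prob phi e : log_dominated phi -> 0 < e ->
  exists2 B, 0 <= B & forall B0 m, B <= B0 ->
  Ex p m (fun h => (B0 * Num.sqrt m.+1%:R < `|mart a m phi h|)%R%:R) <= e.
Proof.
move=> [C H] e0; have [B B0 HB] := mart_sqr_le a1 H.
exists (Num.sqrt (B / e) + 1) => [|B1 m BB1]; first by rewrite addr_ge0 ?sqrtr_ge0.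
have B10 : 0 < B1 by apply: lt_le_trans BB1; rewrite ltr_wpDl ?sqrtr_ge0.
have n0 : 0 < m.+1%:R :> R by rewrite ltr0n.
have c0 : 0 < B1 ^+ 2 * m.+1%:R by rewrite mulr_gt0// exprn_gt0.
apply: (@le_trans _ _ (Ex p m (fun h => (B1 ^+ 2 * m.+1%:R <= mart a m phi h ^+ 2)%R%:R))).
  apply: (Ex_le tp) => h vh; rewrite ler_nat; case: ltP => // lt; rewrite lt0b.
  rewrite -[X in _ * X](sqr_sqrtr (ltW n0)) -exprMn -(real_normK (num_real (mart a m phi h))).
  by rewrite ler_pXn2r ?nnegrE ?mulr_ge0 ?sqrtr_ge0 ?(ltW B10)// ltW.
apply: (le_trans (Ex_markov tp c0 _)) => [h _|]; first exact: sqr_ge0.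
rewrite ler_pdivrMl//; apply: (le_trans (HB m)); rewrite mulrAC ler_wpM2r ?(ltW n0)//.
rewrite mulrC -ler_pdivrMl// mulrC -[leLHS](sqr_sqrtr (divr_ge0 B0 (ltW e0))).
rewrite ler_pXn2r ?nnegrE ?sqrtr_ge0 ?(ltW B10)//.
by apply: le_trans BB1; rewrite lerDl.
Qed.

Lemma has_indicator (s : seq bool) : (~~ all id s)%:R <= \sum_(b <- s) (~~ b)%:R :> R.
Proof.
elim: s => [|b s IH]; first by rewrite big_nil.
rewrite big_cons /= negb_and; case: b => /=; first by rewrite add0r.
by rewrite lerDl sumr_ge0.
Qed.

Lemma regular_prob e : 0 < e -> exists2 B0, 0 <= B0 & forall eta, 0 < eta ->
  exists N, forall m, (N <= m)%N -> Ex p m (fun h => (~~ `[< regular a B0 eta m h >])%:R) <= e.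
Proof.
(* A union bound over the seven conditions of [regular]. *)
move=> e0; have e7 : 0 < e / 7 by rewrite divr_gt0.
have d1 := score1_dominated eps0 aeps; have d2 := eff_score_dominated eps0 aeps.
have d3 := log_dominated_lin 1 1 d1 d2.
have [B1 B10 HB1] := mart_prob d1 e7; have [B2 B20 HB2] := mart_prob d2 e7.
exists (Num.max B1 B2) => [|eta eta0]; first by rewrite le_max B10.
set B0 := Num.max B1 B2.
have a2 : 0 < 2 + a by have := a1; lra.
have u40 : 0 < ulim a 4 / 4 by rewrite divr_gt0// (vprod_gt0 a1 a2).
have [N1 H1] := mean_null_prob (fun e => @count_mart_avg _ a a1 e) (fun m h _ => sumr_ge0 _ (fun k _ => normr_ge0 _)) eta0 e7.
have pe0 m h : valid m h -> 0 <= \sum_(s < m) point_err a s h.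
  by move=> _; apply: sumr_ge0 => s _; exact: sumr_ge0.
have [N2 H2] := mean_null_prob point_err_null pe0 u40 e7.
have [N3 H3] := mean_null_prob (cvar_dev_null d1) (fun m h _ => normr_ge0 _) eta0 e7.
have [N4 H4] := mean_null_prob (cvar_dev_null d2) (fun m h _ => normr_ge0 _) eta0 e7.
have [N5 H5] := mean_null_prob (cvar_dev_null d3) (fun m h _ => normr_ge0 _) eta0 e7.
exists (maxn N1 (maxn N2 (maxn N3 (maxn N4 N5)))) => m.
rewrite !geq_max => /and5P[m1 m2 m3 m4 m5]; set n : R := m.+1%:R.
pose bs h : seq bool := [:: `|mart a m (score1 a) h| <= B0 * Num.sqrt n;
  `|mart a m (eff_score a) h| <= B0 * Num.sqrt n; count_mart a m h <= eta * n;
  \sum_(s < m) point_err a s h <= ulim a 4 / 4 * n; cvar_dev a m (score1 a) h <= eta * n;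
  cvar_dev a m (eff_score a) h <= eta * n;
  cvar_dev a m (fun k => 1 * score1 a k + 1 * eff_score a k) h <= eta * n].
apply: (@le_trans _ _ (Ex p m (fun h => \sum_(b <- bs h) (~~ b)%:R))).
  apply: (Ex_le tp) => h vh; apply: le_trans (has_indicator _).
  rewrite ler_nat; case: asboolP => // nreg; rewrite lt0b.
  apply/negP; rewrite /bs /= => /and5P[r1 r2 r3 r4 /and4P[r5 r6 r7 _]].
  by apply: nreg; split.
rewrite (@Ex_eq _ p tp m _ (fun h : nat -> nat => (B0 * Num.sqrt n < `|mart a m (score1 a) h|)%R%:R +
  ((B0 * Num.sqrt n < `|mart a m (eff_score a) h|)%R%:R + ((eta * n < count_mart a m h)%R%:R +
  ((ulim a 4 / 4 * n < \sum_(s < m) point_err a s h)%R%:R +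
  ((eta * n < cvar_dev a m (score1 a) h)%R%:R + ((eta * n < cvar_dev a m (eff_score a) h)%R%:R +
   (eta * n < cvar_dev a m (fun k => 1 * score1 a k + 1 * eff_score a k) h)%R%:R))))) : R)); last first.
  by move=> h _; rewrite /bs !big_cons big_nil addr0 !ltNge.
rewrite !(ExD tp).
have -> : e = e / 7 + (e / 7 + (e / 7 + (e / 7 + (e / 7 + (e / 7 + e / 7))))) by field.
apply: lerD; first by apply: HB1; rewrite le_max lexx.
apply: lerD; first by apply: HB2; rewrite le_max lexx orbT.
apply: lerD; first exact: H1.
apply: lerD; first exact: H2.
apply: lerD; first exact: H3.
by apply: lerD; [exact: H4|exact: H5].
Qed.

(** Degrees at time [n] are at most [n], so the normalized increments are [O(log n / sqrt n)] and
    need no truncation. *)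
Lemma mart_clt phi : log_dominated phi -> 0 < qvar a phi -> forall y,
  Ex p m (fun h => (mart a m phi h / Num.sqrt (m.+1%:R * qvar a phi) <= y)%R%:R) @[m --> \oo] -->
  gcdf y.
Proof.
move=> ld V0 y; have [C C0 H] := log_dominated_ge0 ld.
set V := qvar a phi in V0 *.
pose c (m : nat) : R := (Num.sqrt (m.+1%:R * V))^-1.
have nV (m : nat) : 0 < m.+1%:R * V by rewrite mulr_gt0// ltr0n.
have c0 m : 0 < c m by rewrite invr_gt0 sqrtr_gt0.
have c2 m : c m ^+ 2 = (m.+1%:R * V)^-1 by rewrite exprVn sqr_sqrtr// ltW.
pose xi n s h := c n * (phi (chosen s h) - cmean a s phi h).
pose v n s h := c n ^+ 2 * cvar a s phi h.
have xiE n h : mart a n phi h / Num.sqrt (n.+1%:R * V) = \sum_(s < n) xi n s h.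
  by rewrite -mulr_sumr mulrC.
rewrite (_ : (fun m => _) = (fun n => Ex p n (fun h => (\sum_(s < n) xi n s h <= y)%R%:R))); last first.
  by apply/funext => n; congr (Ex p n _); apply/funext => h; rewrite xiE.
apply: (@martingale_clt R p tp xi v (fun n => 2 * C * (lw R n.+1 * c n))).
- by move=> n s h h' hh; rewrite /xi (mart_adapted a phi hh).
- move=> n s h h' hh; rewrite /v /cvar (@cmean_adapted _ a s phi h h')//.
  by rewrite (@cmean_adapted _ a s (fun k => phi k ^+ 2) h h').
- move=> n s h _ vh; rewrite /xi stepZ.
  by rewrite (mart_step a1)// mulr0.
- move=> n s h _ vh; rewrite /v -(mart_step_sqr a1)// -stepZ.
  by apply: eq_bigr => i _; rewrite /xi exprMn.
- move=> n s h sn vh; rewrite /xi normrM [`|c n|]ger0_norm ?(ltW (c0 n))//.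
  rewrite (_ : 2 * C * (lw R n.+1 * c n) = c n * (2 * (C * lw R n.+1))); last by ring.
  apply: ler_wpM2l; first exact: ltW.
  have phib k : (0 < k <= s.+1)%N -> `|phi k| <= C * lw R n.+1.
    move=> /andP[k0 ks]; apply: (le_trans (H k k0)); rewrite ler_wpM2l//.
    by rewrite /lw lerD2l ler_ln ?posrE ?ltr0n// ler_nat ltnS (leq_trans ks)// ltnS ltnW.
  rewrite mulr_natl mulr2n; apply: (le_trans (ler_normB _ _)); apply: lerD.
    by apply: phib; rewrite dg_gt0 dg_le.
  by apply: (cmean_abs_le a1) => //; exact: valid_leq vh.
- apply/cvgrPdist_le => e e0.
  have e' : 0 < e * Num.sqrt V / (2 * C + 1).
    by rewrite divr_gt0 ?mulr_gt0 ?sqrtr_gt0// ltr_wpDl// mulr_ge0.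
  have [N HN] := lw_sqrt_small e'; exists N => // m /= /HN le.
  have lw0 : 0 <= lw R m.+1 by apply: le_trans ler01 (lw_ge1 _ _).
  rewrite sub0r normrN ger0_norm; last by rewrite !mulr_ge0// ltW.
  rewrite /c mulrA ler_pdivrMr ?sqrtr_gt0// sqrtrM//.
  apply: (le_trans (ler_wpM2l (mulr_ge0 (ler0n _ 2) C0) le)).
  have -> : 2 * C * (e * Num.sqrt V / (2 * C + 1) * Num.sqrt m.+1%:R) =
      (2 * C / (2 * C + 1)) * (e * (Num.sqrt m.+1%:R * Num.sqrt V)) by ring.
  rewrite ler_piMl ?mulr_ge0 ?sqrtr_ge0 ?(ltW e0)// ler_pdivrMr ?ltr_wpDl ?mulr_ge0//.
  by rewrite mul1r lerDl.
move=> e e0; apply/cvgrPdist_le => e' e'0.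
have [N HN] := mean_null_prob (cvar_dev_null ld) (fun m h _ => normr_ge0 _)
  (mulr_gt0 (divr_gt0 e0 (ltr0n R 2)) V0) e'0.
exists N => // m /= /HN le; rewrite sub0r normrN ger0_norm; last by apply: (Ex_ge0 tp).
apply: le_trans le; apply: (Ex_le tp) => h vh; rewrite ler_nat.
case: (leP e) => // le; rewrite lt0b.
have eE : \sum_(s < m) v m s h - 1 = (\sum_(s < m) cvar a s phi h - m.+1%:R * V) / (m.+1%:R * V).
  by rewrite -mulr_sumr c2; field; rewrite !gt_eqF// ltr0n.
move: le; rewrite eE normrM -/(cvar_dev a m phi h) [`|_^-1|]ger0_norm ?invr_ge0 ?(ltW (nV _))//.
rewrite ler_pdivlMr// => /(lt_le_trans _); apply.
have : 0 < e * (m.+1%:R * V) by exact: mulr_gt0.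
by lra.
Qed.

End regularity.

(** * Identification of the matrix V *)

Section limit_matrix.
Variables (R : realType) (a : R).
Hypothesis a1 : -1 < a.
Implicit Types (k : nat) (lam : R).

Let a2 : 0 < 2 + a. Proof. by have := a1; lra. Qed.

Let ka k : (0 < k)%N -> 0 < k%:R + a.
Proof. exact: deg_weight_gt0. Qed.

Lemma pa_fun1 k : (0 < k)%N -> pa_fun a 1 k = k%:R + a.
Proof. by move=> k0; rewrite /pa_fun powRr1// ltW// ka. Qed.

Lemma pa_prod lam n : \prod_(1 <= k < n.+1) (pa_fun a 1 k / (lam + pa_fun a 1 k)) = vprod a lam n.
Proof.
by apply: eq_big_nat => k /andP[k0 _]; rewrite pa_fun1// [lam + _]addrC.
Qed.

(** [2 + a] is a solution because the limiting probabilities [ulim a k] of the chosen degree add up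
    to 1, by [qmean_cst]. It is the only one because the partial sums decrease in [lam] by at least
    the gap between their first terms, which survives in the limit. *)
Lemma lambda_star_affine : lambda_star (pa_fun a 1) = 2 + a.
Proof.
pose u lam n : R := \sum_(1 <= l < n.+1) vprod a lam l.
have uE lam : (fun n => \sum_(1 <= l < n.+1) \prod_(1 <= k < l.+1)
    (pa_fun a 1 k / (lam + pa_fun a 1 k))) = u lam.
  by apply/funext => n; apply: eq_bigr => l _; exact: pa_prod.
have mono lam lam' n : 0 < lam -> lam < lam' ->
    u lam' n.+1 + (vprod a lam 1 - vprod a lam' 1) <= u lam n.+1.
  move=> l0 ll; have l'0 : 0 < lam' by exact: lt_trans ll.
  have n2 : (1 < n.+2)%N by [].
  rewrite /u !(big_ltn n2).
  set A := \sum_(_ <= _ < _) _; set B := \sum_(_ <= _ < _) _.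
  suff : A <= B by lra.
  apply: ler_sum => l _; rewrite /vprod !big_nat; apply: ler_prod => j /andP[j0 _].
  have kj : 0 < j%:R + a by exact: ka.
  have k1 : 0 < j%:R + a + lam by exact: addr_gt0.
  have k2 : 0 < j%:R + a + lam' by exact: addr_gt0.
  apply/andP; split; first by rewrite divr_ge0// ltW.
  by rewrite ler_wpM2l ?(ltW kj)// lef_pV2 ?posrE// lerD2l ltW.
have v1 lam lam' : 0 < lam -> lam < lam' -> vprod a lam' 1 < vprod a lam 1.
  move=> l0 ll; have l'0 : 0 < lam' by exact: lt_trans ll.
  have k1 : 0 < 1%:R + a by exact: ka.
  have k2 : 0 < 1%:R + a + lam by exact: addr_gt0.
  have k3 : 0 < 1%:R + a + lam' by exact: addr_gt0.
  by rewrite /vprod !big_nat1 ltr_pM2l// ltf_pV2 ?posrE// ltrD2l.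
have uncvg lam lam' : 0 < lam -> lam < lam' -> u lam @ \oo --> (1 : R) -> u lam' @ \oo --> (1 : R) -> False.
  move=> l0 ll c1 c2; pose del := vprod a lam 1 - vprod a lam' 1.
  have del0 : 0 < del by rewrite subr_gt0 v1.
  have {}c1 : (fun n => u lam n.+1) @ \oo --> (1 : R) by rewrite (cvg_shiftS (u lam)).
  have {}c2 : (fun n => u lam' n.+1 + del) @ \oo --> (1 + del : R).
    by apply: cvgD; [rewrite (cvg_shiftS (u lam'))|exact: cvg_cst].
  have : 1 + del <= 1.
    rewrite -[leLHS](cvg_lim _ c2)// -[leRHS](cvg_lim _ c1)//; apply: ler_lim.
    - by apply/cvg_ex; eexists; exact: c2.
    - by apply/cvg_ex; eexists; exact: c1.
    by near=> n; exact: mono.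
  by lra.
have c0 : u (2 + a) @ \oo --> (1 : R).
  have [C H] := log_dominated2 (@log_dominated_cst R 1); have [B HB] := ulim_dominated a1 H.
  have s0 : 0 < (1 + a) / 2 by have := a1; lra.
  have := pos_series_cvg s0 HB; rewrite -/(qmean a (fun=> 1)) (qmean_cst a1).
  by under eq_fun do under eq_bigr do rewrite mulr1.
apply: xget_unique => [|lam [lam0]]; first by rewrite /= uE.
rewrite uE => c1; apply/eqP; case: ltgtP => // ll; exfalso.
  exact: (uncvg _ _ lam0 ll).
exact: (uncvg _ _ a2 ll).
Unshelve. all: by end_near.
Qed.

(** Biasing the limiting degree law by the weight gives, up to the total mass [2 + a], the limit law
    of the chosen degree. *)
Lemma limit_deg_weight k : (0 < k)%N ->
  limit_deg (pa_fun a 1) k * pa_fun a 1 k = (2 + a) * ulim a k.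
Proof.
case: k => // k _; rewrite /limit_deg lambda_star_affine /ulim -pa_prod [in RHS]big_nat_recr//=.
by ring.
Qed.

Lemma limit_sum phi : log2_dominated phi ->
  pos_series (fun k => limit_deg (pa_fun a 1) k * pa_fun a 1 k * phi k) = (2 + a) * qmean a phi.
Proof.
move=> d; rewrite -[RHS]addr0 -(mul0r (qmean a phi)) -(qmean_lin a1 _ _ d d).
by apply: eq_pos_series => k k0; rewrite limit_deg_weight//; ring.
Qed.

End limit_matrix.

Section inverse_entry.
Variable R : realType.

Lemma invmx2_entry (x y z : R) : x * z - y ^+ 2 != 0 ->
  invmx (\matrix_(i < 2, j < 2)
    (if i == 0 then if j == 0 then x else y else if j == 0 then y else z)) 1 1 =
  x / (x * z - y ^+ 2).
Proof.
move=> D0; set M := \matrix_(i, j) _; set D := x * z - y ^+ 2 in D0 *.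
pose W : 'M[R]_2 := \matrix_(i < 2, j < 2)
  (if i == 0 then if j == 0 then z / D else - y / D else if j == 0 then - y / D else x / D).
have MW : M *m W = 1%:M.
  apply/matrixP => i j; rewrite !mxE !big_ord_recl big_ord0 !mxE /=.
  case: i => [[|[|//]] i2]; case: j => [[|[|//]] j2]; rewrite ?mxE /= /eq_op /=.
  - by rewrite mulr1n; have : D != 0 by []; rewrite /D => ?; field.
  - by rewrite mulr0n; have : D != 0 by []; rewrite /D => ?; field.
  - by rewrite mulr0n; have : D != 0 by []; rewrite /D => ?; field.
  - by rewrite mulr1n; have : D != 0 by []; rewrite /D => ?; field.
have [uM _] := mulmx1_unit MW.
by rewrite -[invmx M]mulmx1 -MW mulKmx// mxE.
Qed.

End inverse_entry.

Section test_statistic.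
Variables (R : realType) (eps a : R).
Hypotheses (eps0 : 0 < eps) (aeps : -1 + eps < a < eps^-1).

Let a1 : -1 < a := alpha_gtN1 eps0 aeps.
Let a2 : 0 < 2 + a. Proof. by have := a1; lra. Qed.

Lemma V_matrix_entry : invmx (V_matrix a 1) 1 1 = (eff_info a)^-1.
Proof.
have d1 := score1_dominated eps0 aeps; have d2 := score2_dominated eps0 aeps.
have q1 := info1_gt0 eps0 aeps; have vt := eff_info_gt0 eps0 aeps.
set x := qvar a (score1 a) in q1; set y := qcov a (score1 a) (score2 a); set z := qvar a (score2 a).
have vtE : eff_info a = (x * z - y ^+ 2) / x.
  by rewrite (eff_infoE eps0 aeps) -/x -/y -/z; field; rewrite gt_eqF.
have D0 : x * z - y ^+ 2 != 0.
  by apply/eqP => D0; move: vt; rewrite vtE D0 mul0r ltxx.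
(* Each series is [2 + a] times a [qmean]; the factors cancel against [1 / a^2], and the limiting
   covariances of the scores remain. *)
have -> : V_matrix a 1 = \matrix_(i < 2, j < 2)
    (if i == 0 then if j == 0 then x else y else if j == 0 then y else z).
  have S phi psi : log2_dominated phi -> (forall k, (0 < k)%N -> phi k = psi k) ->
      pos_series (fun k => limit_deg (pa_fun a 1) k * pa_fun a 1 k * psi k) = (2 + a) * qmean a phi.
    move=> d e; rewrite -(limit_sum a1 d); apply: eq_pos_series => k k0.
    by rewrite e.
  rewrite /V_matrix (S (fun=> 1) (fun=> 1) (log_dominated2 (log_dominated_cst 1)))// (qmean_cst a1).
  rewrite (S (fun k => score1 a k * score1 a k) _ (log2_dominatedM d1 d1)); last first.
    by move=> k _; rewrite /score1 expr1n mul1r -expr2 exprVn.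
  rewrite (S (score1 a) _ (log_dominated2 d1)); last by move=> k _; rewrite mul1r.
  rewrite (S (fun k => score1 a k * score2 a k) _ (log2_dominatedM d1 d2)); last first.
    by move=> k _; rewrite mul1r.
  rewrite (S (score2 a) _ (log_dominated2 d2))//.
  rewrite (S (fun k => score2 a k * score2 a k) _ (log2_dominatedM d2 d2)); last first.
    by move=> k _; rewrite -expr2.
  apply/matrixP => i j; rewrite !mxE /x /y /z !qvarE /qcov.
  by case: ifP => _; case: ifP => _; field; rewrite gt_eqF.
rewrite invmx2_entry// vtE; field; rewrite D0 gt_eqF//.
Qed.

Lemma test_statE n be :
  test_stat n a be = Num.sqrt n%:R * (be - 1) * Num.sqrt (eff_info a).
Proof.
rewrite /test_stat V_matrix_entry sqrtrV ?invrK//.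
exact/ltW/(eff_info_gt0 eps0 aeps).
Qed.

End test_statistic.

(** * Continuity of the information in alpha *)

Section continuity.
Variables (R : realType) (eps : R).
Hypothesis eps0 : 0 < eps.

Lemma pos_series_continuous (F : R -> nat -> R) (l r C s a : R) : 0 < s -> l < a < r ->
  (forall al k, l < al < r -> (0 < k)%N -> `|F al k| <= C * k.+1%:R `^ (- (1 + s))) ->
  (forall k, (0 < k)%N -> {for a, continuous (F ^~ k)}) ->
  {for a, continuous (fun al => pos_series (F al))}.
Proof.
move=> s0 alr FC Fc; apply/cvgrPdist_le => e e0; have e3 : 0 < e / 3 by rewrite divr_gt0.
have [K K0 T] := @powR_tail_small R s C (e / 3) s0 e3.
have tl al : l < al < r -> `|pos_series (F al) - \sum_(1 <= k < K) F al k| <= e / 3.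
  by move=> lr; apply: (pos_series_tail s0 (fun k => FC al k lr)).
have cs : (fun al => \sum_(1 <= k < K) F al k) @ a --> \sum_(1 <= k < K) F a k.
  rewrite big_add1; under eq_fun do rewrite big_add1.
  by apply: cvg_sumr => k; exact: Fc.
have ta := tl a alr.
near=> al.
have lr : l < al < r.
  near: al; apply: (@open_nbhs_nbhs _ a `]l, r[%classic); split; last by rewrite /= in_itv.
  exact: interval_open.
have tb := tl al lr.
have : `|\sum_(1 <= k < K) F a k - \sum_(1 <= k < K) F al k| <= e / 3.
  by near: al; move/cvgrPdist_le : cs; apply.
move: ta tb; rewrite !ler_norml => /andP[? ?] /andP[? ?] /andP[? ?].
by apply/andP; split; lra.
Unshelve. all: by end_near.
Qed.

Lemma vprod_continuous (a : R) k : -1 < a -> {for a, continuous (fun al => ulim al k)}.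
Proof.
move=> a1; elim: k => [|k IH].
  rewrite /prop_for /continuous_at /ulim; under eq_fun do rewrite vprod0.
  by rewrite vprod0; exact: cvg_cst.
rewrite /prop_for /continuous_at /ulim; under eq_fun do rewrite vprodS; rewrite vprodS.
apply: cvgM; first exact: IH.
have ka := deg_weight_gt0 a1 (ltn0Sn k).
apply: cvgM; first by apply: cvgD; [exact: cvg_cst|exact: cvg_id].
apply: cvgV; first by rewrite gt_eqF// addr_gt0//; have := a1; lra.
by apply: cvgD; apply: cvgD; (exact: cvg_cst || exact: cvg_id).
Qed.

Lemma qmean_continuous (phi : R -> nat -> R) (C a : R) : -1 + eps < a < eps^-1 ->
  (forall al k, -1 + eps < al < eps^-1 -> (0 < k)%N -> `|phi al k| <= C * lw R k ^+ 2) ->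
  (forall k, (0 < k)%N -> {for a, continuous (phi ^~ k)}) ->
  {for a, continuous (fun al => qmean al (phi al))}.
Proof.
move=> aeps phiC phic; have a1 := alpha_gtN1 eps0 aeps.
(* A bound of [1 + al + rho] for [rho = 2 + al] and [al < eps^-1]. *)
pose M : R := 3 + 2 * eps^-1.
have s0 : 0 < eps / 2 by rewrite divr_gt0.
apply: (@pos_series_continuous _ (-1 + eps) eps^-1
  (C * (M `^ (1 + eps) * (1 + (eps / 4)^-1) ^+ 2)) _ _ s0 aeps) => [al k ale k0|k k0].
  have al1 := alpha_gtN1 eps0 ale; have al2 : 0 < 2 + al by lra.
  have C0 : 0 <= C.
    have := le_trans (normr_ge0 _) (phiC al k ale k0); rewrite pmulr_lge0// exprn_gt0//.
    exact: lt_le_trans (lw_ge1 _ _).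
  have /andP[u0 _] := ulim_bounds al1 k.
  rewrite normrM ger0_norm// -mulrA; apply: (le_trans (ler_wpM2l u0 (phiC al k ale k0))).
  rewrite mulrCA ler_wpM2l//; case/andP: ale => l r.
  by apply: (vprod_lw al1 al2 _ eps0); rewrite /M; lra.
by apply: cvgM; [exact: vprod_continuous|exact: phic].
Qed.

(** Used twice: for the consistency of the normalization at the estimated alpha, and for the
    measurability of the statistic. *)
Lemma eff_info_continuous (a : R) : -1 + eps < a < eps^-1 ->
  {for a, continuous (@eff_info R)}.
Proof.
move=> aeps; have a1 := alpha_gtN1 eps0 aeps.
have [C C0 HC] := ln_deg_bound eps0.
pose B := eps^-1 + C; have B0 : 0 <= B by rewrite addr_ge0// invr_ge0 ltW.
have b1 al k : -1 + eps < al < eps^-1 -> (0 < k)%N -> `|score1 al k| <= B * lw R k.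
  move=> ale k0; apply: (le_trans (score1_bound eps0 ale k0)).
  by rewrite ler_wpM2r ?lerDl// (le_trans ler01 (lw_ge1 _ _)).
have b2 al k : -1 + eps < al < eps^-1 -> (0 < k)%N -> `|score2 al k| <= B * lw R k.
  move=> ale k0; apply: (le_trans (HC _ _ ale k0)).
  by rewrite ler_wpM2r ?lerDr ?invr_ge0 ?(ltW eps0)// (le_trans ler01 (lw_ge1 _ _)).
have k1 k : (0 < k)%N -> {for a, continuous (fun al => score1 al k)}.
  move=> k0; apply: cvgV; first by rewrite gt_eqF// deg_weight_gt0.
  by apply: cvgD; [exact: cvg_cst|exact: cvg_id].
have k2 k : (0 < k)%N -> {for a, continuous (fun al => score2 al k)}.
  move=> k0; have lnc : {for k%:R + a, continuous (@ln R)}.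
    by apply: continuous_ln; exact: deg_weight_gt0.
  apply: (@cvg_comp _ _ _ (fun al : R => k%:R + al) (@ln R) _ _ _ _ lnc).
  by apply: cvgD; [exact: cvg_cst|exact: cvg_id].
have m1 (phi : R -> nat -> R) : (forall al k, -1 + eps < al < eps^-1 -> (0 < k)%N -> `|phi al k| <= B * lw R k) ->
    (forall k, (0 < k)%N -> {for a, continuous (phi ^~ k)}) ->
    {for a, continuous (fun al => qmean al (phi al))}.
  move=> b c; apply: (@qmean_continuous _ B) => // al k ale k0.
  apply: (le_trans (b al k ale k0)); rewrite ler_wpM2l//; exact: lw_le_sqr.
have m2 (phi psi : R -> nat -> R) :
    (forall al k, -1 + eps < al < eps^-1 -> (0 < k)%N -> `|phi al k| <= B * lw R k) ->
    (forall al k, -1 + eps < al < eps^-1 -> (0 < k)%N -> `|psi al k| <= B * lw R k) ->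
    (forall k, (0 < k)%N -> {for a, continuous (phi ^~ k)}) ->
    (forall k, (0 < k)%N -> {for a, continuous (psi ^~ k)}) ->
    {for a, continuous (fun al => qcov al (phi al) (psi al))}.
  move=> b b' c c'; apply: cvgB; last by apply: cvgM; exact: m1.
  apply: (@qmean_continuous (fun al k => phi al k * psi al k) (B ^+ 2)) => // [al k ale k0|k k0].
    by rewrite normrM -exprMn expr2; apply: ler_pM; rewrite ?b ?b'.
  by apply: cvgM; [exact: c|exact: c'].
have near_eq : \forall al \near a, eff_info al = qcov al (score2 al) (score2 al) -
    qcov al (score1 al) (score2 al) ^+ 2 / qcov al (score1 al) (score1 al).
  near=> al; rewrite -!qvarE; apply: (@eff_infoE _ eps) => //.
  near: al; apply: (@open_nbhs_nbhs _ a `]-1 + eps, eps^-1[%classic); split; last by rewrite /= in_itv.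
  exact: interval_open.
rewrite /prop_for /continuous_at (nbhs_singleton near_eq).
apply: cvg_trans; first by apply: near_eq_cvg; apply: filterS near_eq => al ->.
have q0 : qcov a (score1 a) (score1 a) != 0 by rewrite -qvarE gt_eqF// (info1_gt0 eps0 aeps).
apply: cvgB; first exact: m2.
apply: cvgM; last by apply: cvgV => //; exact: m2.
by rewrite expr2; under eq_fun do rewrite expr2; apply: cvgM; exact: m2.
Unshelve. all: by end_near.
Qed.

End continuity.

(** * Transfer from histories to the probability space *)

Section histories.
Variables (R : realType) (p : (nat -> nat) -> nat -> nat -> R).
Hypothesis tp : transition p.
Implicit Types (m s t i : nat) (h : nat -> nat).

Fixpoint histories m : seq (nat -> nat) :=
  if m is m'.+1 then [seq upd h m i | h <- histories m', i <- index_iota 1 m.+1]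
  else [:: fun=> 0%N].

Definition path_weight m h : R := \prod_(s < m) p h s (h s.+1).

Lemma path_weight_adapted m : adapted m (path_weight m).
Proof.
move=> h h' hh; apply: eq_bigr => s _; rewrite hh ?ltn_ord//.
case: tp => _ _ pa; apply: pa => t /andP[t0 ts]; apply: hh.
by rewrite t0 (leq_trans ts)// ltnW.
Qed.

Lemma path_weight_upd m h i : path_weight m.+1 (upd h m.+1 i) = path_weight m h * p h m i.
Proof.
rewrite /path_weight big_ord_recr /= -/(path_weight m _).
rewrite (adapted_upd h i (@path_weight_adapted m)).
by case: tp => _ _ pa; rewrite (adapted_upd h i (pa m _)) /upd eqxx.
Qed.

Lemma historiesS m :
  histories m.+1 = [seq upd h m.+1 i | h <- histories m, i <- index_iota 1 m.+2].
Proof. by []. Qed.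

Lemma Ex_histories m phi : Ex p m phi = \sum_(h <- histories m) path_weight m h * phi h.
Proof.
elim: m phi => [|m IH] phi; first by rewrite /= big_seq1 /path_weight big_ord0 mul1r.
rewrite [LHS]/= IH historiesS big_allpairs_dep; apply: eq_bigr => h _.
by rewrite /step mulr_sumr; apply: eq_bigr => i _; rewrite path_weight_upd mulrA.
Qed.

Lemma histories_valid m h : h \in histories m -> valid m h.
Proof.
elim: m h => [|m IH] h; first by move=> _ t; case: t.
rewrite historiesS => /allpairsP[[h' i] /= [/IH vh' ii ->]].
by apply: valid_upd => //; rewrite mem_index_iota in ii.
Qed.

Lemma histories_complete m h : valid m h ->
  exists2 h', h' \in histories m & forall t, (0 < t <= m)%N -> h t = h' t.
Proof.
elim: m => [|m IH] vh; first by exists (fun=> 0%N) => [|t]; [rewrite inE|case: t].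
have [h' hin hh'] := IH (valid_leq (leqnSn m) vh).
exists (upd h' m.+1 (h m.+1)) => [|t /andP[t0 tm]]; last first.
  rewrite /upd; case: eqP => [->//|/eqP tm']; apply: hh'.
  by rewrite t0 /= -ltnS ltn_neqAle tm'.
rewrite historiesS; apply: (@allpairs_f _ _ _ (fun h i => upd h m.+1 i)) => //.
by rewrite mem_index_iota; apply: vh; rewrite leqnn.
Qed.

End histories.

Section transfer.
Variables (R : realType) (d : measure_display) (Omega : measurableType d).
Variables (P : probability Omega R) (a : R) (c : nat -> {RV P >-> nat}).
Hypotheses (a1 : -1 < a) (PA : is_PA_tree (pa_fun a 1) c).
Implicit Types (m k t i : nat) (h : nat -> nat) (w : Omega).

Let p := pa_kernel a.
Let tp : transition p := pa_transition a1.

Definition past w : nat -> nat := fun t => c t w.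

Definition cell m h := [set w | forall t, (1 <= t < m.+1)%N -> c t w = h t].

(** The last coordinate is split over all natural numbers, because validity holds only almost
    surely. *)
Lemma measurable_past m (B : (nat -> nat) -> Prop) : adapted m B ->
  measurable [set w | B (past w)].
Proof.
elim: m B => [|m IH] B aB.
  have [B0|B0] := pselect (B (fun=> 0%N)).
    rewrite (_ : [set _ | _] = setT)//; apply/seteqP; split => // w _ /=.
    by rewrite (aB _ (fun=> 0%N))// => t; case: t.
  rewrite (_ : [set _ | _] = set0)//; apply/seteqP; split => // w /=.
  by rewrite (aB _ (fun=> 0%N))// => t; case: t.
rewrite (_ : [set _ | _] = \bigcup_i ((c m.+1 @^-1` [set i]) `&`
    [set w | B (upd (past w) m.+1 i)])).
  apply: bigcup_measurable => i _; apply: measurableI.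
    by rewrite -[X in measurable X]setTI; exact: measurable_funP.
  apply: (IH (fun h => B (upd h m.+1 i))) => h h' hh; apply: aB => t /andP[t0 tm].
  by rewrite /upd; case: eqP => // /eqP tm'; apply: hh; rewrite t0 /= -ltnS ltn_neqAle tm'.
have updE w : upd (past w) m.+1 (c m.+1 w) = past w.
  by apply/funext => t; rewrite /upd; case: eqP => // ->.
apply/seteqP; split => [w /= Bw|w [i _ [/= <-]]]; last by rewrite updE.
by exists (c m.+1 w) => //; split => //=; rewrite updE.
Qed.

Lemma cell_adapted m h : adapted m (fun h' : nat -> nat => forall t, (1 <= t < m.+1)%N -> h' t = h t).
Proof.
move=> h1 h2 hh; apply/propext; split => H t tm; rewrite -H//.
  by rewrite hh.
by rewrite hh.
Qed.

Lemma measurable_cell m h : measurable (cell m h).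
Proof. exact: (measurable_past (@cell_adapted m h)). Qed.

Lemma measurable_coord m i : measurable (c m @^-1` [set i]).
Proof. by rewrite -[X in measurable X]setTI; exact: measurable_funP. Qed.

Lemma cell_choice m h i : valid m h -> (0 < i <= m.+1)%N ->
  P (cell m h `&` c m.+1 @^-1` [set i]) = ((p h m i)%:E * P (cell m h))%E.
Proof.
move=> vh im; rewrite [LHS](PA h im); congr ((_ / _)%:E * _)%E.
  exact: (pa_fun1 a1).
rewrite -(node_sum_weight a vh); apply: eq_bigr => j _.
exact: (pa_fun1 a1).
Qed.

Lemma measurable_coord_le m k : measurable [set w | (0 < c m w <= k)%N].
Proof.
rewrite (_ : [set _ | _] = c m @^-1` [set i | (0 < i <= k)%N])//.
by rewrite -[X in measurable X]setTI; exact: measurable_funP.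
Qed.

Lemma cell_choices m h k : valid m h -> (k <= m.+1)%N ->
  P (cell m h `&` [set w | (0 < c m.+1 w <= k)%N]) =
  ((\sum_(1 <= i < k.+1) p h m i)%:E * P (cell m h))%E.
Proof.
move=> vh; elim: k => [_|k IH km].
  rewrite big_geq// mul0e (_ : _ `&` _ = set0) ?measure0//.
  by apply/seteqP; split => // w [_ /=]; case: (c m.+1 w).
rewrite (_ : cell m h `&` _ = (cell m h `&` [set w | (0 < c m.+1 w <= k)%N]) `|`
    (cell m h `&` c m.+1 @^-1` [set k.+1])); last first.
  rewrite -setIUr; congr (_ `&` _); apply/seteqP; split => w /=.
    move=> /andP[c0]; rewrite leq_eqVlt ltnS => /orP[/eqP|ck]; [by right|].
    by left; rewrite c0.
  by case=> [/andP[-> ck]|->] /=; [rewrite (leq_trans ck)|rewrite leqnn].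
transitivity (P (cell m h `&` [set w | (0 < c m.+1 w <= k)%N]) +
    P (cell m h `&` c m.+1 @^-1` [set k.+1]))%E.
apply: measureU.
- by apply: measurableI; [exact: measurable_cell|exact: measurable_coord_le].
- by apply: measurableI; [exact: measurable_cell|exact: measurable_coord].
- apply/seteqP; split => // w [[_ /= /andP[_ ck]] [_ /= ck1]].
  by rewrite ck1 ltnn in ck.
rewrite IH; last exact: ltnW.
have k1 : (0 < k.+1 <= m.+1)%N by [].
have p0 i : (0 < i <= m.+1)%N -> 0 <= p h m i by case: tp => p0 _ _; exact: p0.
rewrite (cell_choice vh k1) [in RHS]big_nat_recr//= EFinD ge0_muleDl// lee_fin; last exact: p0.
rewrite big_nat_cond sumr_ge0// => i /andP[/andP[i0 ik] _]; apply: p0.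
by rewrite i0 /= ltnW// (leq_trans ik)// ltnS ltnW.
Qed.

Lemma probability_cell m h : valid m h -> P (cell m h) = (path_weight p m h)%:E.
Proof.
elim: m => [|m IH] vh.
  rewrite /path_weight big_ord0 (_ : cell 0 h = setT) ?probability_setT//.
  by apply/seteqP; split => // w _ [|t].
have vm : valid m h by exact: valid_leq vh.
have hm : (0 < h m.+1 <= m.+1)%N by apply: vh; rewrite leqnn.
rewrite (_ : cell m.+1 h = cell m h `&` c m.+1 @^-1` [set h m.+1]).
  by rewrite cell_choice// IH// -EFinM mulrC /path_weight big_ord_recr.
apply/seteqP; split => [w H|w [H /= E] t]; first split => [t /andP[t0 tm]|].
- by apply: H; rewrite t0 (leq_trans tm).
- by apply: H; rewrite /= ltnSn.
move=> /andP[t0]; rewrite ltnS leq_eqVlt => /orP[/eqP->//|tm].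
by apply: H; rewrite t0.
Qed.

Lemma probability_union_le (T : eqType) (s : seq T) (F : T -> set Omega) :
  (forall x, measurable (F x)) ->
  measurable [set w | exists2 x, x \in s & F x w] /\
  (P [set w | exists2 x, x \in s & F x w] <= \sum_(x <- s) P (F x))%E.
Proof.
move=> mF; elim: s => [|x s [mU IH]].
  rewrite big_nil (_ : [set _ | _] = set0) ?measure0//.
  by apply/seteqP; split => // w [x].
rewrite (_ : [set _ | _] = F x `|` [set w | exists2 x, x \in s & F x w]); last first.
  apply/seteqP; split => w /=.
    by case=> y; rewrite inE => /orP[/eqP->|ys] Fy; [left|right; exists y].
  by case=> [Fx|[y ys Fy]]; [exists x; rewrite ?inE ?eqxx|exists y; rewrite ?inE ?ys ?orbT].
split; first exact: measurableU.
rewrite big_cons; apply: le_trans; first by apply: measureU2.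
by rewrite leeD2l.
Qed.

Lemma adapted_valid m : adapted m (valid m).
Proof.
move=> h h' hh; apply/propext; split => H t tm; first by rewrite -hh// H.
by rewrite hh// H.
Qed.

(** The conditional probabilities of the admissible parents add up to 1, so each of the finitely
    many valid histories is continued by an invalid choice with probability 0. *)
Lemma past_valid m : P [set w | ~ valid m (past w)] = 0%E.
Proof.
elim: m => [|m IH].
  rewrite (_ : [set _ | _] = set0) ?measure0//.
  by apply/seteqP; split => // w; apply => -[|t].
pose F h := cell m h `\` [set w | (0 < c m.+1 w <= m.+1)%N].
have mF h : measurable (F h).
  by apply: measurableD; [exact: measurable_cell|exact: measurable_coord_le].
have F0 h : valid m h -> P (F h) = 0%E.
  move=> vh; transitivity (P (cell m h) -
      P (cell m h `&` [set w | (0 < c m.+1 w <= m.+1)%N]))%E.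
    apply: measureD; [exact: measurable_cell|exact: measurable_coord_le|].
    by rewrite (le_lt_trans (probability_le1 P (measurable_cell m h)))// ltry.
  rewrite (cell_choices vh (leqnn _)); case: tp => _ -> // _.
  by rewrite mul1e subee// fin_num_measure//; exact: measurable_cell.
have [mU leU] := probability_union_le (histories m) mF.
have mV k : measurable [set w | ~ valid k (past w)].
  by apply: (measurable_past (m := k) (B := fun h => ~ valid k h)) => h h' /adapted_valid ->.
apply/eqP; rewrite eq_le measure_ge0 andbT.
apply: (@le_trans _ _ (P ([set w | ~ valid m (past w)] `|`
    [set w | exists2 h, h \in histories m & F h w]))).
  apply: le_measure; rewrite ?inE//; first exact: measurableU.
  move=> w /= nv; have [vm|] := pselect (valid m (past w)); last by left.
  right; have [h hin hh] := histories_complete vm; exists h => //; split => //.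
  move=> /= cm; apply: nv => t /andP[t0]; rewrite leq_eqVlt => /orP[/eqP->//|tm].
  by apply: vm; rewrite t0.
apply: (@le_trans _ _ (P [set w | ~ valid m (past w)] +
    P [set w | exists2 h, h \in histories m & F h w])%E); first exact: measureU2.
rewrite IH add0e; apply: (le_trans leU).
rewrite big_seq big1// => h hin; apply: F0; exact: histories_valid hin.
Qed.

(** An upper bound is enough: lower bounds are obtained from complements. *)
Lemma probability_past_le m (B : (nat -> nat) -> bool) : adapted m B ->
  (P [set w | B (past w)] <= (Ex p m (fun h => (B h)%:R))%:E)%E.
Proof.
move=> aB; pose s := [seq h <- histories m | B h].
have [mU leU] := probability_union_le s (measurable_cell m).
have mV : measurable [set w | ~ valid m (past w)].
  by apply: (measurable_past (m := m) (B := fun h => ~ valid m h)) => h h' /adapted_valid ->.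
have mB : measurable [set w | B (past w)].
  by apply: (measurable_past (m := m) (B := fun h => B h)) => h h' /aB ->.
apply: (@le_trans _ _ (P ([set w | ~ valid m (past w)] `|`
    [set w | exists2 h, h \in s & cell m h w]))).
  apply: le_measure; rewrite ?inE//; first exact: measurableU.
  move=> w /= Bw; have [vm|] := pselect (valid m (past w)); last by left.
  right; have [h hin hh] := histories_complete vm; exists h => //.
  by rewrite mem_filter hin andbT -(aB _ _ hh).
apply: (@le_trans _ _ (P [set w | ~ valid m (past w)] +
    P [set w | exists2 h, h \in s & cell m h w])%E); first exact: measureU2.
rewrite past_valid add0e; apply: (le_trans leU).
rewrite (Ex_histories tp) -sumEFin big_filter big_mkcond/= big_seq [leRHS]big_seq.
apply: lee_sum => h hin; have vh := histories_valid hin.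
by case: ifP => Bh; rewrite ?mulr1 ?mulr0// probability_cell.
Qed.

End transfer.

(** * Expansion and distribution function of the test statistic *)

Section statistic.
Variables (R : realType) (eps a : R).
Hypotheses (eps0 : 0 < eps) (aeps : -1 + eps < a < eps^-1).
Implicit Types (h : nat -> nat) (m : nat).

Let a1 : -1 < a := alpha_gtN1 eps0 aeps.
Let p := pa_kernel a.
Let tp : transition p := pa_transition a1.
Let Vt := eff_info a.
Let Vt0 : 0 < Vt. Proof. exact: eff_info_gt0 aeps. Qed.

Definition pivot m h : R := mart a m (eff_score a) h / Num.sqrt (m.+1%:R * Vt).

(** The normalization at the estimated alpha is replaced by the one at [a], by continuity and
    consistency. The error splits as [(y - q) s + q (s - s0)], with [s] and [q] bounded. *)
Lemma stat_expansion (B0 e : R) : 0 <= B0 -> 0 < e -> exists2 eta, 0 < eta & exists N,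
  forall m h, (N <= m)%N -> valid m h -> regular a B0 eta m h ->
  forall th, is_MLE eps h m.+1 th ->
  `|test_stat m.+1 th.1 th.2 - Num.min 0 (pivot m h)| <= e.
Proof.
move=> B00 e0; set s0 := Num.sqrt Vt.
have s00 : 0 < s0 by rewrite sqrtr_gt0.
pose zeta := e / (2 * (s0 + 1)).
have z0 : 0 < zeta by rewrite divr_gt0// mulr_gt0// addr_gt0.
pose C := B0 / Vt; have C0 : 0 <= C by rewrite divr_ge0// ltW.
pose z2 := Num.min 1 (e / (2 * (C + 1))).
have z20 : 0 < z2 by rewrite lt_min ltr01 divr_gt0// mulr_gt0// ltr_wpDl.
have [eta [B [eta0 B_ge0 [N1 H1]]]] := mle_expansion eps0 aeps B00 z0.
have sc : {for a, continuous (fun al => Num.sqrt (@eff_info R al))}.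
  apply: (@cvg_comp _ _ _ (@eff_info R) (@Num.sqrt R)); first exact: (eff_info_continuous eps0 aeps).
  exact: sqrt_continuous.
have [del del0 Hdel] : exists2 del : R, 0 < del & forall al, `|al - a| <= del ->
    `|Num.sqrt (eff_info al) - s0| <= z2.
  have /cvgrPdist_le/(_ _ z20)/nbhs_ballP [r r0 Hr] := sc; exists (r / 2); first by rewrite divr_gt0.
  move=> al ala; rewrite distrC; apply: (Hr al); rewrite /ball/= distrC.
  by apply: (le_lt_trans ala); have : 0 < r by []; lra.
have [N2 HN2] := sqrt_large B del0.
exists eta => //; exists (maxn N1 N2) => m h; rewrite geq_max => /andP[mN1 mN2] vh reg th [tth mle].
have [ex expn] := H1 m h mN1 vh reg.
have [uB Y] := expn th (mle ex).
set n : R := m.+1%:R in uB Y *.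
have n0 : 0 < n by rewrite ltr0n.
have sn0 : 0 < Num.sqrt n by rewrite sqrtr_gt0.
have ala : `|th.1 - a| <= del.
  rewrite -(ler_pM2l sn0); apply: (@le_trans _ _ B); last by rewrite mulrC; exact: HN2.
  by apply: le_trans uB; rewrite ler_wpM2l ?(ltW sn0)// lerDl.
have s_close := Hdel _ ala.
have [t1 t2] := tth.
rewrite (test_statE eps0 t1) -/n; set s := Num.sqrt (eff_info th.1) in s_close *.
set D := mart a m (eff_score a) h / Num.sqrt n in Y.
have pE : pivot m h = D / Vt * s0.
  rewrite /pivot /D -/n sqrtrM ?(ltW n0)// -/s0 -[Vt in RHS](sqr_sqrtr (ltW Vt0)) -/s0.
  by field; rewrite !gt_eqF.
have -> : Num.min 0 (pivot m h) = Num.min 0 (D / Vt) * s0.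
  by rewrite pE minr_pMl ?(ltW s00)// mul0r.
set q := Num.min 0 (D / Vt) in Y *.
have qC : `|q| <= C.
  have DB : `|D| <= B0.
    rewrite /D normrM [`|_^-1|]ger0_norm ?invr_ge0 ?(ltW sn0)// ler_pdivrMr//.
    by case: reg.
  have DV : `|D / Vt| <= C.
    by rewrite normrM [`|_^-1|]ger0_norm ?invr_ge0 ?(ltW Vt0)// ler_wpM2r// invr_ge0 ltW.
  by rewrite /q; case: (leP 0 (D / Vt)) => // _; rewrite normr0.
set y := Num.sqrt n * (th.2 - 1) in Y *.
have -> : y * s - q * s0 = (y - q) * s + q * (s - s0) by ring.
have z21 : z2 <= 1 by rewrite ge_min lexx.
have ss : `|s| <= s0 + 1.
  have -> : s = (s - s0) + s0 by ring.
  apply: (le_trans (ler_normD _ _)); rewrite [`|s0|]ger0_norm ?(ltW s00)// addrC lerD2l.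
  exact: le_trans z21.
apply: (le_trans (ler_normD _ _)); rewrite !normrM.
have e1 : `|y - q| * `|s| <= e / 2.
  apply: (@le_trans _ _ (zeta * (s0 + 1))); first by apply: ler_pM.
  by rewrite /zeta le_eqVlt; apply/orP; left; apply/eqP; field; rewrite gt_eqF// addr_gt0.
have e2 : `|q| * `|s - s0| <= e / 2.
  apply: (@le_trans _ _ (C * z2)); first by apply: ler_pM.
  apply: (@le_trans _ _ ((C + 1) * (e / (2 * (C + 1))))).
    by apply: ler_pM => //; [exact: ltW|rewrite lerDl|rewrite ge_min lexx orbT].
  by rewrite le_eqVlt; apply/orP; left; apply/eqP; field; rewrite gt_eqF// ltr_wpDl.
by lra.
Qed.

Lemma pivot_clt y : Ex p m (fun h => (pivot m h <= y)%R%:R) @[m --> \oo] --> gcdf y.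
Proof. exact: (mart_clt eps0 aeps (eff_score_dominated eps0 aeps) Vt0). Qed.

Lemma pivot_adapted m : adapted m (pivot m).
Proof.
move=> h h' hh; congr (_ / _); apply: eq_bigr => s _; apply: mart_adapted => t /andP[t0 ts].
by apply: hh; rewrite t0 (leq_trans ts)// ltn_ord.
Qed.

Lemma regular_adapted B0 eta m : adapted m (regular a B0 eta m).
Proof.
have mA phi : adapted m (mart a m phi).
  move=> h h' hh; apply: eq_bigr => s _; apply: mart_adapted => t /andP[t0 ts].
  by apply: hh; rewrite t0 (leq_trans ts)// ltn_ord.
have cA (s : 'I_m) phi : adapted m (cmean a s phi).
  by apply: adapted_leq (@cmean_adapted _ a s phi); exact: ltnW.
have vA phi : adapted m (cvar_dev a m phi).
  move=> h h' hh; rewrite /cvar_dev; congr (`| _ - _ |); apply: eq_bigr => s _.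
  by rewrite /cvar (cA s phi _ _ hh) (cA s _ _ _ hh).
move=> h h' hh; rewrite /regular (mA _ _ _ hh) (mA (eff_score a) _ _ hh) !(vA _ _ _ hh).
congr [/\ _, _, _, _ & _].
  by congr (_ <= _); apply: eq_bigr => k _; rewrite (mA _ _ _ hh).
congr (_ <= _); apply: eq_bigr => s _; apply: eq_bigr => k _.
by rewrite (cA s _ _ _ hh).
Qed.

End statistic.

Section cdf.
Variables (R : realType) (d : measure_display) (Omega : measurableType d).
Variables (P : probability Omega R) (eps a : R) (c : nat -> {RV P >-> nat}).
Variables (alphahat betahat : nat -> {RV P >-> R}).
Hypotheses (eps0 : 0 < eps) (aeps : -1 + eps < a < eps^-1).
Hypothesis PA : is_PA_tree (pa_fun a 1) c.
Hypothesis MLE : forall n w, (1 <= n)%N ->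
  is_MLE eps (past c w) n (alphahat n w, betahat n w).

Let a1 : -1 < a := alpha_gtN1 eps0 aeps.
Let p := pa_kernel a.
Let tp : transition p := pa_transition a1.

Let T n w := test_stat n (alphahat n w) (betahat n w).

Lemma stat_le0 n w : T n w <= 0.
Proof.
(* At [n = 0] the estimator is unconstrained, but [sqrt 0 = 0] makes the statistic 0. *)
case: n => [|n]; first by rewrite /T /test_stat sqrtr0 !mul0r.
have [[t1 /andP[_ t2]] _] := MLE w (ltn0Sn n).
rewrite /T (test_statE eps0 t1) mulr_le0_ge0 ?sqrtr_ge0// mulr_ge0_le0 ?sqrtr_ge0//.
by rewrite subr_le0.
Qed.

Lemma stat_measurable n : measurable_fun setT (T n).
Proof.
case: n => [|n].
  rewrite (_ : T 0 = cst 0); first exact: measurable_cst.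
  by apply/funext => w; rewrite /T /test_stat sqrtr0 !mul0r.
have rng w : -1 + eps < alphahat n.+1 w < eps^-1 by have [[]] := MLE w (ltn0Sn n).
rewrite (_ : T n.+1 = (fun w => Num.sqrt n.+1%:R * (betahat n.+1 w - 1) *
    Num.sqrt (eff_info (alphahat n.+1 w)))); last first.
  by apply/funext => w; rewrite /T (test_statE eps0 (rng w)).
apply: measurable_funM.
  by apply: measurable_funM; [exact: measurable_cst|apply: measurable_funB].
apply: (@measurable_comp _ _ _ _ _ _ `]-1 + eps, eps^-1[%classic
  (fun al => Num.sqrt (eff_info al)) setT (alphahat n.+1)) => //.
- by move=> _ [w _ <-] /=; rewrite in_itv/= rng.
- apply: open_continuous_measurable_fun; first exact: interval_open.
  move=> al; rewrite inE/= in_itv/= => ale.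
  apply: (@cvg_comp _ _ _ (@eff_info R) (@Num.sqrt R)); first exact: (eff_info_continuous eps0 ale).
  exact: sqrt_continuous.
Qed.

Lemma probability_event_le m (A : set Omega) (B : (nat -> nat) -> bool) :
  measurable A -> adapted m B ->
  (forall w, valid m (past c w) -> A w -> B (past c w)) ->
  fine (P A) <= Ex p m (fun h => (B h)%:R).
Proof.
move=> mA aB AB.
have mV : measurable [set w | ~ valid m (past c w)].
  by apply: (measurable_past c (m := m) (B := fun h => ~ valid m h)) => h h' /adapted_valid ->.
have mB : measurable [set w | B (past c w)].
  by apply: (measurable_past c (m := m) (B := fun h => B h)) => h h' /aB ->.
rewrite -lee_fin fineK ?fin_num_measure//; apply: le_trans (probability_past_le a1 PA aB).
apply: (@le_trans _ _ (P ([set w | ~ valid m (past c w)] `|` [set w | B (past c w)]))).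
  apply: le_measure; rewrite ?inE//; first exact: measurableU.
  by move=> w Aw; have [vw|] := pselect (valid m (past c w)); [right; exact: AB|left].
apply: (@le_trans _ _ (P [set w | ~ valid m (past c w)] + P [set w | B (past c w)])%E).
  exact: measureU2.
by rewrite (past_valid a1 PA) add0e.
Qed.

Lemma stat_cdf (y : R) : y < 0 -> (fun n => fine (P [set w | T n w <= y])) @ \oo --> gcdf y.
Proof.
move=> y0; apply/cvgrPdist_le => e e0.
(* [del <= - y / 2] keeps [y + del] negative, where the minimum with 0 has no effect. The quarters
   of [e] go to the irregular event, the limit law, and the shift by [del]. *)
pose del := Num.min (e / 4) (- y / 2).
have del0 : 0 < del by rewrite lt_min !divr_gt0// oppr_gt0.
have [dele dely] : del <= e / 4 /\ del <= - y / 2 by rewrite !ge_min !lexx orbT.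
have e4 : 0 < e / 4 by rewrite divr_gt0.
have [B0 B00 HB0] := regular_prob eps0 aeps e4.
have [eta eta0 [N1 H1]] := stat_expansion eps0 aeps B00 del0.
have [N2 H2] := HB0 _ eta0.
have /cvgrPdist_le/(_ _ e4)[N3 _ H3] := @pivot_clt _ _ _ eps0 aeps (y + del).
have /cvgrPdist_le/(_ _ e4)[N4 _ H4] := @pivot_clt _ _ _ eps0 aeps (y - del).
exists (maxn (maxn N1 N2) (maxn N3 N4)).+1 => // -[//|m] /=; rewrite ltnS !geq_max.
move=> /andP[/andP[m1 m2] /andP[m3 m4]].
have irr := H2 m m2; have {}H3 := H3 m m3; have {}H4 := H4 m m4.
have mT (D : set R) : measurable D -> measurable (T m.+1 @^-1` D).
  by move=> mD; rewrite -[X in measurable X]setTI; exact: stat_measurable.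
have mle : measurable [set w | T m.+1 w <= y].
  rewrite (_ : [set _ | _] = T m.+1 @^-1` `]-oo, y]%classic); first by apply: mT; exact: measurable_itv.
  by apply/seteqP; split => w /=; rewrite in_itv.
have ra : adapted m (fun h => ~~ `[< regular a B0 eta m h >]).
  by move=> h h' hh; rewrite (regular_adapted a B0 eta hh).
have expn w : valid m (past c w) -> regular a B0 eta m (past c w) ->
    `|T m.+1 w - Num.min 0 (pivot a m (past c w))| <= del.
  by move=> vw rw; exact: (H1 m _ m1 vw rw (alphahat m.+1 w, betahat m.+1 w) (MLE w (ltn0Sn m))).
have up : fine (P [set w | T m.+1 w <= y]) <=
    Ex p m (fun h => (~~ `[< regular a B0 eta m h >])%:R) +
    Ex p m (fun h => (pivot a m h <= y + del)%R%:R).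
  apply: (@le_trans _ _ (Ex p m (fun h =>
      (~~ `[< regular a B0 eta m h >] || (pivot a m h <= y + del))%:R))).
    apply: probability_event_le => //.
      by move=> h h' hh; rewrite (ra h h' hh) (pivot_adapted a hh).
    move=> w vw /= Ty; case: asboolP => //= rw; have := expn w vw rw.
    rewrite ler_norml; case: (leP 0 (pivot a m (past c w))) => q /andP[? ?]; last by lra.
    by have : y + del < 0 by [lra]; lra.
  rewrite -(ExD tp); apply: (Ex_le tp) => h _.
  by case: (~~ _); case: (pivot a m h <= _) => /=; rewrite ?addr0 ?add0r ?lerDl.
have lo : 1 - fine (P [set w | T m.+1 w <= y]) <=
    Ex p m (fun h => (~~ `[< regular a B0 eta m h >])%:R) +
    (1 - Ex p m (fun h => (pivot a m h <= y - del)%R%:R)).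
  have <- : fine (P (~` [set w | T m.+1 w <= y])) = 1 - fine (P [set w | T m.+1 w <= y]).
    by rewrite probability_setC// fineB// fin_num_measure.
  apply: (@le_trans _ _ (Ex p m (fun h =>
      (~~ `[< regular a B0 eta m h >] || ~~ (pivot a m h <= y - del))%:R))).
    apply: probability_event_le; first exact: measurableC.
      by move=> h h' hh; rewrite (ra h h' hh) (pivot_adapted a hh).
    move=> w vw /= Ty; case: asboolP => //= rw; have := expn w vw rw.
    move/negP : Ty; rewrite -!ltNge => Ty.
    rewrite ler_norml; case: (leP 0 (pivot a m (past c w))) => q /andP[? ?]; last by lra.
    by have : y < 0 by []; lra.
  rewrite -[X in _ + (X - _)](Ex_cst tp m 1) -(ExB tp) -(ExD tp); apply: (Ex_le tp) => h _.
  by case: (~~ `[< _ >]); case: (pivot a m h <= _) => /=; rewrite ?subrr ?subr0 ?addr0 ?add0r ?lerDl.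
have l1 := gcdf_lip (y + del) y; have l2 := gcdf_lip (y - del) y.
move: l1 l2 H3 H4.
rewrite (_ : y + del - y = del); last by ring.
rewrite (_ : y - del - y = - del); last by ring.
rewrite normrN [`|del|]ger0_norm ?(ltW del0)// !ler_norml.
move=> /andP[? ?] /andP[? ?] /andP[? ?] /andP[? ?].
by apply/andP; split; lra.
Qed.

End cdf.

(** * Weak convergence from distribution functions on the negative half-line *)

Section step_approximation.
Variables (R : realType) (g : R -> R).
Hypothesis gc : continuous g.

Lemma uniformly_continuous_segment (l r e : R) : 0 < e ->
  exists2 del : R, 0 < del & forall x y, l <= x <= r -> `|x - y| <= del -> `|g x - g y| <= e.
Proof.
move=> e0; have e2 : 0 < e / 2 by rewrite divr_gt0.
have /compact_near_coveringP cov := @segment_compact R l r.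
have H := cov R (0^'+) (fun del x => forall y, `|x - y| <= del -> `|g x - g y| <= e).
have : \forall del \near 0^'+, [set` `[l, r]] `<=` (fun x => forall y, `|x - y| <= del -> `|g x - g y| <= e).
  apply: H => x0 _; have /cvgrPdist_le/(_ _ e2)/nbhs_ballP[s /= s0 Hs] := gc (x := x0).
  have s2 : 0 < s / 2 by rewrite divr_gt0.
  near=> x del => y /= xy.
  have xx : `|x0 - x| < s / 2 by near: x; apply: cvgr_dist_lt => //; exact: cvg_id.
  have del2 : del < s / 2 by near: del; exact: nbhs_right_lt.
  have g1 : `|g x0 - g x| <= e / 2 by apply: Hs; rewrite /ball/=; lra.
  have g2 : `|g x0 - g y| <= e / 2.
    apply: Hs; rewrite /ball/= (_ : x0 - y = (x0 - x) + (x - y)); last by ring.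
    by apply: (le_lt_trans (ler_normD _ _)); lra.
  rewrite (_ : g x - g y = (g x0 - g y) - (g x0 - g x)); last by ring.
  by apply: (le_trans (ler_normB _ _)); lra.
move=> nH; have : \forall del \near (0 : R)^'+, 0 < del /\
    ([set` `[l, r]] `<=` (fun x => forall y, `|x - y| <= del -> `|g x - g y| <= e)).
  by near=> del; split; near: del; [exact: nbhs_right_gt|exact: nH].
move=> /filter_ex[del [del0 Hdel]]; exists del => // x y xlr.
by apply: Hdel; rewrite /= in_itv.
Unshelve. all: by end_near.
Qed.

(** On a grid of [-L, 0] the sum telescopes to [g 0 - g (y j)], with [y j] the first grid point at
    or after [x]. All thresholds are negative, so the distribution function at 0 never enters. *)
Lemma step_approximation (M L e : R) : (forall x, `|g x| <= M) -> 0 < L -> 0 < e ->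
  exists (N : nat) (y : nat -> R), [/\ forall i, (i < N)%N -> y i < 0 &
    forall x, x <= 0 ->
    `|g x - (g 0 - \sum_(i < N) (g (y i.+1) - g (y i)) * (x <= y i)%R%:R)| <=
    e + 2 * M * (x <= - L)%R%:R].
Proof.
move=> gM L0 e0; have [del del0 uc] := uniformly_continuous_segment (- L) 0 e0.
have M0 : 0 <= M by apply: le_trans (gM 0).
pose N := (Num.truncn (L / del)).+1.
have N0 : 0 < N%:R :> R by rewrite ltr0n.
pose y i : R := - L + i%:R * (L / N%:R).
have LN : 0 < L / N%:R by rewrite divr_gt0.
have LNdel : L / N%:R <= del.
  rewrite ler_pdivrMr// mulrC -ler_pdivrMr//; apply/ltW.
  by rewrite /N; exact: truncnS_gt.
have yN : y N = 0 by rewrite /y; field; rewrite gt_eqF.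
have y0 : y 0%N = - L by rewrite /y mul0r addr0.
have yS i : y i.+1 = y i + L / N%:R by rewrite /y -natr1; ring.
have ymono i j : (y i <= y j) = (i <= j)%N.
  by rewrite /y lerD2l ler_pM2r// ler_nat.
exists N, y; split => [i iN|x x0].
  by rewrite -yN ltNge ymono -ltnNge.
have exj : exists j, x <= y j by exists N; rewrite yN.
case: (ex_minnP exj) => j xj jmin.
have jN : (j <= N)%N by apply: jmin; rewrite yN.
have ind i : (x <= y i) = (j <= i)%N.
  by apply/idP/idP => [/jmin//|ji]; apply: (le_trans xj); rewrite ymono.
have -> : \sum_(i < N) (g (y i.+1) - g (y i)) * (x <= y i)%R%:R = g 0 - g (y j).
  under eq_bigr do rewrite ind.
  rewrite -(big_mkord predT (fun i => (g (y i.+1) - g (y i)) * (j <= i)%N%:R)).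
  rewrite (big_cat_nat (n := j))//= big_nat_cond big1 ?add0r; last first.
    by move=> i /andP[/andP[_ ij] _]; rewrite leqNgt ij mulr0.
  rewrite -[X in g X - _]yN -(telescope_sumr (fun i => g (y i)) jN).
  by apply: eq_big_nat => i /andP[-> _]; rewrite mulr1.
rewrite (_ : g 0 - (g 0 - g (y j)) = g (y j)); last by ring.
have [xL|xL] := leP x (- L).
  rewrite mulr1; apply: (le_trans (ler_normB _ _)).
  by have := gM x; have := gM (y j); have := e0; lra.
rewrite mulr0 addr0; apply: uc; first by rewrite (ltW xL).
case: j => [|j] in xj jmin jN ind *; first by rewrite y0 in xj; lra.
have : y j < x by rewrite ltNge ind ltnn.
by rewrite yS in xj *; rewrite ler_norml => ?; apply/andP; split; lra.
Qed.

End step_approximation.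

Section bounded_expectation.
Variables (R : realType) (d : measure_display) (T : measurableType d) (P : probability T R).
Implicit Types (f h : T -> R) (X : T -> R).

Definition bmeas f := measurable_fun setT f /\ exists M, forall w, `|f w| <= M.

Lemma bmeas_Lfun f : bmeas f -> f \in Lfun P 1.
Proof.
move=> [mf [M fM]]; apply/Lfun1_integrable; apply: measurable_bounded_integrable => //.
  by rewrite (le_lt_trans (probability_le1 P measurableT))// ltry.
by exists M; split; [exact: num_real|move=> x Mx w _ /=; exact: le_trans (fM w) (ltW Mx)].
Qed.

Lemma bmeas_cst k : bmeas (fun=> k).
Proof. by split; [exact: measurable_cst|exists `|k|]. Qed.

Lemma bmeas_lin k f h : bmeas f -> bmeas h -> bmeas (fun w => k * f w + h w).
Proof.
move=> [mf [M fM]] [mh [N hN]]; split.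
  by apply: measurable_funD => //; apply: measurable_funM => //; exact: measurable_cst.
exists (`|k| * M + N) => w; apply: (le_trans (ler_normD _ _)).
by apply: lerD => //; rewrite normrM ler_wpM2l.
Qed.

Lemma bmeas_indic X y : measurable_fun setT X -> bmeas (fun w => (X w <= y)%R%:R).
Proof.
move=> mX; have mA : measurable [set w | X w <= y].
  rewrite (_ : [set _ | _] = setT `&` X @^-1` `]-oo, y]%classic).
    by apply: mX => //; exact: measurable_itv.
  by apply/seteqP; split => w /=; rewrite in_itv/= => // -[].
rewrite (_ : (fun w => _) = \1_[set w | X w <= y]); last first.
  by apply/funext => w; rewrite indicE mem_setE.
split; first exact: measurable_indic.
by exists 1 => w; rewrite indicE; case: (_ \in _); rewrite ?normr0 ?normr1.
Qed.

Definition mean f : R := fine ('E_P[f])%E.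

Lemma meanE f : bmeas f -> ('E_P[f] = (mean f)%:E)%E.
Proof. by move=> bf; rewrite /mean fineK// expectation_fin_num// bmeas_Lfun. Qed.

Lemma mean_cst k : mean (fun=> k) = k.
Proof. by rewrite /mean (expectation_cst P k). Qed.

Lemma mean_lin k f h : bmeas f -> bmeas h -> mean (fun w => k * f w + h w) = k * mean f + mean h.
Proof.
move=> bf bh; have bkf : bmeas (fun w => k * f w).
  have := bmeas_lin k bf (bmeas_cst 0).
  by rewrite (_ : (fun w => k * f w + 0) = (fun w => k * f w))//; apply/funext => w; rewrite addr0.
apply: EFin_inj; rewrite -meanE; last exact: bmeas_lin.
rewrite (_ : (fun w => _) = (k \o* f) \+ h); last first.
  by apply/funext => w /=; rewrite mulrC.
have kfE : k \o* f = (fun w => k * f w) by apply/funext => w /=; rewrite mulrC.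
rewrite expectationD; [|by rewrite kfE; exact: bmeas_Lfun|exact: bmeas_Lfun].
by rewrite expectationZl ?bmeas_Lfun// !meanE.
Qed.

Lemma mean_le f h : bmeas f -> bmeas h -> (forall w, f w <= h w) -> mean f <= mean h.
Proof.
move=> bf bh fh; rewrite -subr_ge0.
have -> : mean h - mean f = mean (fun w => -1 * f w + h w).
  by rewrite mean_lin//; ring.
apply: fine_ge0; apply: expectation_ge0 => w.
by have := fh w; lra.
Qed.

Lemma mean_indic X y : measurable_fun setT X ->
  mean (fun w => (X w <= y)%R%:R) = fine (P [set w | X w <= y]).
Proof.
move=> mX; have mA : measurable [set w | X w <= y].
  rewrite (_ : [set _ | _] = setT `&` X @^-1` `]-oo, y]%classic).
    by apply: mX => //; exact: measurable_itv.
  by apply/seteqP; split => w /=; rewrite in_itv/= => // -[].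
rewrite (_ : (fun w => _) = \1_[set w | X w <= y]); last first.
  by apply/funext => w; rewrite indicE mem_setE.
by rewrite /mean expectation_indic.
Qed.

Lemma mean_sum N (k : nat -> R) (f : nat -> T -> R) : (forall i, bmeas (f i)) ->
  bmeas (fun w => \sum_(i < N) k i * f i w) /\
  mean (fun w => \sum_(i < N) k i * f i w) = \sum_(i < N) k i * mean (f i).
Proof.
move=> bf; elim: N => [|N [bN IH]].
  rewrite big_ord0 (_ : (fun w => _) = (fun=> 0)); last by apply/funext => w; rewrite big_ord0.
  by split; [exact: bmeas_cst|exact: mean_cst].
rewrite (_ : (fun w => _) = (fun w => k N * f N w + \sum_(i < N) k i * f i w)); last first.
  by apply/funext => w; rewrite big_ord_recr addrC.
split; first exact: bmeas_lin.
by rewrite mean_lin// IH big_ord_recr addrC.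
Qed.

Lemma mean_step (g : R -> R) (N : nat) (y : nat -> R) (L M e : R) X :
  continuous g -> (forall x, `|g x| <= M) -> measurable_fun setT X -> (forall w, X w <= 0) ->
  (forall x, x <= 0 ->
    `|g x - (g 0 - \sum_(i < N) (g (y i.+1) - g (y i)) * (x <= y i)%R%:R)| <=
    e + 2 * M * (x <= - L)%R%:R) ->
  `|mean (g \o X) - (g 0 - \sum_(i < N) (g (y i.+1) - g (y i)) * fine (P [set w | X w <= y i]))| <=
  e + 2 * M * fine (P [set w | X w <= - L]).
Proof.
move=> gc gM mX X0 approx.
have bg : bmeas (g \o X).
  split; last by exists M => w; exact: gM.
  by apply: measurableT_comp => //; exact: continuous_measurable_fun.
have [bs ms] := mean_sum N (fun i => g (y i.+1) - g (y i)) (fun i => bmeas_indic (y i) mX).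
pose s w := -1 * (\sum_(i < N) (g (y i.+1) - g (y i)) * (X w <= y i)%R%:R) + g 0.
have bs' : bmeas s by apply: bmeas_lin => //; exact: bmeas_cst.
pose b w := 2 * M * (X w <= - L)%R%:R + e.
have bb : bmeas b by apply: bmeas_lin; [exact: bmeas_indic|exact: bmeas_cst].
have sE : mean s = g 0 - \sum_(i < N) (g (y i.+1) - g (y i)) * fine (P [set w | X w <= y i]).
  rewrite mean_lin//; last exact: bmeas_cst.
  rewrite mean_cst ms mulN1r addrC; congr (_ - _).
  by apply: eq_bigr => i _; rewrite mean_indic.
have bE : mean b = e + 2 * M * fine (P [set w | X w <= - L]).
  rewrite mean_lin; [|exact: bmeas_indic|exact: bmeas_cst].
  by rewrite mean_cst mean_indic// addrC.
have ab w : `|g (X w) - s w| <= b w.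
  by have := approx (X w) (X0 w); rewrite /s /b mulN1r [- _ + _]addrC [_ + e]addrC.
rewrite -sE -bE ler_norml; apply/andP; split.
  have : mean s <= mean (fun w => 1 * b w + (g \o X) w).
    apply: mean_le => // [|w]; first exact: bmeas_lin.
    by have := ab w; rewrite ler_norml /= => /andP[]; lra.
  by rewrite mean_lin// mul1r; lra.
have : mean (g \o X) <= mean (fun w => 1 * b w + s w).
  apply: mean_le => // [|w]; first exact: bmeas_lin.
  by have := ab w; rewrite ler_norml /= => /andP[]; lra.
by rewrite mean_lin// mul1r; lra.
Qed.

End bounded_expectation.

(** For nonpositive variables any atom at 0 is carried by the term [g 0] of the step approximation;
    the decay of [F] provides tightness. *)
Lemma cvg_expectation_of_cdf (R : realType)
    (d : measure_display) (T : measurableType d) (P : probability T R) (X : nat -> T -> R)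
    (d' : measure_display) (T' : measurableType d') (P' : probability T' R) (Y : T' -> R)
    (F : R -> R) (g : R -> R) :
  (forall n, measurable_fun setT (X n)) -> measurable_fun setT Y ->
  (forall n w, X n w <= 0) -> (forall w, Y w <= 0) ->
  (forall y, y < 0 -> (fun n => fine (P [set w | X n w <= y])) @ \oo --> F y) ->
  (forall y, y < 0 -> fine (P' [set w | Y w <= y]) = F y) ->
  (forall e, 0 < e -> exists2 L, 0 < L & F (- L) <= e) ->
  continuous g -> bounded_fun g ->
  ((fun n => 'E_P[g \o X n]) @ \oo --> 'E_P'[g \o Y])%E.
Proof.
move=> mX mY X0 Y0 FX FY Ftail gc [r [_ Hr]].
pose M := r + 1; have gM x : `|g x| <= M by apply: (Hr M) => //; rewrite ltrDl.
have M0 : 0 <= M by apply: le_trans (gM 0).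
have bX n : bmeas (g \o X n).
  split; last by exists M => w; exact: gM.
  by apply: measurableT_comp => //; exact: continuous_measurable_fun.
have bY : bmeas (g \o Y).
  split; last by exists M => w; exact: gM.
  by apply: measurableT_comp => //; exact: continuous_measurable_fun.
rewrite meanE//; under eq_fun do rewrite meanE//.
apply: cvg_EFin; first by near=> n.
rewrite /=; apply/cvgrPdist_le => e e0.
have M1 : 0 < 2 * M + 1 by rewrite ltr_wpDl// mulr_ge0.
(* The errors add up to [3 e / 8] from the step functions and [e / 2] from the two tails below
   [- L]. *)
pose e1 := e / 8 / (2 * M + 1); have e10 : 0 < e1 by rewrite !divr_gt0.
have [L L0 FL] := Ftail _ e10.
have e8 : 0 < e / 8 by rewrite divr_gt0.
have [N [y [yneg approx]]] := step_approximation gc gM L0 e8.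
pose S (G : R -> R) := g 0 - \sum_(i < N) (g (y i.+1) - g (y i)) * G (y i).
have SX : (fun n => S (fun t => fine (P [set w | X n w <= t]))) @ \oo --> S F.
  apply: cvgB; first exact: cvg_cst.
  apply: cvg_sumr => i; apply: cvgM; first exact: cvg_cst.
  by apply: FX; exact: yneg.
have EY : `|mean P' (g \o Y) - S F| <= e / 8 + 2 * M * F (- L).
  have := mean_step P' gc gM mY Y0 approx.
  rewrite FY; last by rewrite oppr_lt0.
  by rewrite (eq_bigr (fun i : 'I_N => (g (y i.+1) - g (y i)) * F (y i)))// => i _; rewrite FY// yneg.
have L0' : - L < 0 by rewrite oppr_lt0.
have tail t : t <= 2 * e1 -> 2 * M * t <= e / 4.
  move=> te; apply: (@le_trans _ _ (2 * M * (2 * e1))); first by rewrite ler_wpM2l// mulr_ge0.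
  rewrite (_ : 2 * M * (2 * e1) = (2 * M / (2 * M + 1)) * (e / 4)); last first.
    by rewrite /e1; field; rewrite gt_eqF.
  by rewrite ler_piMl ?divr_ge0 ?(ltW e0)// ler_pdivrMr// mul1r lerDl.
near=> n.
have n1 : `|S F - S (fun t => fine (P [set w | X n w <= t]))| <= e / 8.
  by near: n; move/cvgrPdist_le : SX; apply.
have n2 : fine (P [set w | X n w <= - L]) <= 2 * e1.
  have : `|F (- L) - fine (P [set w | X n w <= - L])| <= e1.
    by near: n; move/cvgrPdist_le : (FX _ L0'); apply.
  by rewrite ler_norml => /andP[]; lra.
have EX : `|mean P (g \o X n) - S (fun t => fine (P [set w | X n w <= t]))| <=
    e / 8 + 2 * M * fine (P [set w | X n w <= - L]).
  exact: (mean_step P gc gM (mX n) (X0 n) approx).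
have t1 := tail _ n2.
have t2 : 2 * M * F (- L) <= e / 4 by apply: tail; lra.
move: n1 EX EY t1 t2 => /=.
set s1 := S F; set s2 := S _; set p1 := 2 * M * fine _; set p2 := 2 * M * F _.
rewrite !ler_norml => /andP[? ?] /andP[? ?] /andP[? ?] ? ?.
by apply/andP; split; lra.
Unshelve. all: by end_near.
Qed.

Theorem theorem5p3 (R : realType)
    (d : measure_display) (Omega : measurableType d) (P : probability Omega R)
    (eps alpha0 : R)
    (c : nat -> {RV P >-> nat})
    (alphahat betahat : nat -> {RV P >-> R})
    (d' : measure_display) (Omega' : measurableType d')
    (P' : probability Omega' R) (Z : {RV P' >-> R})
    (eps_gt0 : 0 < eps)
    (true_param : Theta eps (alpha0, 1))
    (PA : is_PA_tree (pa_fun alpha0 1) c)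
    (MLE : forall (n : nat) (w : Omega), (1 <= n)%N ->
       is_MLE eps (fun t => c t w) n (alphahat n w, betahat n w))
    (Z_normal : standard_normal Z) :
  cvg_in_distribution P
    (fun (n : nat) (w : Omega) => test_stat n (alphahat n w) (betahat n w))
    P' (fun w : Omega' => Z w * \1_[set z : R | z <= 0] (Z w)).
Proof.
have aeps : -1 + eps < alpha0 < eps^-1 by case: true_param.
have mle n w : (1 <= n)%N -> is_MLE eps (past c w) n (alphahat n w, betahat n w).
  exact: MLE.
have mT := stat_measurable eps_gt0 mle.
pose Y w := Z w * \1_[set z : R | z <= 0] (Z w).
have YE w : Y w = if Z w <= 0 then Z w else 0.
  rewrite /Y indicE (_ : (Z w \in _) = (Z w <= 0)); last by apply/idP/idP; rewrite inE.
  by case: (Z w <= 0); rewrite ?mulr1 ?mulr0.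
have Y0 w : Y w <= 0 by rewrite YE; case: ifP.
have mneg : measurable [set z : R | z <= 0].
  rewrite (_ : [set _ | _] = `]-oo, 0]%classic); first exact: measurable_itv.
  by apply/seteqP; split => z /=; rewrite in_itv.
have mY : measurable_fun setT Y.
  apply: measurable_funM => //.
  by apply: measurableT_comp => //; exact: measurable_indic.
split=> [n||g gc gb]; [exact: mT|exact: mY|].
apply: (@cvg_expectation_of_cdf _ _ _ P _ _ _ P' Y (@gcdf R)) => //.
- by move=> n w; exact: (stat_le0 eps_gt0 mle).
- by move=> y y0; exact: (stat_cdf eps_gt0 aeps PA mle).
(* For [y < 0] the truncation is invisible: [Y <= y] exactly when [Z <= y]. *)
- move=> y y0; rewrite (_ : [set w | Y w <= y] = Z @^-1` `]-oo, y]%classic).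
    by rewrite /gcdf -Z_normal//; exact: measurable_itv.
  apply/seteqP; split => w /=; rewrite in_itv/= YE; case: ifPn => //; last first.
    by rewrite -ltNge => /ltW Zw Zy; move: (le_lt_trans (le_trans Zw Zy) y0); rewrite ltxx.
  by move=> _ y0'; move: (le_lt_trans y0' y0); rewrite ltxx.
- by move=> e e0; have [L L0 H] := gcdf_tails e0; exists L => //; case: (H L (lexx L)).
Qed.
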